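(* The automorphism group $\mathrm{Aut}(\mathbb{L}_c)$ is extremely amenable.
   Context: A topological group $G$ is extremely amenable if every continuous action of $G$ on a (nonempty) compact Hausdorff space has a fixed point. Fans. A fan is an undirected connected simple graph with all loops and with no cycles of length greater than one, with a distinguished point called the root, such that all elements other than the root have degree at most 2 (loops not counted). On a fan $T$, $s\preceq_T t$ iff $s$ lies on the path connecting $t$ and the root; $t$ is an immediate successor of $s$ if $s\preceq_T t$, $s\neq t$ and there is no $p\ne s,t$ with $s\preceq_T p\preceq_T t$. With $R$ a binary relation symbol, $R^T(s,t)$ iff $s=t$ or $t$ is an immediate successor of $s$. $\mathcal{F}$ is the family of all finite fans, viewed as discrete topological $\{R\}$-structures. A topological $\{R\}$-structure is a compact Hausdorff zero-dimensional second-countable space with a closed binary relation $R$. An epimorphism $\phi:B\to A$ is a continuous surjection such that $R^A(x_1,x_2)$ iff there are $y_1,y_2\in B$ with $\phi(y_i)=x_i$ and $R^B(y_1,y_2)$. An isomorphism is a bijective epimorphism. The family $\mathcal{F}_c$. A chain on a compact space is a family of nonempty closed subsets pairwise comparable under inclusion. $\mathcal{F}_c$ is the family of pairs $(A,\mathcal{C}^A)$ with $A\in\mathcal{F}$ and $\mathcal{C}^A$ a chain of nonempty downwards closed (for $\preceq_A$) subsets of $A$ to which no further nonempty downwards closed set can be added. $f:(B,\mathcal{C}^B)\to(A,\mathcal{C}^A)$ is an epimorphism if $f:B\to A$ is an epimorphism and $f(C)\in\mathcal{C}^A$ for all $C\in\mathcal{C}^B$. The inverse limit of a sequence $((A_n,\mathcal{C}^{A_n}),f^n_m)$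 in $\mathcal{F}_c$ (with bonding epimorphisms) is $(P,\mathcal{C}^P)$, where $P=\varprojlim(A_n,f^n_m)$, $R^P(x,y)$ iff $R^{A_n}(f_n^\infty(x),f_n^\infty(y))$ for all $n$, and $\mathcal{C}^P$ is the collection of all nonempty closed $C\subset P$ with $f_n^\infty(C)\in\mathcal{C}^{A_n}$ for all $n$. $\mathcal{F}_c^*$ is the family of all such inverse limits (it includes $\mathcal{F}_c$), with epimorphisms defined by the same formula. The limit. $\mathbb{L}_c=(\mathbb{L},\mathcal{C}^{\mathbb{L}})$ is the unique up to isomorphism structure in $\mathcal{F}_c^*$ such that: (L1) every $A_c\in\mathcal{F}_c$ is an epimorphic image of $\mathbb{L}_c$; (L2) for every finite discrete space $X$ and continuous $f:\mathbb{L}\to X$ there are $A_c\in\mathcal{F}_c$, an epimorphism $\phi:\mathbb{L}_c\to A_c$ and a function $f_0$ from the underlying set of $A_c$ to $X$ with $f=f_0\circ\phi$; (L3) for every $A_c\in\mathcal{F}_c$ and epimorphisms $\phi_1,\phi_2:\mathbb{L}_c\to A_c$ there is an isomorphism $\psi:\mathbb{L}_c\to\mathbb{L}_c$ with $\phi_2=\phi_1\circ\psi$. $\mathrm{Aut}(\mathbb{L}_c)$ is the group of all homeomorphisms $g$ of $\mathbb{L}$ that preserve $R^{\mathbb{L}}$ and satisfy $g(\mathcal{C}^{\mathbb{L}})=\mathcal{C}^{\mathbb{L}}$, with the compact-open topology. *)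

(* Defs.v *)
From HB Require Import structures.
From mathcomp Require Import all_boot.
From mathcomp Require Import all_classical.
From mathcomp Require Import topology.

Set Implicit Arguments.
Unset Strict Implicit.
Unset Printing Implicit Defensive.

Local Open Scope classical_set_scope.

HB.mixin Record isTopologicalGroup G of Topological G & Group G := {
  mulg_continuous : continuous (fun p : G * G => (p.1 * p.2)%g);
  invg_continuous : continuous (fun g : G => (g^-1)%g)
}.

#[short(type="topologicalGroupType")]
HB.structure Definition TopologicalGroup :=
  {G of isTopologicalGroup G & Topological G & Group G}.

Definition continuous_action (G : topologicalGroupType) (X : topologicalType)
    (act : G -> X -> X) : Prop :=
  [/\ forall x, act 1%g x = x,
      forall g h x, act (g * h)%g x = act g (act h x) &
      continuous (fun p : G * X => act p.1 p.2)].

Definition extremely_amenable (G : topologicalGroupType) : Prop :=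
  forall (X : topologicalType) (act : G -> X -> X),
    [set: X] !=set0 -> compact [set: X] -> hausdorff_space X ->
    continuous_action act ->
    exists x : X, forall g : G, act g x = x.

Record Rstructure := MkRstructure {
  Rspace :> topologicalType;
  Rrel : Rspace -> Rspace -> Prop;
  Rspace_compact : compact [set: Rspace];
  Rspace_hausdorff : hausdorff_space Rspace;
  Rspace_zero_dimensional : zero_dimensional Rspace;
  Rspace_second_countable : @second_countable Rspace;
  Rrel_closed : closed [set p : Rspace * Rspace | Rrel p.1 p.2]
}.

Definition epimorphism (B A : Rstructure) (phi : B -> A) : Prop :=
  [/\ continuous phi,
      forall x : A, exists y : B, phi y = x &
      forall x1 x2 : A, Rrel x1 x2 <->
        exists y1 y2 : B, [/\ phi y1 = x1, phi y2 = x2 & Rrel y1 y2]].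

(* A finite graph with all loops is given by a reflexive symmetric relation.
   [ucycle] asks that the vertices be pairwise distinct.  A duplicate-free
   closed walk of size 1 is a loop, and one of size 2 runs along one edge and
   back, so the cycles of length greater than one are the duplicate-free
   closed walks of size at least 3. *)
Record finite_fan := MkFiniteFan {
  fan_vertex :> finType;
  fan_edge : rel fan_vertex;
  fan_root : fan_vertex;
  fan_edge_loop : reflexive fan_edge;
  fan_edge_sym : symmetric fan_edge;
  fan_connected : forall s t, connect fan_edge s t;
  fan_acyclic : forall c : seq fan_vertex, ucycle fan_edge c -> size c <= 2;
  fan_degree : forall s, s != fan_root ->
    #|[set t | fan_edge s t & t != s]%SET| <= 2
}.

Section FanOrder.
Variable T : finite_fan.

Definition fan_le (s t : T) : Prop :=
  exists p : seq T,
    [/\ path (@fan_edge T) (fan_root T) p, uniq (fan_root T :: p),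
        last (fan_root T) p = t & s \in fan_root T :: p].

Definition immediate_successor (s t : T) : Prop :=
  [/\ fan_le s t, s <> t &
      ~ exists p : T, [/\ p <> s, p <> t, fan_le s p & fan_le p t]].

Definition fan_rel (s t : T) : Prop := s = t \/ immediate_successor s t.

Definition downwards_closed (D : set T) : Prop :=
  forall s t : T, fan_le s t -> D t -> D s.

End FanOrder.

Section FanRstructure.
Variable A : finite_fan.
Local Notation dA := (discrete_topology A).

Lemma fan_compact : compact [set: dA].
Proof. exact/finite_compact/(@finite_finset A). Qed.

Lemma fan_second_countable : @second_countable dA.
Proof.
exists (range (fun x : dA => [set x])).
  apply: card_le_trans (card_image_le _ _) _; exact: (@countableP A).
split=> [U _|x U Ux]; first exact: discrete_open.
by exists [set x]; [split=> //; exists x | move=> y ->; exact: nbhs_singleton].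
Qed.

Lemma fan_rel_closed : closed [set p : dA * dA | fan_rel p.1 p.2].
Proof.
move=> [x y] /(_ [set (x, y)])[|p [/= + pxy]].
  exists ([set x], [set y]); first by split; exact: discrete_set1.
  by move=> [u v] [/= -> ->].
by rewrite pxy.
Qed.

Definition fan_structure : Rstructure :=
  MkRstructure fan_compact discrete_hausdorff discrete_zero_dimension
    fan_second_countable fan_rel_closed.

End FanRstructure.

Record chain_structure := MkChainStructure {
  chain_Rstructure :> Rstructure;
  chain_family : set (set chain_Rstructure)
}.

Definition chain_epimorphism (B A : chain_structure) (phi : B -> A) : Prop :=
  epimorphism phi /\
  forall C : set B, chain_family C -> chain_family (phi @` C).

Definition chain_isomorphism (B A : chain_structure) (phi : B -> A) : Prop :=
  chain_epimorphism phi /\ bijective phi.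

Definition is_chain (X : topologicalType) (F : set (set X)) : Prop :=
  (forall C, F C -> C !=set0 /\ closed C) /\
  (forall C D, F C -> F D -> C `<=` D \/ D `<=` C).

Record Fc := MkFc {
  Fc_fan :> finite_fan;
  Fc_chain : set (set (fan_structure Fc_fan));
  Fc_is_chain : is_chain Fc_chain;
  Fc_downwards_closed : forall C, Fc_chain C -> @downwards_closed Fc_fan C;
  Fc_maximal : forall D : set (fan_structure Fc_fan),
    D !=set0 -> @downwards_closed Fc_fan D ->
    is_chain (Fc_chain `|` [set D]) -> Fc_chain D
}.

Definition Fc_structure (A : Fc) : chain_structure :=
  MkChainStructure (@Fc_chain A).

Record inverse_sequence := MkInverseSequence {
  iseq :> nat -> Fc;
  bond : forall m n, m <= n -> Fc_structure (iseq n) -> Fc_structure (iseq m);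
  bond_epi : forall m n (h : m <= n), chain_epimorphism (bond h);
  bond_id : forall n (h : n <= n) x, bond h x = x;
  bond_comp : forall k m n (hkm : k <= m) (hmn : m <= n) (hkn : k <= n) x,
    bond hkm (bond hmn x) = bond hkn x
}.

Section InverseLimit.
Variable S : inverse_sequence.
Local Notation A n := (Fc_structure (S n)).
Local Notation prodA := (prod_topology (fun n => A n : topologicalType)).

Definition coherent : set prodA :=
  [set x | forall m n (h : m <= n), bond h (x n) = x m].

Definition invlim : Type := set_type coherent.
HB.instance Definition _ := Topological.copy invlim (set_type coherent).

Definition invlim_proj (n : nat) (x : invlim) : A n := set_val x n.

Definition invlim_rel (x y : invlim) : Prop :=
  forall n, Rrel (invlim_proj n x) (invlim_proj n y).

Definition invlim_chain : set (set invlim) :=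
  [set C | [/\ C !=set0, closed C &
               forall n, chain_family (invlim_proj n @` C)]].

Lemma invlim_proj_continuous n : continuous (invlim_proj n).
Proof.
move=> x; apply: (@continuous_comp invlim prodA (A n) set_val (fun f => f n)).
  exact: initial_continuous.
exact: (@proj_continuous nat (fun n => A n : topologicalType) n).
Qed.

Lemma invlim_proj_bond m n (h : m <= n) x :
  bond h (invlim_proj n x) = invlim_proj m x.
Proof. by have /set_mem := valP x; apply. Qed.

Lemma invlim_proj_inj (x y : invlim) :
  (forall n, invlim_proj n x = invlim_proj n y) -> x = y.
Proof. by move=> xy; apply: val_inj; exact: functional_extensionality_dep. Qed.

Lemma invlim_nbhs (x : invlim) (U : set invlim) : nbhs x U ->
  exists n, forall y, invlim_proj n y = invlim_proj n x -> U y.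
Proof.
pose cyl n : set invlim := [set y | invlim_proj n y = invlim_proj n x].
pose F : set_system invlim := filter_from [set: nat] cyl.
have FF : Filter F.
  apply: filter_from_filter; first by exists 0.
  move=> m n _ _; exists (maxn m n) => // y yx.
  have cylS k : k <= maxn m n -> cyl k y.
    move=> h; rewrite /cyl/= -(invlim_proj_bond h x) -(invlim_proj_bond h y).
    by congr bond.
  by split; apply: cylS; rewrite (leq_maxl, leq_maxr).
have Fx : (set_val @ F : set_system prodA) --> set_val x.
  apply/cvg_sup => n V [W [[O oO <-] Ox] OV].
  exists n => // y yx; apply: OV => /=.
  by rewrite [_ n](_ : _ = set_val x n).
case=> V [[W oW <-] Wx VU].
have /Fx [n _ nW] : nbhs (set_val x) W by exact: open_nbhs_nbhs.
by exists n => y yx; apply: VU; exact: nW.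
Qed.

Lemma invlim_cylinder_nbhs n (x : invlim) :
  nbhs x [set y | invlim_proj n y = invlim_proj n x].
Proof.
exact: (@invlim_proj_continuous n x _
  (@discrete_set1 (discrete_topology (S n)) (invlim_proj n x))).
Qed.

Lemma closed_coherent : closed coherent.
Proof.
move=> x clx m n h.
have nb k : nbhs x [set y : prodA | y k = x k].
  exact: (@proj_continuous nat (fun n => A n : topologicalType) k x _
    (@discrete_set1 (discrete_topology (S k)) (x k))).
have [y [cy [yn ym]]] := clx _ (filterI (nb n) (nb m)).
by rewrite -yn -ym; exact: cy.
Qed.

Lemma invlim_compact : compact [set: invlim].
Proof.
have cptA : compact coherent.
  apply: (subclosed_compact closed_coherent _ (@subsetT _ _)).
  have := @tychonoff nat (fun n => A n : topologicalType) (fun=> setT)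
    (fun n => @Rspace_compact (A n)).
  by congr compact; apply/seteqP; split.
move=> F FF _.
have Fc : F (set_val @^-1` coherent).
  by apply: filterS filterT => x _; have /set_mem := valP x.
have [p [cp Fp]] := cptA (set_val @ F) _ Fc.
exists (exist _ p (mem_set cp)); split=> // U V FU [W [[O oO <-] Op] OV].
have [||_ [[x Ux <-] Ox]] := Fp (set_val @` U) O.
- suff: F (set_val @^-1` (set_val @` U)) by [].
  by apply: filterS FU => x Ux; exists x.
- exact: open_nbhs_nbhs.
by exists x; split=> //; exact: OV.
Qed.

Lemma invlim_hausdorff : hausdorff_space invlim.
Proof.
move=> x y xy; apply: invlim_proj_inj => n.
by have [z [/= <- <-]] :=
  xy _ _ (invlim_cylinder_nbhs n x) (invlim_cylinder_nbhs n y).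
Qed.

Lemma invlim_zero_dimensional : zero_dimensional invlim.
Proof.
move=> x y /eqP xy.
have [n nxy] : exists n, invlim_proj n x <> invlim_proj n y.
  by apply/existsNP => h; apply: xy; exact: invlim_proj_inj.
exists (invlim_proj n @^-1` [set invlim_proj n x]); split=> //; last exact: nesym.
apply: preimage_clopen; last exact: invlim_proj_continuous.
by split; [exact: (@discrete_open (discrete_topology (S n)))
          |exact: (@discrete_closed (discrete_topology (S n)))].
Qed.

Lemma invlim_second_countable : @second_countable invlim.
Proof.
pose cyl (p : {n : nat & S n}) : set invlim :=
  [set x | invlim_proj (tag p) x = tagged p].
exists (range cyl).
  apply: card_le_trans (card_image_le _ _) _; exact: countableP.
split=> [_ [[n a] _ <-]|x U /invlim_nbhs[n nU]].
  rewrite openE => x xa; have := invlim_cylinder_nbhs n x.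
  by rewrite [invlim_proj n x]xa.
exists (cyl (Tagged (fun n => S n : Type) (invlim_proj n x))); last exact: nU.
by split=> //; exists (Tagged (fun n => S n : Type) (invlim_proj n x)).
Qed.

Lemma invlim_rel_closed :
  closed [set p : invlim * invlim | invlim_rel p.1 p.2].
Proof.
move=> [x y] clxy n /=.
have [[u v] [/= uv [/= <- <-]]] := clxy _ (ex_intro2 _ _ (_, _)
  (conj (invlim_cylinder_nbhs n x) (invlim_cylinder_nbhs n y)) (fun p h => h)).
exact: uv.
Qed.

Definition invlim_structure : chain_structure :=
  @MkChainStructure (MkRstructure invlim_compact invlim_hausdorff
    invlim_zero_dimensional invlim_second_countable invlim_rel_closed)
    invlim_chain.

End InverseLimit.

(* Families of structures are taken up to isomorphism.  The inverse of the
   isomorphism must be an epimorphism too: an arbitrary structure need not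
   have a family of sets as large as that of an inverse limit onto which it
   maps by a bijective epimorphism. *)
Definition Fc_star (L : chain_structure) : Prop :=
  exists (S : inverse_sequence)
         (f : L -> invlim_structure S) (g : invlim_structure S -> L),
    [/\ chain_epimorphism f, chain_epimorphism g, cancel f g & cancel g f].

Definition projective_universal (L : chain_structure) : Prop :=
  forall A : Fc, exists phi : L -> Fc_structure A, chain_epimorphism phi.

Definition continuous_maps_factor (L : chain_structure) : Prop :=
  forall (X : finType) (f : L -> discrete_topology X), continuous f ->
    exists (A : Fc) (phi : L -> Fc_structure A) (f0 : A -> X),
      chain_epimorphism phi /\ f = f0 \o phi.

Definition projective_ultrahomogeneous (L : chain_structure) : Prop :=
  forall (A : Fc) (phi1 phi2 : L -> Fc_structure A),
    chain_epimorphism phi1 -> chain_epimorphism phi2 ->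
    exists psi : L -> L, chain_isomorphism psi /\ phi2 = phi1 \o psi.

Definition is_Lc (L : chain_structure) : Prop :=
  [/\ Fc_star L, projective_universal L, continuous_maps_factor L &
      projective_ultrahomogeneous L].

Section Automorphisms.
Variable L : chain_structure.

Definition is_automorphism (g : L -> L) : Prop :=
  [/\ continuous g,
      exists h : L -> L, [/\ continuous h, cancel g h & cancel h g],
      forall x y, Rrel (g x) (g y) <-> Rrel x y &
      [set g @` C | C in @chain_family L] = @chain_family L].

Definition Aut : Type :=
  set_type [set g : {compact-open, L -> L} | is_automorphism g].
HB.instance Definition _ := Topological.copy Aut
  (set_type [set g : {compact-open, L -> L} | is_automorphism g]).

Definition aut_fun (g : Aut) : L -> L := set_val g.

Lemma autP (g : Aut) : is_automorphism (aut_fun g).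
Proof. by have /set_mem := valP g. Qed.

Definition mkAut (g : L -> L) (autg : is_automorphism g) : Aut :=
  @exist _ _ (g : {compact-open, L -> L}) (mem_set autg).

Lemma aut_inj (g h : Aut) : (forall x, aut_fun g x = aut_fun h x) -> g = h.
Proof. by move=> gh; apply/val_inj/funext. Qed.

Lemma is_automorphism_id : is_automorphism id.
Proof.
have cid : continuous (id : L -> L) by move=> x; exact: cvg_id.
split=> //; first by exists id.
by apply/seteqP; split=> C => [[D LD <-]|LC]; [|exists C => //]; rewrite image_id.
Qed.

Lemma is_automorphism_comp (g h : L -> L) :
  is_automorphism g -> is_automorphism h -> is_automorphism (g \o h).
Proof.
move=> [cg [g' [cg' gK g'K]] Rg Lg] [ch [h' [ch' hK h'K]] Rh Lh]; split.
- by move=> x; apply: continuous_comp; [exact: ch|exact: cg].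
- exists (h' \o g'); split; [|exact: can_comp|exact: can_comp].
  by move=> x; apply: continuous_comp; [exact: cg'|exact: ch'].
- by move=> x y; exact: iff_trans (Rg _ _) (Rh _ _).
- rewrite -[RHS]Lg -[in RHS]Lh image_comp.
  by congr image; apply/funext => C /=; rewrite image_comp.
Qed.

Lemma aut_inverse_subproof (g : Aut) :
  exists h : Aut, cancel (aut_fun g) (aut_fun h) /\
                  cancel (aut_fun h) (aut_fun g).
Proof.
have [cg [h [ch gK hK]] Rg Lg] := autP g.
have auth : is_automorphism h.
  split=> //; first by exists (aut_fun g).
    by move=> x y; have := Rg (h x) (h y); rewrite !hK; exact: iff_sym.
  rewrite -[in LHS]Lg image_comp -[RHS]image_id.
  congr image; apply/funext => C /=; rewrite image_comp -[RHS]image_id.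
  by congr image; apply/funext => x /=; rewrite gK.
by exists (mkAut auth).
Qed.

Definition aut1 : Aut := mkAut is_automorphism_id.
Definition aut_mul (g h : Aut) : Aut :=
  mkAut (is_automorphism_comp (autP g) (autP h)).
Definition aut_inv (g : Aut) : Aut := sval (cid (aut_inverse_subproof g)).

Lemma aut_invK (g : Aut) : cancel (aut_fun g) (aut_fun (aut_inv g)).
Proof. exact: (svalP (cid (aut_inverse_subproof g))).1. Qed.

Lemma aut_invVK (g : Aut) : cancel (aut_fun (aut_inv g)) (aut_fun g).
Proof. exact: (svalP (cid (aut_inverse_subproof g))).2. Qed.

Lemma aut_mulA : associative aut_mul.
Proof. by move=> f g h; exact: aut_inj. Qed.

Lemma aut_mul1g : left_id aut1 aut_mul.
Proof. by move=> g; exact: aut_inj. Qed.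

Lemma aut_mulg1 : right_id aut1 aut_mul.
Proof. by move=> g; exact: aut_inj. Qed.

Lemma aut_mulVg : left_inverse aut1 aut_inv aut_mul.
Proof. by move=> g; apply: aut_inj => x; exact: aut_invK. Qed.

Lemma aut_mulgV : right_inverse aut1 aut_inv aut_mul.
Proof. by move=> g; apply: aut_inj => x; exact: aut_invVK. Qed.

HB.instance Definition _ :=
  isGroup.Build Aut aut_mulA aut_mul1g aut_mulg1 aut_mulVg aut_mulgV.

Lemma aut_cvgP (F : set_system Aut) (g : Aut) : Filter F ->
  F --> g <-> forall K O : set L, compact K -> open O ->
    (forall x, K x -> O (aut_fun g x)) ->
    F [set h | forall x, K x -> O (aut_fun h x)].
Proof.
move=> FF.
have sub K O : [set h | forall x, K x -> O (aut_fun h x)] =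
    set_val @^-1` [set h : {compact-open, L -> L} | h @` K `<=` O].
  apply/seteqP; split=> h /= KO => [_ [x Kx <-]|x Kx]; first exact: KO.
  by apply: KO; exists x.
split=> [Fg K O cK oO gKO|Fg].
  apply: Fg; rewrite sub; exists (set_val @^-1`
    [set h : {compact-open, L -> L} | h @` K `<=` O]); split=> //.
    by eexists; first exact: compact_open_open cK oO.
  by move=> _ [x Kx <-]; exact: gKO.
have vFg : (set_val @ F : set_system {compact-open, L -> L}) --> set_val g.
  apply/compact_open_cvgP => K O cK oO gKO; rewrite /= /nbhs/= -sub.
  by apply: Fg => // x Kx; apply: gKO; exists x.
move=> U [V [[W oW <-] Wg] WU].
have FW : F (set_val @^-1` W).
  by apply: vFg; exact: (@open_nbhs_nbhs {compact-open, L -> L}).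
exact: filterS WU FW.
Qed.

Lemma aut_nbhs (g : Aut) (K O : set L) : compact K -> open O ->
  (forall x, K x -> O (aut_fun g x)) ->
  nbhs g [set h | forall x, K x -> O (aut_fun h x)].
Proof. by have /aut_cvgP := @cvg_id _ (nbhs g); apply. Qed.

Lemma open_compactC (O : set L) : open O -> compact (~` O).
Proof.
move=> oO; apply: (subclosed_compact _ (@Rspace_compact L)) => //.
exact: open_closedC.
Qed.

Lemma compact_openC (K : set L) : compact K -> open (~` K).
Proof.
move=> cK; apply: closed_openC.
by apply: compact_closed cK; exact: Rspace_hausdorff.
Qed.

Lemma aut_mul_continuous : continuous (fun p : Aut * Aut => (p.1 * p.2)%g).
Proof.
move=> [g h]; apply/aut_cvgP => K O cK oO /= ghKO.
have [cg _ _ _] := autP g; have [ch _ _ _] := autP h.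
have oP : open (aut_fun g @^-1` O) by move/continuousP: cg; apply.
have cI : compact (aut_fun h @` K).
  by apply: continuous_compact => //; exact: continuous_subspaceT.
have clI := compact_closed (@Rspace_hausdorff L) cI.
have nI : set_nbhs (aut_fun h @` K) (aut_fun g @^-1` O).
  apply/set_nbhsP; exists (aut_fun g @^-1` O); split=> // _ [x Kx <-].
  exact: ghKO.
have [V /set_nbhsP[W [oW IW WV]] VO] :=
  compact_normal (@Rspace_hausdorff L) (@Rspace_compact L) clI nI.
have cV : compact (closure V).
  apply: (subclosed_compact _ (@Rspace_compact L)) => //; exact: closed_closure.
exists ([set g' | forall x, closure V x -> O (aut_fun g' x)],
        [set h' | forall x, K x -> W (aut_fun h' x)]).
  split; first exact: aut_nbhs.
  by apply: aut_nbhs => // x Kx; apply: IW; exists x.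
move=> [g' h'] [/= gV hK] x Kx.
by apply: gV; apply: subset_closure; apply: WV; exact: hK.
Qed.

Lemma aut_inv_continuous : continuous (fun g : Aut => (g^-1)%g).
Proof.
move=> g; have FF := @fmap_filter _ _ (fun h : Aut => (h^-1)%g) _ (nbhs_filter g).
apply: (iffRL (@aut_cvgP _ (g^-1)%g FF)).
move=> K O cK oO gKO.
have := @aut_nbhs g _ _ (open_compactC oO) (compact_openC cK).
have /[swap]/[apply] : forall x, ~ O x -> ~ K (aut_fun g x).
  by move=> x nOx /gKO; rewrite aut_invK.
apply: filterS => h /= hOK x Kx; apply: contrapT => /hOK.
by rewrite aut_invVK.
Qed.

HB.instance Definition _ :=
  isTopologicalGroup.Build Aut aut_mul_continuous aut_inv_continuous.

End Automorphisms.

(* Main.v *)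
From mathcomp Require Import all_boot all_classical topology zify.
Require Import Defs.

Set Implicit Arguments.
Unset Strict Implicit.
Unset Printing Implicit Defensive.

Local Open Scope classical_set_scope.

(** The theorem is reduced, in the manner of Kechris, Pestov and Todorcevic, to
a Ramsey theorem for finite fans with a maximal chain of downwards closed sets.

From dynamics to colourings.  Let G be the automorphism group, acting on a
compact Hausdorff space, and suppose that no point is fixed.  Every point x
then has a neighbourhood that some g x moves off itself, and this persists
under small perturbations of the group elements
([moved_point_neighbourhoods]).  Finitely many of these neighbourhoods cover the
space; colour a group element b by one of them that contains b x0.  It is enough
to find b such that b and all the products (g x) b are small left perturbations
of elements of one colour: b x0 and (g x) b x0 then both lie close to the
neighbourhood of the same x, which g x moves off itself.  The existence of such
a b is [oscillation_stable].

From colourings of G to colourings of epimorphisms.  The stabilizers of the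
projections of the limit onto its finite quotients form a basis at the
identity ([stabilizer_nbhs]), and by homogeneity the cosets of the stabilizer of
an epimorphism phi onto A correspond to the epimorphisms onto A, through
b |-> phi b.  What remains is the Ramsey property: for all A and B there is C
such that every finite colouring of the epimorphisms from C to A is constant on
the epimorphisms that factor through a suitable one from C to B.  Universality
and homogeneity of the limit allow A and B to be replaced by fans that map onto
them.  For B this gives the lexicographic fans, whose branches all have height k
and are listed one after the other ([lex_cover]).  For A it gives fans in
which a dummy leaf precedes every vertex ([spread_cover]), so that no branch of B
can reach two new vertices at once.  For these fans the Ramsey property is
[fan_ramsey].

The Ramsey theorem.  An epimorphism from a lexicographic fan to A is a word,
whose letters are the images of the branches.  Each letter is a path in A from
the root, and with the vertices of A numbered along the chain, every letter
ends at most one above the vertices met so far.  The proof is a downward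
induction on the last vertex i already met ([ramsey_from]), relative to an
initial part b0 of B on which the word is prescribed.
- If i is the last vertex of A, all further letters are free and the
  Hales-Jewett theorem applies, with the paths in b0 as its alphabet.  A path
  in A lifts to b0 as soon as it waits long enough between its steps for the
  walk in b0 to catch up ([treepath_lift]); this is what the freedom in the
  heights of the branches of C is used for.
- To pass from i+1 to i, a fusion first makes the colour depend only on the
  letters up to the one that reaches i+1 ([prefix_ramsey_from_next]).  Then a
  version of the Hales-Jewett theorem for prefixes of words removes the
  dependence on the letters before that one ([prefix_hales_jewett]), and
  Ramsey's theorem for finite sets of times removes the dependence on the times
  at which that path takes its steps ([ramsey_from_prefix]). *)

(** * Partition theorems for finite sets and words *)

Lemma pigeonhole (R : finType) (T : Type) (f : T -> R) k (X : seq T) :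
  #|R| * k < size X -> exists r, k < size [seq x <- X | f x == r].
Proof.
move=> lt; apply: contrapT => /forallNP no; move: lt; apply/negP; rewrite -leqNgt.
have -> : size X = \sum_(r : R) size [seq x <- X | f x == r].
  elim: X {no} => [|x X IH] /=; first by rewrite big1.
  rewrite IH (bigD1 (f x)) //= [RHS](bigD1 (f x)) //= eqxx /= addSn.
  by congr (_ + _).+1; apply: eq_bigr => r /negPf; rewrite eq_sym => ->.
rewrite -sum_nat_const; apply: leq_sum => r _; rewrite leqNgt; apply/negP; exact: no.
Qed.

Lemma subseq_consr (T : eqType) (s : seq T) x X :
  subseq s (x :: X) ->
  subseq s X \/ exists s', s = x :: s' /\ subseq s' X.
Proof.
case: s => [|y s]; first by left; exact: sub0seq.
by rewrite /=; case: eqP => [->|_] h; [right; exists s|left].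
Qed.

(** Ramsey's theorem for sets of size a, represented as subsequences.  The
induction on a first builds a sequence in which the colour of x :: s depends on
x alone; each entry carries that colour, so the pigeonhole principle finishes. *)
Lemma ramsey a k (R : finType) : exists M, forall (c : seq nat -> R) (X : seq nat),
  M <= size X -> exists H, [/\ subseq H X, size H = k &
    forall s s', subseq s H -> subseq s' H -> size s = a -> size s' = a -> c s = c s'].
Proof.
elim: a R k => [|a IH] R k.
  exists k => c X kX; exists (take k X); split; first exact: take_subseq.
    by rewrite size_takel.
  by move=> s s' _ _ /size0nil -> /size0nil ->.
have E t : exists M, forall (c : seq nat -> R) (X : seq nat), M <= size X ->
    exists P : seq (nat * R), [/\ subseq (unzip1 P) X, size P = t &
      forall P1 p P2 s, P = P1 ++ p :: P2 -> subseq s (unzip1 P2) -> size s = a ->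
        c (p.1 :: s) = p.2].
  elim: t => [|t [M1 IHt]].
    by exists 0 => c X _; exists [::]; split=> //; [exact: sub0seq|case].
  have [M2 M2P] := IH R M1; exists M2.+1 => c [|x X] //= /(M2P (fun s => c (x :: s))).
  move=> [H [HX sH Hc]].
  have [|P [PH sP Pc]] := IHt c H; first by rewrite sH.
  exists ((x, c (x :: take a H)) :: P); rewrite /= eqxx sP; split=> //.
    exact: subseq_trans HX.
  move=> [|y P1] p P2 s /= [ep eqP]; last exact: Pc eqP.
  move: ep eqP => <- <- sP2 ss; have sH' := subseq_trans sP2 PH; apply: Hc => //.
    exact: take_subseq.
  by rewrite size_takel // -ss size_subseq.
have [M MP] := E (#|R| * k).+1; exists M => c X /(MP c)[P [PX sP Pc]].
have [|r rP] := @pigeonhole R _ snd k P; first by rewrite sP.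
set P' := [seq _ <- _ | _] in rP.
have key s : subseq s (unzip1 P') -> size s = a.+1 -> c s = r.
  rewrite /P' => {PX sP rP P'}.
  elim: P Pc => [|[x d] P IHP] Pc; first by rewrite subseq0 => /eqP ->.
  have Pc' P1 p P2 s' : P = P1 ++ p :: P2 -> subseq s' (unzip1 P2) ->
      size s' = a -> c (p.1 :: s') = p.2.
    by move=> eqP; apply: (Pc ((x, d) :: P1)); rewrite eqP.
  move=> /= + ss; case: eqP => [dr|_]; last by move=> /(IHP Pc'); exact.
  case/subseq_consr => [/(IHP Pc')|[s' [es s'P]]]; first exact.
  rewrite es (Pc [::] (x, d) P s') //=;  last by move: ss; rewrite es => -[].
    by apply: (subseq_trans s'P); apply: map_subseq; exact: filter_subseq.
exists (take k (unzip1 P')); split.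
- apply: (subseq_trans (take_subseq _ _)).
  by apply: subseq_trans PX; apply: map_subseq; exact: filter_subseq.
- by rewrite size_takel // size_map ltnW.
- move=> s s' sH s'H ss ss'.
  by rewrite !key //; [exact: (subseq_trans s'H (take_subseq _ _))
                      |exact: (subseq_trans sH (take_subseq _ _))].
Qed.

Section VariableWords.
Variable Q : Type.
Implicit Types (l : Q + nat) (s : seq (Q + nat)) (f : nat -> Q).

Definition subst_letter f l := match l with inl q => q | inr x => f x end.
Definition subst_word f s := map (subst_letter f) s.
(** One more than the index of a variable, so that constants get 0 and
[num_vars] is the number of variables of a rigid word. *)
Definition letter_bound l := if l is inr x then x.+1 else 0.
Definition num_vars s := \max_(l <- s) letter_bound l.
(** New variables appear in the order 0, 1, 2, ...  In a rigid word the
occurrence of x after s1 is its first one exactly when num_vars s1 = x. *)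
Definition rigid s := forall s1 x s2, s = s1 ++ inr x :: s2 -> x <= num_vars s1.

(** Substitution of the letters of t for the variables of s. *)
Definition bind_word (t : seq (Q + nat)) s : seq (Q + nat) :=
  map (fun l => match l with inl q => inl q | inr x => nth (inr x) t x end) s.

Lemma num_vars_cat s1 s2 : num_vars (s1 ++ s2) = maxn (num_vars s1) (num_vars s2).
Proof. exact: big_cat. Qed.

Lemma num_vars_cons l s : num_vars (l :: s) = maxn (letter_bound l) (num_vars s).
Proof. by rewrite /num_vars big_cons. Qed.

Lemma num_vars_nil : num_vars [::] = 0.
Proof. by rewrite /num_vars big_nil. Qed.

Lemma num_vars_rcons s l : num_vars (rcons s l) = maxn (num_vars s) (letter_bound l).
Proof. by rewrite -cats1 num_vars_cat num_vars_cons num_vars_nil maxn0. Qed.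

Lemma subst_word_cat f s1 s2 : subst_word f (s1 ++ s2) = subst_word f s1 ++ subst_word f s2.
Proof. exact: map_cat. Qed.

Lemma subst_word_ext f g s : (forall x, x < num_vars s -> f x = g x) -> subst_word f s = subst_word g s.
Proof.
elim: s => [|l s IH] //= fg; congr (_ :: _).
  case: l fg => //= x fg; apply: fg; rewrite num_vars_cons /=; lia.
by apply: IH => x xs; apply: fg; rewrite num_vars_cons; lia.
Qed.

Lemma subst_word_bind f t s :
  subst_word f (bind_word t s) = subst_word (fun x => subst_letter f (nth (inr x) t x)) s.
Proof. by rewrite /subst_word -map_comp; apply: eq_map => -[]. Qed.

Lemma rigid_cat_l s1 s2 : rigid (s1 ++ s2) -> rigid s1.
Proof. by move=> h u x v e; apply: (h u x (v ++ s2)); rewrite e -catA. Qed.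

Lemma rigid_rcons s l : rigid s -> letter_bound l <= (num_vars s).+1 -> rigid (rcons s l).
Proof.
move=> rs vl u x; elim/last_ind => [|v y _].
  by rewrite cats1 => /rcons_inj[<- el]; move: vl; rewrite el.
by rewrite -rcons_cons -rcons_cat => /rcons_inj[es _]; exact: rs es.
Qed.

Lemma rigid_rconsE s l : rigid (rcons s l) -> rigid s /\ letter_bound l <= (num_vars s).+1.
Proof.
rewrite -cats1 => h; split; first exact: rigid_cat_l h.
case: l h => //= x h; exact: (h s x [::]).
Qed.

Lemma rigid_nil : rigid [::].
Proof. by case. Qed.

Lemma size_bind_word t s : size (bind_word t s) = size s.
Proof. exact: size_map. Qed.

Lemma num_vars_bind_word t s : rigid s -> rigid t -> num_vars s <= size t ->
  num_vars (bind_word t s) = num_vars (take (num_vars s) t) /\ rigid (bind_word t s).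
Proof.
move=> + rt; elim/last_ind: s => [|s l IH]; first by rewrite !num_vars_nil take0 num_vars_nil; split=> //; exact: rigid_nil.
move=> /rigid_rconsE[rs vl]; rewrite num_vars_rcons => st.
have [|e rb] := IH rs; first lia.
rewrite /bind_word map_rcons -/(bind_word t s); case: l vl st => [q|x] /= vl st.
  by rewrite num_vars_rcons maxn0 maxn0; split=> //; exact: rigid_rcons.
have xt : x < size t by lia.
have tx : take x.+1 t = rcons (take x t) (nth (inr x) t x) by rewrite (take_nth (inr x)).
have rx : rigid (take x.+1 t) by apply: (@rigid_cat_l _ (drop x.+1 t)); rewrite cat_take_drop.
rewrite num_vars_rcons e; move: rx; rewrite tx => /rigid_rconsE[rx vx].
have vt m : x < m -> maxn (num_vars (take m t)) (letter_bound (nth (inr x) t x)) = num_vars (take m t).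
  move=> xm; have -> : take m t = take x.+1 t ++ take (m - x.+1) (drop x.+1 t).
    by rewrite -[in LHS](cat_take_drop x.+1 t) take_cat size_takel //; case: ltnP => //; lia.
  by rewrite tx num_vars_cat num_vars_rcons; lia.
have [xv|vx'] := ltnP x (num_vars s).
  have -> : maxn (num_vars s) x.+1 = num_vars s by lia.
  rewrite vt //; split=> //; apply: rigid_rcons => //; rewrite e -(vt _ xv); lia.
have xv : x = num_vars s by lia.
have -> : maxn (num_vars s) x.+1 = x.+1 by lia.
rewrite -xv tx num_vars_rcons; split=> //; apply: rigid_rcons => //.
by rewrite e -xv.
Qed.

(** A first occurrence in a composite word comes from first occurrences in
both factors; colourings of prefixes can therefore be composed. *)
Lemma bind_word_new t s r1 x r2 : rigid s -> rigid t -> num_vars s <= size t ->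
  bind_word t s = r1 ++ inr x :: r2 -> num_vars r1 = x ->
  exists s1 d s2 t2, [/\ s = s1 ++ inr d :: s2, num_vars s1 = d, r1 = bind_word t s1,
    t = take d t ++ inr x :: t2 & num_vars (take d t) = x].
Proof.
move=> rs rt st eqb vr1.
pose s1 := take (size r1) s; pose l := drop (size r1) s.
have er1 : r1 = bind_word t s1.
  by rewrite /s1 /bind_word map_take -/(bind_word t s) eqb take_size_cat.
have : bind_word t l = inr x :: r2.
  by rewrite /l /bind_word map_drop -/(bind_word t s) eqb drop_size_cat.
case el : l => [|[q|d] s2] //= [nx _].
have es : s = s1 ++ inr d :: s2 by rewrite -el cat_take_drop.
have dv : d <= num_vars s1 by apply: rs es.
have dt : d < size t.
  by move: st; rewrite es num_vars_cat num_vars_cons /=; lia.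
have [||| vb _] := @num_vars_bind_word t s1 => //; first by apply: (@rigid_cat_l s1 (inr d :: s2)); rewrite -es.
  by move: st; rewrite es num_vars_cat; lia.
have et : t = take d t ++ inr x :: drop d.+1 t.
  by rewrite -nx -drop_nth // cat_take_drop.
have vd : d = num_vars s1.
  apply/eqP; rewrite eqn_leq dv leqNgt; apply/negP => lt.
  have : x < num_vars (take (num_vars s1) t); last by rewrite -vb -er1 vr1 ltnn.
  rewrite et take_cat size_takel; last exact: ltnW.
  rewrite (ltnNge (num_vars s1) d) (ltnW lt) /= -{1}[num_vars s1 - d]prednK ?subn_gt0 //= num_vars_cat num_vars_cons /=.
  lia.
exists s1, d, s2, (drop d.+1 t); split=> //.
by rewrite vd -vb -er1.
Qed.

End VariableWords.

Section MoreVariableWords.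
Variable Q : Type.
Implicit Types (s t : seq (Q + nat)).

Lemma rigid_cat_bounded s t :
  rigid s -> all (fun l => letter_bound l <= (num_vars s).+1) t -> rigid (s ++ t).
Proof.
move=> rs; elim/last_ind: t => [|t l IH]; first by rewrite cats0.
rewrite all_rcons -rcons_cat => /andP[vl /IH rst].
apply: rigid_rcons => //; rewrite num_vars_cat; lia.
Qed.

Lemma num_vars_nseq k (l : Q + nat) : num_vars (nseq k l) = if k is 0 then 0 else letter_bound l.
Proof. by elim: k => [|[|k] IH]; rewrite ?num_vars_nil //= num_vars_cons IH; lia. Qed.

Lemma rigid_cat_iota s k : rigid s ->
  rigid (s ++ map inr (iota 0 k)) /\ num_vars (s ++ map inr (iota 0 k)) = maxn (num_vars s) k.
Proof.
move=> rs; elim: k => [|k [IH1 IH2]]; first by rewrite cats0 maxn0.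
rewrite -addn1 iotaD map_cat /= add0n catA cats1 num_vars_rcons IH2 /=.
split; last lia.
apply: rigid_rcons => //=; rewrite IH2; lia.
Qed.

Lemma rigid_cat_inl s (w : seq Q) : rigid s ->
  rigid (s ++ map inl w) /\ num_vars (s ++ map inl w) = num_vars s.
Proof.
move=> rs; elim/last_ind: w => [|w q [IH1 IH2]]; first by rewrite cats0.
rewrite map_rcons -rcons_cat num_vars_rcons IH2 /= maxn0; split=> //.
exact: rigid_rcons.
Qed.

End MoreVariableWords.

(** Shelah's insensitivity lemma: a large word space contains a subspace on
which the colour does not see the difference between the letters a0 and a1.
One variable is added at a time.  Among the words a0^j a1^(N-j) two have the
same effect on all colourings of the remaining coordinates, and the positions
where they differ carry the new variable. *)
Lemma shelah n (Q : finType) (a0 a1 : Q) (R : finType) :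
  exists M, forall c : seq Q -> R, exists s, [/\ size s = M, rigid s, num_vars s = n &
    forall f f', (forall j, j < n -> f j = f' j \/ (f j = a0 /\ f' j = a1)) ->
      c (subst_word f s) = c (subst_word f' s)].
Proof.
elim: n R => [|n IH] R.
  exists 0 => c; exists [::]; rewrite num_vars_nil; split=> //; exact: rigid_nil.
have [M MP] := IH {ffun Q -> R}.
pose N := #|{ffun M.-tuple Q -> R}|.
exists (M + N) => c.
pose blk j := nseq j a0 ++ nseq (N - j) a1.
have [i [j [ij jN cij]]] : exists i j, [/\ i < j, j <= N &
    forall v : M.-tuple Q, c (v ++ blk i) = c (v ++ blk j)].
  pose F j := [ffun v : M.-tuple Q => c (v ++ blk j)].
  have [|r] := @pigeonhole _ _ F 1 (iota 0 N.+1); first by rewrite size_iota muln1.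
  set X := (X in 1 < size X) => sX.
  have sortX : sorted ltn X by apply: sorted_filter; [exact: ltn_trans|exact: iota_ltn_sorted].
  have XP x : x \in X -> F x = r /\ x <= N.
    by rewrite mem_filter mem_iota => /andP[/eqP -> ?]; split=> //; lia.
  case: X sX sortX XP => [|x [|y X]] //= _ /andP[xy _] XP.
  have [Fx _] := XP x (mem_head _ _).
  have [|Fy yN] := XP y; first by rewrite !inE eqxx orbT.
  exists x, y; split=> // v.
  by have := erefl (F x v); rewrite {1}Fx -Fy !ffunE => ->.
pose l : seq (Q + nat) := nseq i (inl a0) ++ nseq (j - i) (inr n) ++ nseq (N - j) (inl a1).
have l0 f : f n = a0 -> subst_word f l = blk j.
  move=> fn; rewrite /l !subst_word_cat /subst_word !map_nseq /= fn catA /blk; congr (_ ++ _).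
  by rewrite -nseqD; congr nseq; lia.
have l1 f : f n = a1 -> subst_word f l = blk i.
  move=> fn; rewrite /l !subst_word_cat /subst_word !map_nseq /= fn /blk; congr (_ ++ _).
  by rewrite -nseqD; congr nseq; lia.
have [s [ss rs vs sc]] := MP (fun v => [ffun a : Q => c (v ++ subst_word (fun=> a) l)]).
have vl : num_vars l = n.+1.
  rewrite /l !num_vars_cat !num_vars_nseq /=.
  have : j - i != 0 by lia.
  by case: (j - i) => // m _; case: (i) => [|?]; case: (N - j) => [|?] /=; lia.
exists (s ++ l); split.
- by rewrite size_cat ss /l !size_cat !size_nseq; lia.
- apply: rigid_cat_bounded => //.
  by rewrite vs /l !all_cat !all_nseq /= leqnn !orbT.
- by rewrite num_vars_cat vs vl; lia.
move=> f f' ff'; rewrite (subst_word_cat f) (subst_word_cat f').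
have lf g : subst_word g l = subst_word (fun=> g n) l.
  by rewrite /l !subst_word_cat /subst_word !map_nseq /=.
have -> : c (subst_word f s ++ subst_word f l) = c (subst_word f' s ++ subst_word f l).
  rewrite lf; have := sc f f' (fun x xn => ff' x (ltnW xn)).
  by move=> /ffunP /(_ (f n)); rewrite !ffunE.
have [e|[f0 f1]] := ff' n (ltnSn n); first by rewrite lf e -lf.
have sv : size (subst_word f' s) == M by rewrite size_map ss.
by rewrite l0 // l1 //; have /= := cij (Tuple sv).
Qed.

(** Induction on the set of letters on which the line has to be
monochromatic: a space insensitive to replacing a0 by a1 takes care of the
letter a1 once a0 has been treated. *)
Lemma hales_jewett_line (Q : finType) (S : seq Q) (R : finType) :
  exists M, forall c : seq Q -> R, exists s, [/\ size s = M, rigid s, num_vars s = 1 &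
    {in S &, forall a b, c (subst_word (fun=> a) s) = c (subst_word (fun=> b) s)}].
Proof.
have base : rigid [:: (inr 0 : Q + nat)] /\ num_vars [:: (inr 0 : Q + nat)] = 1.
  by rewrite num_vars_cons num_vars_nil; split=> //; apply: (@rigid_rcons _ [::]) => //; exact: rigid_nil.
elim: S R => [|a1 S IH] R; first by exists 1 => c; exists [:: inr 0]; split; case: base.
case: S IH => [|a0 S] IH.
  exists 1 => c; exists [:: inr 0]; split; try by case: base.
  by move=> a b; rewrite !inE => /eqP -> /eqP ->.
have [n nP] := IH R; have [M MP] := shelah n a0 a1 R.
exists M => c; have [t [st rt vt tc]] := MP c.
have [s [ss rs vs sc]] := nP (fun w => c (subst_word (nth a0 w) t)).
have [|e rb] := num_vars_bind_word rt rs; first by rewrite vt ss.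
exists (bind_word s t); split=> //; first by rewrite size_bind_word.
  by rewrite e vt -ss take_size.
have key a : c (subst_word (fun=> a) (bind_word s t)) = c (subst_word (nth a0 (subst_word (fun=> a) s)) t).
  rewrite subst_word_bind; congr c; apply: subst_word_ext => x; rewrite vt -ss => xs.
  by rewrite (nth_map (inr x)).
have key2 a : a \in a1 :: a0 :: S ->
    c (subst_word (fun=> a) (bind_word s t)) = c (subst_word (fun=> a0) (bind_word s t)).
  rewrite inE => /predU1P[->|aS]; last by rewrite !key; apply: sc => //; exact: mem_head.
  rewrite !subst_word_bind; apply/esym/tc => j jn.
  by case: (nth _ _ _) => [q|y] /=; [left|right].
by move=> a b /key2 -> /key2 ->.
Qed.

(** An n-dimensional subspace over Q is a line over the alphabet of n-tuples:
each position of the line becomes a block of n positions, so the variables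
appear in increasing order. *)
Lemma hales_jewett n (Q : finType) (R : finType) :
  exists M, forall c : seq Q -> R, exists s, [/\ size s = M, rigid s, num_vars s = n &
    forall f f', c (subst_word f s) = c (subst_word f' s)].
Proof.
have [M MP] := hales_jewett_line (enum {: n.-tuple Q}) R.
exists (M * n) => c.
pose fl (w : seq (n.-tuple Q)) : seq Q := flatten (map val w).
have [s [ss rs vs sc]] := MP (fun w => c (fl w)).
pose blk (l : n.-tuple Q + nat) : seq (Q + nat) :=
  if l is inl w then map inl w else map inr (iota 0 n).
have sub f t : subst_word f (flatten (map blk t)) =
    fl (subst_word (fun=> [tuple f i | i < n]) t).
  elim: t => [|l t IH] //=; rewrite subst_word_cat IH /fl /=; congr (_ ++ _).
  case: l => [w|x] /=; first by rewrite /subst_word -map_comp map_id.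
  by rewrite /subst_word -map_comp -val_enum_ord -map_comp.
exists (flatten (map blk s)); split.
- rewrite size_flatten /shape -map_comp -ss {ss rs vs sc}.
  elim: s => [|l s IH] //=; rewrite IH; case: l => [w|x] /=.
    by rewrite size_map size_tuple mulSn.
  by rewrite size_map size_iota mulSn.
- elim/last_ind: (s) => [|t l IH]; first exact: rigid_nil.
  rewrite map_rcons flatten_rcons; case: l => [w|x] /=.
    by have [] := rigid_cat_inl w IH.
  by have [] := rigid_cat_iota n IH.
- suff H t : rigid (flatten (map blk t)) /\
      num_vars (flatten (map blk t)) = if num_vars t is 0 then 0 else n.
    by have [_ ->] := H s; rewrite vs.
  elim/last_ind: t => [|t l [IH1 IH2]].
    by rewrite !num_vars_nil; split=> //; exact: rigid_nil.
  rewrite map_rcons flatten_rcons num_vars_rcons; case: l => [w|x] /=.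
    by have [? ->] := rigid_cat_inl w IH1; rewrite maxn0.
  have [? ->] := rigid_cat_iota n IH1; split=> //; rewrite IH2.
  by case: (num_vars t) => [|k]; rewrite ?max0n ?maxnn ?maxnSS.
- by move=> f f'; rewrite !sub; apply: sc; rewrite mem_enum.
Qed.

Lemma num_vars_has (Q : Type) k (s : seq (Q + nat)) :
  num_vars s < k -> has (fun l => letter_bound l == k) s = false.
Proof. by elim: s => [|l s IH] //=; rewrite num_vars_cons => h; rewrite IH; lia. Qed.

(** The colour of the part of the word before the first occurrence of x,
where x and all later variables are absent, depends on x alone.  The last
variable is the easy one: append it to a monochromatic subspace.  The variables
of that subspace are then available for the construction of the earlier
ones. *)
Lemma prefix_hales_jewett_graded n (Q : finType) (q0 : Q) (R : finType) :
  exists M, forall c : seq Q -> R, exists s, [/\ size s = M, rigid s, num_vars s = n &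
    exists col : nat -> R, forall s1 x s2 f,
      s = s1 ++ inr x :: s2 -> num_vars s1 = x -> c (subst_word f s1) = col x].
Proof.
elim: n => [|n [D DP]].
  exists 0 => c; exists [::]; rewrite num_vars_nil; split=> //; first exact: rigid_nil.
  by exists (fun=> c [::]) => -[].
have [M MP] := hales_jewett D Q R; exists M.+1 => c.
have [t [st rt vt tc]] := MP c.
(* the part of t before its first occurrence of the variable d *)
pose pre d := take (find (fun l : Q + nat => letter_bound l == d.+1) t) t.
have preE t1 d t2 : t = t1 ++ inr d :: t2 -> num_vars t1 = d -> pre d = t1.
  move=> et vt1; rewrite /pre et find_cat num_vars_has ?vt1 //= eqxx addn0.
  by rewrite take_size_cat.
have [s [ss rs vs [col colP]]] := DP (fun w => c (subst_word (nth q0 w) (pre (size w)))).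
have [|e rb] := num_vars_bind_word rt rs; first by rewrite vt ss.
have vb : num_vars (bind_word s t) = n by rewrite e vt -ss take_size.
exists (rcons (bind_word s t) (inr n)); split.
- by rewrite size_rcons size_bind_word st.
- by apply: rigid_rcons => //=; rewrite vb.
- by rewrite num_vars_rcons vb /=; lia.
exists (fun x => if x < n then col x else c (subst_word (fun=> q0) t)) => s1 x s2 f.
case: (lastP s2) => {s2} [|s2 l]; last first.
  rewrite -rcons_cons -rcons_cat => /rcons_inj[es _] vs1.
  have [|s1' [d [s2' [t2 [et vs1' es1 es' vd]]]]] := bind_word_new rt rs _ es vs1.
    by rewrite vt ss.
  have -> : x < n.
    by rewrite -vs es' num_vars_cat num_vars_cons /=; lia.
  rewrite -(colP _ _ _ f es' vd) es1 subst_word_bind.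
  have ds : d <= size s by rewrite ss -vt et num_vars_cat num_vars_cons /=; lia.
  rewrite size_map size_takel // (preE _ _ _ et vs1'); congr c.
  apply: subst_word_ext => y; rewrite vs1' => yd.
  by rewrite (nth_map (inr y)) ?size_takel // nth_take.
rewrite cats1 => /rcons_inj[<- [<-]] _.
by rewrite ltnn subst_word_bind; exact: tc.
Qed.

(** By the pigeonhole principle many variables x of
[prefix_hales_jewett_graded] share their colour; the others are replaced by the
constant q0. *)
Lemma prefix_hales_jewett k (Q : finType) (q0 : Q) (R : finType) :
  exists M, forall c : seq Q -> R, exists s, [/\ size s = M, rigid s, num_vars s = k &
    exists r, forall s1 x s2 f,
      s = s1 ++ inr x :: s2 -> num_vars s1 = x -> c (subst_word f s1) = r].
Proof.
pose n := (#|R| * k).+1.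
have [M MP] := prefix_hales_jewett_graded n q0 R; exists M => c.
have [s [ss rs vs [col colP]]] := MP c.
have [|r] := @pigeonhole _ _ col k (iota 0 n); first by rewrite size_iota.
rewrite size_filter => kr.
pose cnt x := count (fun y => col y == r) (iota 0 x).
(* keep and renumber the first k variables of colour r *)
pose th x : Q + nat := if (col x == r) && (cnt x < k) then inr (cnt x) else inl q0.
have thP m : rigid (mkseq th m) /\ num_vars (mkseq th m) = minn k (cnt m).
  elim: m => [|m [IH1 IH2]]; first by rewrite num_vars_nil; split; [exact: rigid_nil|rewrite /cnt /= minn0].
  have -> : mkseq th m.+1 = rcons (mkseq th m) (th m) by rewrite /mkseq -addn1 iotaD map_cat /= cats1.
  have cS : cnt m.+1 = cnt m + (col m == r).
    by rewrite /cnt -addn1 iotaD count_cat /= addn0.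
  rewrite num_vars_rcons IH2 cS; split.
    apply: rigid_rcons => //; rewrite IH2 /th.
    by case: (col m == r) => //=; case: (ltnP (cnt m) k) => //= ?; lia.
  by rewrite /th; case: (col m == r) => /=; case: (ltnP (cnt m) k) => /= ?; lia.
have [rt vt] := thP n.
have [|e rb] := num_vars_bind_word rs rt; first by rewrite vs size_mkseq.
exists (bind_word (mkseq th n) s); split=> //; first by rewrite size_bind_word.
  by rewrite e vs take_oversize ?size_mkseq // vt /cnt; lia.
exists r => s1 x s2 f es vs1.
have [|s1' [d [s2' [t2 [et vs1' es1 es' vd]]]]] := bind_word_new rs rt _ es vs1.
  by rewrite vs size_mkseq.
have dn : d < n by rewrite -vs et num_vars_cat num_vars_cons /=; lia.
have : th d = inr x.
  rewrite -(nth_mkseq (inl q0) th dn) es' nth_cat size_takel ?size_mkseq ?ltnn ?subnn //.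
  exact: ltnW.
rewrite /th; case: eqP => //= cd _.
by rewrite es1 subst_word_bind (colP _ _ _ _ et vs1').
Qed.

(** * Words of tree paths *)

(** A path of height k that starts at the root 0 of the tree with parent
function par and in each unit of time stays or moves to a child.  With the
parent function predn these are the climbs of a branch. *)
Definition treepath (par : nat -> nat) (p : nat -> nat) (k : nat) :=
  p 0 = 0 /\ forall h, h < k -> p h.+1 = p h \/ (0 < p h.+1 /\ par (p h.+1) = p h).

(** A fan whose branches (blocks) are listed one after the other is given by
the list of their heights.  A map between two such fans sends the vertex at
height h of block j to height (g j).2 h in block (g j).1. *)
Definition block_map := nat -> nat * (nat -> nat).
Definition reindex (a : nat -> nat -> nat) (g : block_map) : nat -> nat -> nat :=
  fun j h => a (g j).1 ((g j).2 h).
Definition block_map_comp (g2 g1 : block_map) : block_map :=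
  fun j => ((g2 (g1 j).1).1, fun h => (g2 (g1 j).1).2 ((g1 j).2 h)).

(** m j is the number of target blocks covered by the source blocks before j.
A new target block has to be covered completely, and at once. *)
Definition discovery_counter (cs bs : seq nat) (g : block_map) (m : nat -> nat) :=
  [/\ m 0 = 0, m (size cs) = size bs & forall j, j < size cs ->
    ((g j).1 < m j /\ m j.+1 = m j) \/
    [/\ (g j).1 = m j, m j.+1 = (m j).+1 & (g j).2 (nth 0 cs j) = nth 0 bs (m j)]].

Definition valid_block_map (cs bs : seq nat) (g : block_map) :=
  (forall j, j < size cs -> treepath predn (g j).2 (nth 0 cs j) /\
     (g j).2 (nth 0 cs j) <= nth 0 bs (g j).1) /\
  exists m, discovery_counter cs bs g m.

Definition fixes (b0 : seq nat) (g : block_map) :=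
  forall j, j < size b0 -> (g j).1 = j /\ forall h, h <= nth 0 b0 j -> (g j).2 h = h.

Definition agree (hs : seq nat) (m : nat) (a a' : nat -> nat -> nat) :=
  forall j h, j < m -> h <= nth 0 hs j -> a j h = a' j h.

(** Words are total functions for convenience; a colouring may only look at
the finitely many values inside the blocks cs. *)
Definition local_colouring (R : Type) (cs : seq nat) (c : (nat -> nat -> nat) -> R) :=
  forall f f', agree cs (size cs) f f' -> c f = c f'.

(** The largest vertex met by the first m letters; a path ends at its largest
vertex. *)
Definition reached (a : nat -> nat -> nat) (hs : seq nat) (m : nat) :=
  \max_(j < m) a j (nth 0 hs j).

Lemma reachedS a hs m : reached a hs m.+1 = maxn (reached a hs m) (a m (nth 0 hs m)).
Proof. by rewrite /reached big_ord_recr. Qed.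

Lemma reached0 a hs : reached a hs 0 = 0.
Proof. by rewrite /reached big_ord0. Qed.

Lemma reached_mono a hs m m' : m <= m' -> reached a hs m <= reached a hs m'.
Proof.
elim: m' => [|m' IH]; first by rewrite leqn0 => /eqP ->.
by rewrite leq_eqVlt => /predU1P[->//|/IH]; rewrite reachedS; lia.
Qed.

Lemma reached_cat a b0 hs m : m <= size b0 -> reached a (b0 ++ hs) m = reached a b0 m.
Proof.
by move=> mb; apply: eq_bigr => j _; rewrite nth_cat (leq_trans (ltn_ord j) mb).
Qed.

Lemma reached_agree a a' hs m : agree hs m a a' -> reached a hs m = reached a' hs m.
Proof. by move=> aa'; apply: eq_bigr => j _; exact: aa'. Qed.

Lemma agree_cat b0 hs a a' m : m <= size b0 ->
  agree (b0 ++ hs) m a a' <-> agree b0 m a a'.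
Proof.
move=> mb; split=> aa' j h jm hj; apply: aa' => //; move: hj;
by rewrite nth_cat (leq_trans jm mb).
Qed.

Lemma agree_le hs a a' m m' : m' <= m -> agree hs m a a' -> agree hs m' a a'.
Proof. by move=> mm aa' j h jm; apply: aa'; lia. Qed.

Lemma agree_sym hs a a' m : agree hs m a a' -> agree hs m a' a.
Proof. by move=> aa' j h jm hj; rewrite aa'. Qed.

Lemma agree_trans hs a a' a'' m :
  agree hs m a a' -> agree hs m a' a'' -> agree hs m a a''.
Proof. by move=> aa' a'a'' j h jm hj; rewrite aa' // a'a''. Qed.

Lemma treepath_leq par p k h h' : (forall v, 0 < v -> par v < v) ->
  treepath par p k -> h <= h' -> h' <= k -> p h <= p h'.
Proof.
move=> par_lt [_ ps]; elim: h' => [|h' IH]; first by rewrite leqn0 => /eqP ->.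
rewrite leq_eqVlt => /predU1P[->//|hh'] h'k.
have := IH hh' (ltnW h'k); have [->//|[/par_lt + e]] := ps h' h'k; lia.
Qed.

Lemma predn_lt v : 0 < v -> v.-1 < v. Proof. by lia. Qed.

Lemma treepath_comp par p g k b : treepath par p b -> treepath predn g k ->
  g k <= b -> treepath par (p \o g) k.
Proof.
move=> [p0 ps] gk gb; have gle := treepath_leq predn_lt gk.
case: gk => g0 gs; split=> [|h hk] /=; first by rewrite g0.
have gS := gle h.+1 k hk (leqnn k).
have [->|[gp ge]] := gs h hk; first by left.
have -> : g h.+1 = (g h).+1 by lia.
by apply: ps; lia.
Qed.

Lemma discovery_counter_mono cs bs g m i j : discovery_counter cs bs g m -> i <= j -> j <= size cs -> m i <= m j.
Proof.
move=> [_ _ mS]; elim: j => [|j IH]; first by rewrite leqn0 => /eqP ->.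
rewrite leq_eqVlt => /predU1P[->//|ij] js.
by have := IH ij (ltnW js); case: (mS j js) => [[_ ->]//|[_ -> _]]; lia.
Qed.

Lemma valid_block_map_target cs bs g j : valid_block_map cs bs g -> j < size cs -> (g j).1 < size bs.
Proof.
move=> [_ [m cm]] js; have le i k := discovery_counter_mono (i := i) (j := k) cm.
case: cm => _ ms mS; rewrite -ms.
have := le j.+1 (size cs) js (leqnn _).
by case: (mS j js) => [[]|[]]; lia.
Qed.

Lemma valid_block_map_range cs bs g j h : valid_block_map cs bs g -> j < size cs -> h <= nth 0 cs j ->
  (g j).2 h <= nth 0 bs (g j).1.
Proof.
move=> [vg _] js hj; have [tp] := vg j js.
apply: leq_trans; exact: treepath_leq predn_lt tp _ _.
Qed.

Lemma reindex_agree cs bs g a a' : valid_block_map cs bs g -> agree bs (size bs) a a' ->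
  agree cs (size cs) (reindex a g) (reindex a' g).
Proof.
move=> vg aa' j h js hj; apply: aa'; first exact: valid_block_map_target vg js.
exact: valid_block_map_range vg js hj.
Qed.

Lemma local_colouring_reindex (R : Type) cs bs g (c : _ -> R) :
  valid_block_map cs bs g -> local_colouring cs c -> local_colouring bs (fun f => c (reindex f g)).
Proof. by move=> vg lc f f' ff'; apply: lc; exact: reindex_agree ff'. Qed.

Lemma fixes_agree b0 g a : fixes b0 g -> agree b0 (size b0) (reindex a g) a.
Proof. by move=> fg j h jb hj; have [e1 e2] := fg j jb; rewrite /reindex e1 e2. Qed.

Lemma fixes_comp b0 g2 g1 : fixes b0 g2 -> fixes b0 g1 -> fixes b0 (block_map_comp g2 g1).
Proof.
move=> f2 f1 j jb; have [e1 e2] := f1 j jb; have [e3 e4] := f2 j jb.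
by rewrite /block_map_comp /= e1; split=> // h hj; rewrite e2 // e4.
Qed.

Lemma fixes_cat b0 b1 g : fixes (b0 ++ b1) g -> fixes b0 g.
Proof.
move=> fg j jb; have [|e1 e2] := fg j; first by rewrite size_cat; lia.
by split=> // h hj; apply: e2; rewrite nth_cat jb.
Qed.

Definition block_map_id : block_map := fun j => (j, id).

Lemma valid_block_map_id bs : valid_block_map bs bs block_map_id.
Proof.
split=> [j js|]; first by split=> //; split=> // h _; right.
by exists id; split=> // j js; right.
Qed.

Lemma fixes_block_map_id b0 : fixes b0 block_map_id. Proof. by []. Qed.

Lemma valid_block_map_comp ds cs bs g2 g1 : valid_block_map cs bs g2 -> valid_block_map ds cs g1 ->
  valid_block_map ds bs (block_map_comp g2 g1).
Proof.
move=> v2 v1; have [p2 [m2 c2]] := v2; have [p1 [m1 c1]] := v1.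
split=> [j js|].
  have [t1 e1] := p1 j js; have js' := valid_block_map_target v1 js.
  have [t2 e2] := p2 _ js'; split; first exact: treepath_comp t2 t1 e1.
  by apply: leq_trans e2; exact: treepath_leq predn_lt t2 _ _.
have le2 i j := discovery_counter_mono (i := i) (j := j) c2.
have le1 i j := discovery_counter_mono (i := i) (j := j) c1.
case: c1 c2 => m10 m1s m1S [m20 m2s m2S].
exists (m2 \o m1); split=> /= [|| j js]; rewrite ?m10 ?m1s //.
have js' := valid_block_map_target v1 js.
have mj : m1 j <= size cs by rewrite -m1s le1 // ltnW.
case: (m1S j js) => [[lt ->]|[e -> e2]].
  left; split=> //; have := le2 _ _ lt mj.
  by case: (m2S _ js') => [[]|[]]; lia.
have := m2S _ js'; rewrite !e => -[[? ->]|[? -> e3]]; first by left.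
by right; split=> //; rewrite e2.
Qed.

Section Words.
Variables (par : nat -> nat) (N : nat).
Hypothesis par_lt : forall v, 0 < v -> par v < v.

(** The letters are paths, every letter exceeds what has been reached by at
most one, and the last vertex N is reached in the end.  If no child directly
follows its parent in the numbering, children of the root excepted, this
describes the chain preserving epimorphisms onto the tree 0, ..., N. *)
Definition epi_word (hs : seq nat) (a : nat -> nat -> nat) :=
  (forall j, j < size hs -> treepath par (a j) (nth 0 hs j) /\
     a j (nth 0 hs j) <= (reached a hs j).+1) /\ reached a hs (size hs) = N.

(** A substituted word has met exactly the vertices met by the target blocks
already covered. *)
Lemma reached_reindex cs bs g m a j : (forall j, j < size bs -> treepath par (a j) (nth 0 bs j)) ->
  valid_block_map cs bs g -> discovery_counter cs bs g m -> j <= size cs ->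
  reached (reindex a g) cs j = reached a bs (m j).
Proof.
move=> ea vg cm; have [m0 _ mS] := cm.
elim: j => [|j IH] js; first by rewrite m0 !reached0.
rewrite reachedS IH ?(ltnW js) //; case: (mS j js) => [[lt ->]|[e -> e2]].
  apply/maxn_idPl; apply: (@leq_trans (reached a bs (g j).1.+1)).
    rewrite reachedS /reindex leq_max; apply/orP; right.
    apply: treepath_leq par_lt (ea _ (valid_block_map_target vg js)) _ (leqnn _).
    exact: valid_block_map_range vg js (leqnn _).
  exact: reached_mono.
by rewrite reachedS /reindex e2 e.
Qed.

Lemma epi_word_reindex cs bs g a : epi_word bs a -> valid_block_map cs bs g -> epi_word cs (reindex a g).
Proof.
move=> [ea sa] vg; have [vp [m cm]] := vg; have ea1 j js := (ea j js).1.
have sta j := reached_reindex (j := j) ea1 vg cm.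
split=> [j js|]; last by rewrite sta //; case: cm => _ -> _.
have js' := valid_block_map_target vg js; have [t1 e1] := vp j js; split.
  exact: treepath_comp (ea1 _ js') t1 e1.
have := sta _ js; rewrite reachedS sta ?(ltnW js) //; case: cm => _ _ /(_ j js).
case=> [[_ ->]|[e -> e2]]; first by lia.
by rewrite /reindex e2 -e => _; have [] := ea _ js'.
Qed.

(** The Ramsey property relative to the blocks b0: the word is prescribed on
b0 and has met the vertices up to i there. *)
Definition ramsey_from (i : nat) := forall (b0 hs : seq nat) (R : finType), 0 < size b0 ->
  exists cs, forall c : (nat -> nat -> nat) -> R, local_colouring (b0 ++ cs) c ->
  exists g, [/\ valid_block_map (b0 ++ cs) (b0 ++ hs) g, fixes b0 g &
    forall a a', epi_word (b0 ++ hs) a -> epi_word (b0 ++ hs) a' ->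
      reached a b0 (size b0) = i -> agree b0 (size b0) a a' ->
      c (reindex a g) = c (reindex a' g)].

(** As [ramsey_from], but the colour may still depend on the word up to any
point m where exactly the vertices up to i.+1 have been met. *)
Definition prefix_ramsey_from (i : nat) := forall (b0 hs : seq nat) (R : finType), 0 < size b0 ->
  exists cs, forall c : (nat -> nat -> nat) -> R, local_colouring (b0 ++ cs) c ->
  exists g, [/\ valid_block_map (b0 ++ cs) (b0 ++ hs) g, fixes b0 g &
    forall a a' m, epi_word (b0 ++ hs) a -> epi_word (b0 ++ hs) a' ->
      reached a b0 (size b0) = i -> m <= size (b0 ++ hs) ->
      agree (b0 ++ hs) m a a' -> reached a (b0 ++ hs) m = i.+1 ->
      c (reindex a g) = c (reindex a' g)].

(** Fusion over the blocks of hs.  If the first block reaches i.+1, the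
property at i.+1, relative to b0 and that block, makes the colour independent
of everything that follows.  Otherwise the first block joins the prescribed
part b0, and the induction hypothesis applies.  Both are arranged at once by
composing the two substitutions. *)
Lemma prefix_ramsey_from_next i : ramsey_from i.+1 -> prefix_ramsey_from i.
Proof.
move=> Si b0 hs R; elim: hs b0 => [|k hs IH] b0 b0s.
  exists [::] => c lc; exists block_map_id; split; [exact: valid_block_map_id|exact: fixes_block_map_id|].
  move=> a a' m _ _ sti; rewrite cats0 => mb _ stm.
  by have := reached_mono a b0 mb; rewrite stm sti ltnn.
have [|cs2 cs2P] := IH (rcons b0 k); first by rewrite size_rcons.
have [|cs1 cs1P] := Si (rcons b0 k) cs2 R; first by rewrite size_rcons.
exists (k :: cs1) => c; rewrite -cat_rcons => lc.
have [g1 [v1 f1 c1]] := cs1P c lc.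
have [g2 [v2 f2 c2]] := cs2P _ (local_colouring_reindex v1 lc).
exists (block_map_comp g2 g1); rewrite -cat_rcons; split; first exact: valid_block_map_comp v2 v1.
  by have := fixes_comp f2 f1; rewrite -cats1; exact: fixes_cat.
move=> a a' m ea ea' sti mb aa' stm.
have [ea1 _] := ea.
have [|_ stk] := ea1 (size b0).
  by rewrite size_cat size_rcons; lia.
have mb0 : size b0 < m.
  rewrite ltnNge; apply/negP => le; have := reached_mono a (rcons b0 k ++ hs) le.
  by rewrite stm reached_cat ?size_rcons // -cats1 reached_cat // sti ltnn.
have stE : reached a (rcons b0 k) (size b0) = i by rewrite -cats1 reached_cat.
rewrite reached_cat ?size_rcons // stE in stk.
have agk : agree (rcons b0 k) (size (rcons b0 k)) a a'.
  by apply/(agree_cat hs _ _ (leqnn _)); apply: agree_le aa'; rewrite size_rcons.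
have [stk'|stk'] : reached a (rcons b0 k) (size (rcons b0 k)) = i \/
    reached a (rcons b0 k) (size (rcons b0 k)) = i.+1.
- rewrite size_rcons reachedS stE; move: stk; rewrite nth_cat size_rcons ltnSn; lia.
- exact: (c2 _ _ m).
apply: (c1 (reindex a g2) (reindex a' g2)).
- exact: epi_word_reindex v2.
- exact: epi_word_reindex v2.
- by rewrite (reached_agree (fixes_agree a f2)).
- apply: agree_trans (fixes_agree a f2) _; apply: agree_trans agk _.
  exact/agree_sym/fixes_agree.
Qed.

End Words.

(** * Lifting and reparametrizing paths *)

(** F and G record heights along two paths to the same vertex.  The lift g
climbs by one whenever it can without leaving the set of places where F is at
most the current value of G.  Between two steps of G there are k0 > h units of
time, enough to reach the top of the level, and from the top of a level F
passes to the next one together with G. *)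
Lemma treepath_predn_lift F G h K k0 d :
  treepath predn F h -> F h = d -> treepath predn G K -> G K <= d -> h < k0 ->
  (forall t, t < K -> G t.+1 != G t -> k0 %| t.+1) ->
  exists g, [/\ treepath predn g K, g K <= h & forall t, t <= K -> F (g t) = G t].
Proof.
move=> tF Fh tG GK hk0 Gj.
have Fle := treepath_leq predn_lt tF; have Gle := treepath_leq predn_lt tG.
have Gd t : t <= K -> G t <= d by move=> tK; apply: leq_trans (Gle _ _ tK (leqnn _)) GK.
have FS l : l < h -> F l <= F l.+1 <= (F l).+1.
  by move=> lh; have [->|[]] := tF.2 l lh; lia.
have GS t : t < K -> G t.+1 = G t \/ G t.+1 = (G t).+1.
  by move=> tK; have [->|[]] := tG.2 t tK; lia.
have [top topP] : exists top : nat -> nat, forall y, y <= d ->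
    [/\ top y <= h, F (top y) = y & forall l, l <= h -> F l <= y -> l <= top y].
  suff /choice[top topP] : forall y, exists l, y <= d -> [/\ l <= h, F l = y &
      forall l', l' <= h -> F l' <= y -> l' <= l] by exists top.
  move=> y.
  have [yd|] := leqP y d; last by exists 0; lia.
  have ex : exists l, (l <= h) && (F l <= y) by exists 0; rewrite tF.1.
  have ub l : (l <= h) && (F l <= y) -> l <= h by case/andP.
  case: (ex_maxnP ex ub) => l /andP[lh Fl] lmax; exists l => _; split=> //.
    apply/eqP; rewrite eqn_leq Fl /= leqNgt; apply/negP => Fly.
    have lh' : l < h.
      by rewrite ltn_neqAle lh andbT; apply/eqP => e; move: Fly; rewrite e Fh; lia.
    by have := lmax l.+1; have := FS l lh'; rewrite lh'; lia.
  by move=> l' l'h Fl'; apply: lmax; rewrite l'h.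
pose g := fix g t := if t is t'.+1 then minn (g t').+1 (top (G t)) else 0.
have inv t : t <= K -> [/\ g t <= top (G t), F (g t) = G t &
    minn (t %% k0) (top (G t)) <= g t].
  elim: t => [_|t IH tK].
    by have [t1 t2 t3] := topP 0 (leq0n d); rewrite tG.1 tF.1 mod0n min0n.
  have [g1 g2 g3] := IH (ltnW tK).
  have [t1 t2 t3] := topP _ (Gd _ (ltnW tK)).
  have [s1 s2 s3] := topP _ (Gd _ tK).
  have gt : g t.+1 = minn (g t).+1 (top (G t.+1)) by [].
  have [e|e] := GS t tK.
    rewrite e in s1 s2 s3 gt *.
    split; first by rewrite gt; lia.
      have := Fle (g t) (g t.+1); have := Fle (g t.+1) (top (G t)); rewrite gt; lia.
    have : t.+1 %% k0 <= (t %% k0).+1 by rewrite -addn1 -modnDml addn1 leq_mod.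
    by rewrite gt; lia.
  have div : k0 %| t.+1 by apply: Gj => //; rewrite e; lia.
  have tk : t %% k0 = k0.-1.
    have : t %% k0 < k0 by rewrite ltn_mod; lia.
    move: div; rewrite {1}(divn_eq t k0) -addnS dvdn_addr ?dvdn_mull // => /dvdn_leq.
    by move=> /(_ isT); lia.
  have gtop : g t = top (G t) by lia.
  have toph : top (G t) < h.
    by rewrite ltn_neqAle t1 andbT; apply/eqP => E; move: t2 (Gd _ tK); rewrite E Fh e; lia.
  have FSt := FS _ toph.
  have le : (top (G t)).+1 <= top (G t.+1) by apply: s3 => //; lia.
  have gt' : g t.+1 = (top (G t)).+1 by rewrite gt gtop; lia.
  split; first by rewrite gt'.
    have := t3 _ toph; rewrite gt'; lia.
  by rewrite (eqP div) min0n.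
exists g; split.
- split=> // t tK; have [g1 g2 g3] := inv t (ltnW tK); have [s1 s2 s3] := inv _ tK.
  have [t1 t2 t3] := topP _ (Gd _ (ltnW tK)).
  have [u1 u2 u3] := topP _ (Gd _ tK).
  have := u3 _ t1; rewrite t2 (Gle t t.+1) // => /(_ isT) le.
  have : g t.+1 = minn (g t).+1 (top (G t.+1)) by [].
  by move=> ->; lia.
- by have [g1 _ _] := inv K (leqnn _); have [t1 _ _] := topP _ (Gd _ (leqnn _)); lia.
- by move=> t /inv[].
Qed.

Section Depth.
Variable par : nat -> nat.
Hypothesis par_lt : forall v, 0 < v -> par v < v.

(** The first argument bounds the length of the recursion; any bound at least
v gives the same value. *)
Fixpoint depth_fuel n v :=
  if n is n'.+1 then if v is 0 then 0 else (depth_fuel n' (par v)).+1 else 0.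
Definition depth v := depth_fuel v v.

Lemma depthS v : 0 < v -> depth v = (depth (par v)).+1.
Proof.
have fuel n m u : u <= n -> u <= m -> depth_fuel n u = depth_fuel m u.
  elim: n m u => [|n IH] [|m] [|u] //= un um.
  by congr S; apply: IH; have := par_lt (ltn0Sn u); lia.
rewrite /depth; case: v => // v _ /=; congr S.
by apply: fuel; have := par_lt (ltn0Sn v); lia.
Qed.

Lemma treepath_depth p k : treepath par p k -> treepath predn (depth \o p) k.
Proof.
move=> [p0 ps]; split=> [|h hk] /=; first by rewrite p0.
by have [->|[/depthS -> ->]] := ps h hk; [left|right].
Qed.

(** A path to a vertex is determined by its depth function: it runs through
the iterated parents of its end. *)
Lemma treepath_level p k l : treepath par p k -> l <= k ->
  p l = iter (depth (p k) - depth (p l)) par (p k).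
Proof.
elim: k => [|k IH] tp; first by rewrite leqn0 => /eqP ->; rewrite subnn.
rewrite leq_eqVlt => /predU1P[->|lk0]; first by rewrite subnn.
have lk : l <= k by [].
have tpk : treepath par p k.
  by case: tp => p0 ps; split=> // h hk; apply: ps; exact: ltnW.
have := IH tpk lk; have := treepath_leq predn_lt (treepath_depth tpk) lk (leqnn k).
have [->//|[/depthS + e]] := tp.2 k (ltnSn k); rewrite /= e => eS le pl.
rewrite [LHS]pl -e; have -> : depth (p k.+1) - depth (p l) = (depth (p k) - depth (p l)).+1.
  by rewrite eS subSn.
by rewrite iterSr e.
Qed.

(** Two paths to the same vertex differ only in the times of their steps, so
only depths have to be matched. *)
Lemma treepath_lift p h q k g K k0 : treepath par p h -> treepath par q k ->
  p h = q k -> treepath predn g K -> g K <= k -> h < k0 ->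
  (forall t, t < K -> g t.+1 != g t -> k0 %| t.+1) ->
  exists g', [/\ treepath predn g' K, g' K <= h &
    forall t, t <= K -> p (g' t) = q (g t)].
Proof.
move=> tp tq pq tg gk hk0 gj.
have gle t : t <= K -> g t <= k.
  by move=> tK; apply: leq_trans gk; exact: treepath_leq predn_lt tg tK (leqnn _).
have tqg := treepath_comp tq tg gk.
have dle : depth (q (g K)) <= depth (q k).
  by have := treepath_leq predn_lt (treepath_depth tq) gk (leqnn _).
have [||g' [tg' g'h g'P]] := @treepath_predn_lift (depth \o p) (depth \o (q \o g)) h K k0
    (depth (q k)) (treepath_depth tp) _ (treepath_depth tqg) dle hk0.
- by rewrite /= pq.
- move=> t tK; have [/eqP e|/(gj t tK)//] := boolP (g t.+1 == g t).
  by rewrite /= e eqxx.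
exists g'; split=> // t tK.
have g't : g' t <= h.
  by apply: leq_trans g'h; exact: treepath_leq predn_lt tg' tK (leqnn _).
rewrite (treepath_level tp g't) (treepath_level tq (gle _ tK)) pq.
by have /= -> := g'P t tK.
Qed.

Definition jumps (p : nat -> nat) k := [seq t <- iota 0 k | p t != p t.+1].

Lemma jumpsS p k : jumps p k.+1 = jumps p k ++ (if p k != p k.+1 then [:: k] else [::]).
Proof. by rewrite /jumps -[in LHS]addn1 iotaD filter_cat /= add0n. Qed.

Lemma depth_jumps p k l : treepath par p k -> l <= k ->
  depth (p l) + count (leq l) (jumps p k) = depth (p k).
Proof.
elim: k => [|k IH] tp; first by rewrite leqn0 => /eqP ->; rewrite /= addn0.
have tpk : treepath par p k.
  by case: tp => p0 ps; split=> // h hk; apply: ps; exact: ltnW.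
rewrite leq_eqVlt => /predU1P[->|lk].
  rewrite -[RHS]addn0; congr (_ + _); apply/eqP; rewrite eqn0Ngt -has_count.
  by apply/hasPn => t; rewrite mem_filter mem_iota; lia.
have := IH tpk lk; rewrite jumpsS count_cat addnA => ->.
have [->|[p1 e]] := tp.2 k (ltnSn k); first by rewrite eqxx /= addn0.
have := par_lt p1; rewrite e => lt; rewrite (depthS p1) e.
have -> : p k != p k.+1 by lia.
by rewrite /= (_ : leq l k = true) // addn1.
Qed.

Lemma size_jumps p k : treepath par p k -> size (jumps p k) = depth (p k).
Proof.
move=> tp; have [p0 _] := tp; have := depth_jumps tp (leq0n k).
by rewrite p0 add0n => <-; apply/esym/eqP; rewrite -all_count; apply/allP.
Qed.

(** The path is recovered from its end and the times of its steps: at time l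
the steps at times t >= l are still to come. *)
Lemma treepath_jumps p k l : treepath par p k -> l <= k ->
  p l = iter (count (leq l) (jumps p k)) par (p k).
Proof.
move=> tp lk; rewrite (treepath_level tp lk) -(depth_jumps tp lk).
by rewrite addKn.
Qed.

End Depth.

(** The climb that takes its steps at the times s * k0, for s in H.  The gaps
of length k0 leave room for lifting, and the choice of H is left to Ramsey's
theorem. *)
Definition sparse k0 (H : seq nat) t := count (fun s => s * k0 <= t) H.

Lemma sparse_nth k0 H i t : 0 < k0 -> sorted ltn H -> i < size H ->
  (i < sparse k0 H t) = (nth 0 H i * k0 <= t).
Proof.
rewrite /sparse => k00; elim: H i => [|x H IH] i //= sH iH.
have sH' := path_sorted sH.
case: (leqP (x * k0) t) => xt; last first.
  have xH : all (fun y => x < y) H by apply: order_path_min sH => ???; exact: ltn_trans.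
  have -> : count (fun s => s * k0 <= t) H = 0.
    apply/eqP; rewrite eqn0Ngt -has_count; apply/hasPn => y /(allP xH) xy; nia.
  case: i iH => [|i] iH /=; first by lia.
  have /(allP xH) : nth 0 H i \in H by apply: mem_nth.
  by nia.
by case: i iH => [|i] iH /=; rewrite add1n ltnS ?IH //; lia.
Qed.

Lemma sparseP k0 H M : 0 < k0 -> subseq H (iota 1 M) ->
  [/\ sorted ltn H, treepath predn (sparse k0 H) (M * k0),
    forall t, sparse k0 H t.+1 != sparse k0 H t -> k0 %| t.+1 &
    sparse k0 H (M * k0) = size H].
Proof.
move=> k00 HM.
have sH : sorted ltn H by apply: subseq_sorted HM _; [exact: ltn_trans|exact: iota_ltn_sorted].
have inH y : y \in H -> 0 < y <= M by move/(mem_subseq HM); rewrite mem_iota; lia.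
have uH : uniq H by apply: sorted_uniq sH; [exact: ltn_trans|exact: ltnn].
have split_ t : sparse k0 H t.+1 = sparse k0 H t + count (fun s => s * k0 == t.+1) H.
  rewrite /sparse; elim: (H) => //= y H' ->; lia.
split=> //.
- split=> [|t _].
    apply/eqP; rewrite eqn0Ngt -has_count; apply/hasPn => y /inH; nia.
  rewrite split_; have : count (fun s => s * k0 == t.+1) H <= 1.
    case: (pickP (fun s : 'I_M.+1 => s * k0 == t.+1)) => [s /eqP e|no].
      rewrite (eq_count (a2 := pred1 (nat_of_ord s))) ?count_uniq_mem ?leq_b1 //.
      by move=> y /=; rewrite -e eqn_pmul2r.
    rewrite leqW // leqn0 eqn0Ngt -has_count; apply/hasPn => y /inH yM.
    have yM' : y < M.+1 by lia.
    by have /= -> := no (Ordinal yM').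
  by case: (count _ _) => [|[|]] //; [left; lia|right; lia].
- move=> t; rewrite split_ => ne.
  have /hasP[s _ /eqP <-] : has (fun s => s * k0 == t.+1) H.
    by rewrite has_count; lia.
  exact: dvdn_mull.
- by apply/eqP; rewrite -all_count; apply/allP => y /inH; nia.
Qed.

(** * Substitution of variable words, and the last stage *)

(** Finitely many bounded values are coded by a finite type, so that colours
may be collected over all of them. *)
Lemma bounded_functions_coding n k B : exists (E : finType) (d : E -> nat -> nat -> nat),
  forall a : nat -> nat -> nat, (forall j h, j < n -> h <= k -> a j h <= B) ->
  exists e, forall j h, j < n -> h <= k -> d e j h = a j h.
Proof.
exists {ffun 'I_n.+1 * 'I_k.+1 -> 'I_B.+1}.
exists (fun (e : {ffun 'I_n.+1 * 'I_k.+1 -> 'I_B.+1}) j h =>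
  nat_of_ord (e (inord j, inord h))) => a aB.
exists [ffun x : 'I_n.+1 * 'I_k.+1 => inord (a x.1 x.2)] => j h jn hk.
by rewrite ffunE /= !inordK ?ltnS ?aB //; lia.
Qed.

Definition letter := (nat * (nat -> nat))%type.

Definition letter_on (b0 : seq nat) K (l : letter) :=
  [/\ l.1 < size b0, treepath predn l.2 K & l.2 K <= nth 0 b0 l.1].

Lemma leq_nth_sumn (s : seq nat) j : nth 0 s j <= sumn s.
Proof.
elim: s j => [|x s IH] [|j] //=; first exact: leq_addr.
by apply: leq_trans (IH j) _; exact: leq_addl.
Qed.

(** A finite alphabet for the paths of height K inside the blocks b0; codes of
anything else are decoded as the constant path at the root. *)
Lemma letters_coding b0 K : 0 < size b0 ->
  exists (Q : finType) (q0 : Q) (dec : Q -> letter),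
    (forall q, letter_on b0 K (dec q)) /\
    forall l, letter_on b0 K l -> exists q, (dec q).1 = l.1 /\
      forall t, t <= K -> (dec q).2 t = l.2 t.
Proof.
move=> b00.
have [Q [d dP]] := bounded_functions_coding 2 K (size b0 + sumn b0).
have root : letter_on b0 K (0, fun=> 0) by split=> //; split=> // h _; left.
pose dec q : letter := if `[< letter_on b0 K (d q 0 0, d q 1) >] then (d q 0 0, d q 1)
  else (0, fun=> 0).
have decP l : letter_on b0 K l -> exists q, (dec q).1 = l.1 /\
      forall t, t <= K -> (dec q).2 t = l.2 t.
  move=> [l1 l2 l3].
  have l2le t : t <= K -> l.2 t <= nth 0 b0 l.1.
    by move=> tK; apply: leq_trans l3; exact: treepath_leq predn_lt l2 tK (leqnn _).
  have [|q qP] := dP (fun j h => if j == 0 then l.1 else l.2 h).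
    move=> [|j] h _ hK /=; first lia.
    by have := l2le h hK; have := leq_nth_sumn b0 l.1; lia.
  have q1 : d q 0 0 = l.1 by apply: qP.
  have q2 t : t <= K -> d q 1 t = l.2 t by move=> tK; apply: qP.
  exists q; rewrite /dec; case: asboolP => // -[]; split; rewrite /= ?q1 ?q2 //.
  case: l2 => l0 lS; split=> [|h hK]; first by rewrite q2.
  by rewrite !q2 ?(ltnW hK) //; exact: lS.
have [q0 _] := decP _ root.
exists Q, q0, dec; split=> // q; rewrite /dec; by case: asboolP.
Qed.

Section Substitution.
Variables (b0 hs : seq nat) (K : nat) (Q : Type) (dec : Q -> letter).
Variable sp : nat -> nat -> nat.
Hypothesis decP : forall q, letter_on b0 K (dec q).
Hypothesis spP : forall x, x < size hs ->
  treepath predn (sp x) K /\ sp x K = nth 0 hs x.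

Definition letter_image (l : Q + nat) : letter :=
  match l with inl q => dec q | inr x => (size b0 + x, sp x) end.

(** A variable word over the paths in b0 as a map of blocks: constants go into
b0, and the variable x goes to block x of hs along the climb sp x. *)
Definition substitution_map (s : seq (Q + nat)) : block_map := fun j =>
  if j < size b0 then (j, id) else letter_image (nth (inr 0) s (j - size b0)).

(** Rigidity of the word is what makes the blocks of hs appear in order. *)
Lemma valid_substitution_map s : rigid s -> num_vars s = size hs ->
  valid_block_map (b0 ++ nseq (size s) K) (b0 ++ hs) (substitution_map s) /\ fixes b0 (substitution_map s).
Proof.
move=> rs vs.
have nthK t : t < size s -> nth 0 (b0 ++ nseq (size s) K) (size b0 + t) = K.
  move=> ts; rewrite nth_cat ltnNge leq_addr /= addKn nth_nseq ts //.
have nthh x : nth 0 (b0 ++ hs) (size b0 + x) = nth 0 hs x.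
  by rewrite nth_cat ltnNge leq_addr /= addKn.
have ntht t : t < size s -> s = take t s ++ nth (inr 0) s t :: drop t.+1 s.
  by move=> ts; rewrite -drop_nth // cat_take_drop.
split; last by move=> j jb; rewrite /substitution_map jb.
split=> [j|].
  rewrite size_cat size_nseq => js; rewrite /substitution_map; case: ltnP => jb /=.
    by rewrite !nth_cat jb; split=> //; split=> // h _; right.
  have [t et] : exists t, j = size b0 + t by exists (j - size b0); lia.
  have ts : t < size s by lia.
  rewrite et addKn nthK //.
  have := ntht t ts; case: (nth _ _ _) => [q|x] /= es.
    by have [q1 q2 q3] := decP q; split=> //; rewrite nth_cat q1.
  have xh : x < size hs by rewrite -vs es num_vars_cat num_vars_cons /=; lia.
  by have [? e] := spP xh; split=> //; rewrite nthh e.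
exists (fun j => if j <= size b0 then j else size b0 + num_vars (take (j - size b0) s)).
split=> //.
  rewrite !size_cat size_nseq; case: ifP => [|_]; last by rewrite addKn take_size vs.
  move=> le; have s0 : size s = 0 by lia.
  by rewrite s0 addn0 -vs (size0nil s0) num_vars_nil addn0.
move=> j; rewrite size_cat size_nseq => js; rewrite /substitution_map.
case: (ltnP j (size b0)) => jb /=.
  by right; rewrite ltnW //; split=> //; rewrite !nth_cat jb.
have [t et] : exists t, j = size b0 + t by exists (j - size b0); lia.
have ts : t < size s by lia.
have -> : (if j <= size b0 then j else size b0 + num_vars (take (j - size b0) s)) =
    size b0 + num_vars (take t s).
  rewrite et addKn; case: ifP => // le; have -> : t = 0 by lia.
  by rewrite take0 num_vars_nil.
rewrite (_ : j.+1 - size b0 = t.+1); last lia.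
rewrite (_ : j - size b0 = t); last lia.
rewrite (take_nth (inr 0)) // num_vars_rcons et nthK //.
have := ntht t ts; case: (nth _ _ _) => [q|x] /= es.
  by left; have [q1 _ _] := decP q; rewrite maxn0; split=> //; lia.
have xv := rs _ _ _ es.
have xh : x < size hs by rewrite -vs es num_vars_cat num_vars_cons /=; lia.
have [xlt|xge] := ltnP x (num_vars (take t s)).
  by left; split; lia.
have ex : x = num_vars (take t s) by lia.
have [_ e] := spP xh.
by right; split; [lia|lia|rewrite nthh e ex].
Qed.

(** The word that takes the values d on b0, followed by the images under d of
the letters of w. *)
Definition spell (d : nat -> nat -> nat) (w : seq Q) (q0 : Q) : nat -> nat -> nat :=
  fun j h => if j < size b0 then d j h else
    d (dec (nth q0 w (j - size b0))).1 ((dec (nth q0 w (j - size b0))).2 h).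

(** If f x lifts the letter of block x to b0, then substituting f for the
variables has the same effect as reading the original word. *)
Lemma spell_substitution a d f l : agree b0 (size b0) a d ->
  (forall x t, x < letter_bound l -> t <= K ->
     a (dec (f x)).1 ((dec (f x)).2 t) = a (size b0 + x) (sp x t)) ->
  forall t, t <= K -> a (letter_image l).1 ((letter_image l).2 t) =
     d (dec (subst_letter f l)).1 ((dec (subst_letter f l)).2 t).
Proof.
move=> ad lift t tK.
have ale q : a (dec q).1 ((dec q).2 t) = d (dec q).1 ((dec q).2 t).
  have [q1 q2 q3] := decP q; apply: ad => //; apply: leq_trans q3.
  exact: treepath_leq predn_lt q2 tK (leqnn _).
by case: l lift => [q|x] /= lift; rewrite ?ale // -ale lift.
Qed.

End Substitution.

(** Letters rise by at most one above what has been reached, so no vertex is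
left out. *)
Lemma reached_attained par (par_lt : forall v, 0 < v -> par v < v) hs a m u :
  0 < m -> (forall j, j < m -> treepath par (a j) (nth 0 hs j) /\
     a j (nth 0 hs j) <= (reached a hs j).+1) -> u <= reached a hs m ->
  exists j h, [/\ j < m, h <= nth 0 hs j & a j h = u].
Proof.
case: (posnP u) => [-> m0 ea _|u0]; first by exists 0, 0; split=> //; have [[]] := ea 0 m0.
elim: m => // m IH _ ea; rewrite reachedS => um.
have [le|lt] := leqP u (reached a hs m).
  have m0 : 0 < m by case: (posnP m) le => // ->; rewrite reached0; lia.
  have [|j [h [jm hj e]]] := IH m0 _ le; first by move=> j jm; apply: ea; lia.
  by exists j, h; split=> //; lia.
by exists m, (nth 0 hs m); split=> //; have [_] := ea m (ltnSn m); lia.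
Qed.

Section Lift.
Variables (par : nat -> nat) (N : nat).
Hypothesis par_lt : forall v, 0 < v -> par v < v.

(** A later letter that ends in a vertex met on b0 is, when read along a slow
climb g, the image of a path in b0: choose a place of b0 above its end and
lift. *)
Lemma epi_word_lift b0 hs a x K k0 g : epi_word par N (b0 ++ hs) a -> 0 < size b0 ->
  x < size hs -> a (size b0 + x) (nth 0 hs x) <= reached a b0 (size b0) ->
  sumn b0 < k0 -> treepath predn g K -> g K = nth 0 hs x ->
  (forall t, t < K -> g t.+1 != g t -> k0 %| t.+1) ->
  exists l, letter_on b0 K l /\
    forall t, t <= K -> a l.1 (l.2 t) = a (size b0 + x) (g t).
Proof.
move=> [ea _] b00 xh le k0P tg gK gj.
have [|j [h [jb hj e]]] := @reached_attained par par_lt b0 a (size b0) _ b00 _ le.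
  move=> j jb; have [|e1 e2] := ea j; first by rewrite size_cat; lia.
  by move: e1 e2; rewrite nth_cat jb reached_cat // ltnW.
have [|tj _] := ea j; first by rewrite size_cat; lia.
have [|tx _] := ea (size b0 + x); first by rewrite size_cat; lia.
have tjh : treepath par (a j) h.
  rewrite nth_cat jb in tj.
  by case: tj => t0 tS; split=> // t th; apply: tS; exact: leq_trans hj.
rewrite nth_cat ltnNge leq_addr /= addKn in tx.
have [||g' [tg' g'h g'P]] := treepath_lift par_lt tjh tx e tg _ _ gj.
- by rewrite gK.
- by apply: leq_ltn_trans k0P; apply: leq_trans hj _; exact: leq_nth_sumn.
by exists (j, g'); split=> //; split=> //=; exact: leq_trans hj.
Qed.

Lemma epi_word_coding b0 : exists (E : finType) (d : E -> nat -> nat -> nat),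
  forall hs a, epi_word par N (b0 ++ hs) a -> exists e, agree b0 (size b0) a (d e).
Proof.
have [E [d dP]] := bounded_functions_coding (size b0) (sumn b0) N.
exists E, d => hs a [ea sa].
have [|e eP] := dP (fun j h => if h <= nth 0 b0 j then a j h else 0).
  move=> j h jb _; case: ifP => // hj.
  have [|tj _] := ea j; first by rewrite size_cat; lia.
  rewrite nth_cat jb in tj; apply: leq_trans (treepath_leq par_lt tj hj (leqnn _)) _.
  rewrite -sa; apply: (@leq_trans (reached a (b0 ++ hs) j.+1)).
    by rewrite reachedS nth_cat jb leq_max leqnn orbT.
  by apply: reached_mono; rewrite size_cat; lia.
exists e => j h jb hj; rewrite eP ?hj //.
by apply: leq_trans hj _; exact: leq_nth_sumn.
Qed.

Lemma sparse_block hs H M k0 x : 0 < k0 -> subseq H (iota 1 M) -> x < size hs ->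
  size H = sumn hs ->
  let g := sparse k0 (take (nth 0 hs x) H) in
  [/\ treepath predn g (M * k0), g (M * k0) = nth 0 hs x &
    forall t, t < M * k0 -> g t.+1 != g t -> k0 %| t.+1].
Proof.
move=> k00 HM xh sH.
have [|_ p2 p3 p4] := @sparseP k0 (take (nth 0 hs x) H) M k00.
  exact: subseq_trans (take_subseq _ _) HM.
split=> //; last by move=> t _; exact: p3.
by rewrite p4 size_takel // sH leq_nth_sumn.
Qed.

(** Once every vertex has been met, all letters lift to b0.  Words over the
paths in b0 are coloured by the values of c for all possible words on b0
simultaneously, and the Hales-Jewett theorem applies. *)
Lemma ramsey_from_last : ramsey_from par N N.
Proof.
move=> b0 hs R b00.
pose k0 := (sumn b0).+1; pose K := sumn hs * k0.
have [Q [q0 [dec [decP decS]]]] := letters_coding K b00.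
have [E [d dP]] := epi_word_coding b0.
have [M MP] := hales_jewett (size hs) Q {ffun E -> R}.
exists (nseq M K) => c lc.
have [s [ss rs vs sc]] := MP (fun w => [ffun e => c (spell b0 dec (d e) w q0)]).
pose sp x := sparse k0 (take (nth 0 hs x) (iota 1 (sumn hs))).
have spP x (xh : x < size hs) := @sparse_block hs _ _ k0 x (ltn0Sn _)
  (subseq_refl _) xh (size_iota 1 _).
have sp1 x : x < size hs -> treepath predn (sp x) K /\ sp x K = nth 0 hs x.
  by move=> /spP[].
have [vg fg] := valid_substitution_map decP sp1 rs vs; rewrite ss in vg.
exists (substitution_map b0 dec sp s); split=> //.
have key a e : epi_word par N (b0 ++ hs) a -> reached a b0 (size b0) = N ->
    agree b0 (size b0) a (d e) -> exists f,
    c (reindex a (substitution_map b0 dec sp s)) = c (spell b0 dec (d e) (subst_word f s) q0).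
  move=> ea sta ade.
  have lift x : exists q, x < size hs -> forall t, t <= K ->
      a (dec q).1 ((dec q).2 t) = a (size b0 + x) (sp x t).
    have [xh|] := ltnP x (size hs); last by exists q0.
    have [s1 s2 s3] := spP x xh.
    have [||l [lb lP]] := epi_word_lift ea b00 xh _ _ s1 s2 s3 => //.
      rewrite sta; have [_ <-] := ea.
      apply: (@leq_trans (reached a (b0 ++ hs) (size b0 + x).+1)).
        by rewrite reachedS nth_cat ltnNge leq_addr /= addKn leq_max leqnn orbT.
      by apply: reached_mono; rewrite size_cat; lia.
    have [q [q1 q2]] := decS l lb; exists q => _ t tK.
    by rewrite q1 q2 // lP.
  have [f fP] := choice lift; exists f; apply: lc => j h.
  rewrite size_cat size_nseq nth_cat nth_nseq /reindex /spell /substitution_map => jM.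
  case: ltnP => jb hj /=; first exact: ade.
  have jM' : j - size b0 < size s by lia.
  rewrite -ss jM' in hj.
  rewrite (nth_map (inr 0)) //.
  have vl : letter_bound (nth (inr 0) s (j - size b0)) <= size hs.
    rewrite -vs -[s in num_vars s](cat_take_drop (j - size b0)) (drop_nth (inr 0)) //.
    by rewrite num_vars_cat num_vars_cons; lia.
  apply: (spell_substitution decP ade) => // x t xl tK; apply: fP => //; lia.
move=> a a' ea ea' sta aa'.
have [e ade] := dP _ _ ea.
have ade' : agree b0 (size b0) a' (d e) by apply: agree_trans ade; exact: agree_sym.
have sta' : reached a' b0 (size b0) = N by rewrite -(reached_agree aa').
have [f ->] := key a e ea sta ade; have [f' ->] := key a' e ea' sta' ade'.
by have /ffunP/(_ e) := sc f f'; rewrite !ffunE.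
Qed.

End Lift.

(** * The induction on the vertices already met *)

Lemma first_occurrence (Q : Type) (s : seq (Q + nat)) x : rigid s -> x < num_vars s ->
  exists s1 s2, s = s1 ++ inr x :: s2 /\ num_vars s1 = x.
Proof.
elim/last_ind: s => [|s l IH]; first by rewrite num_vars_nil.
move=> /rigid_rconsE[rs vl]; rewrite num_vars_rcons => xv.
have [lt|le] := ltnP x (num_vars s).
  have [s1 [s2 [-> v1]]] := IH rs lt; exists s1, (rcons s2 l).
  by rewrite -rcons_cons -rcons_cat.
exists s, [::]; rewrite cats1; case: l vl xv => [q|y] /= vl xv; first by lia.
have -> : y = x by lia.
by split=> //; lia.
Qed.

Lemma subseq_mask_code (X S : seq nat) : uniq X -> subseq S X ->
  exists b : (size X).-tuple bool, mask b X = S.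
Proof. by move=> uX /subseqP[m sm ->]; exists (tcast sm (in_tuple m)); rewrite val_tcast. Qed.

Section Core.
Variables (par : nat -> nat) (N : nat).
Hypothesis par_lt : forall v, 0 < v -> par v < v.

(** Reading a path along the climb with step times H k0 gives a path to the
same vertex, whose step times are the members of H that correspond to the steps
of p, multiplied by k0. *)
Lemma sparse_path p k H M k0 l : treepath par p k -> 0 < k0 -> subseq H (iota 1 M) ->
  k <= size H ->
  p (sparse k0 (take k H) l) =
  iter (count (fun s => l < s * k0) (map (nth 0 H) (jumps p k))) par (p k).
Proof.
move=> tp k00 HM kH.
have [|sH tg _ gK] := @sparseP k0 (take k H) M k00.
  exact: subseq_trans (take_subseq _ _) HM.
have le : sparse k0 (take k H) l <= k.
  by rewrite -[X in _ <= X](size_takel kH); exact: count_size.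
rewrite (treepath_jumps par_lt tp le) count_map; congr iter.
apply: eq_in_count => t; rewrite mem_filter mem_iota add0n => /andP[_ tk] /=.
have tk' : t < size (take k H) by rewrite size_takel.
by rewrite leqNgt (sparse_nth _ k00 sH tk') nth_take // -ltnNge.
Qed.

Lemma subseq_jumps p k H : k <= size H -> subseq (map (nth 0 H) (jumps p k)) H.
Proof.
move=> kH; rewrite -[X in subseq _ X](mkseq_nth 0); apply: map_subseq.
apply: (subseq_trans (filter_subseq _ _)).
by rewrite -(subnKC kH) iotaD add0n prefix_subseq.
Qed.

Lemma first_reach hs a n0 i : epi_word par N hs a -> n0 <= size hs -> reached a hs n0 = i -> i < N ->
  exists x, [/\ n0 + x < size hs, reached a hs (n0 + x) = i, reached a hs (n0 + x).+1 = i.+1 &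
    a (n0 + x) (nth 0 hs (n0 + x)) = i.+1].
Proof.
move=> [ea sa] n0s sti iN.
have ex : exists m, (m <= size hs) && (i < reached a hs m) by exists (size hs); rewrite leqnn sa.
case: (ex_minnP ex) => m /andP[ms im] mmin.
have n0m : n0 < m.
  by rewrite ltnNge; apply/negP => /(reached_mono a hs); rewrite sti; lia.
exists (m.-1 - n0); rewrite (_ : n0 + (m.-1 - n0) = m.-1); last lia.
have le : reached a hs m.-1 <= i.
  by rewrite leqNgt; apply/negP => lt; have := mmin m.-1; rewrite lt andbT; lia.
have ge : i <= reached a hs m.-1 by rewrite -sti; apply: reached_mono; lia.
have [|_ step] := ea m.-1; first by lia.
have em : m.-1.+1 = m by lia.
have := reachedS a hs m.-1; rewrite em => stm.
by split; lia.
Qed.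

(** The letters before the first one that reaches i.+1 lift to b0, so the
prefix version of the Hales-Jewett theorem makes the colour independent of
them.  What is left is the path that reaches i.+1, which is determined by its
set of step times, of fixed size depth par i.+1; Ramsey's theorem yields a set H
of times for which the colour no longer depends on it. *)
Lemma ramsey_from_prefix i : i < N -> prefix_ramsey_from par N i -> ramsey_from par N i.
Proof.
move=> iN pre b0 hs R b00.
have [E [d dP]] := epi_word_coding N par_lt b0.
pose v := i.+1; pose a0 := depth par v.
have [M MP] := ramsey a0 (sumn hs) {ffun E -> R}.
pose X := iota 1 M.
have sX : size X = M by rewrite size_iota.
pose k0 := (sumn b0).+1; pose K := M * k0.
have [Q [q0 [dec [decP decS]]]] := letters_coding K b00.
pose lam (S : seq nat) l := iter (count (fun s => l < s * k0) S) par v.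
have lamK (b : M.-tuple bool) : lam (mask b X) K = v.
  rewrite /lam (_ : count _ _ = 0) //; apply/eqP; rewrite eqn0Ngt -has_count.
  apply/hasPn => s /mem_mask; rewrite mem_iota; nia.
have [L LP] := prefix_hales_jewett (size hs) q0 {ffun M.-tuple bool * E -> R}.
have [cs csP] := pre b0 (nseq L K) R b00.
exists cs => c lc; have [g1 [v1 f1 c1]] := csP c lc.
have lc1 := local_colouring_reindex v1 lc.
pose P (y : seq Q * M.-tuple bool * E) f :=
  [/\ epi_word par N (b0 ++ nseq L K) f, reached f b0 (size b0) = i,
      size y.1.1 < L,
      agree (b0 ++ nseq L K) (size b0 + size y.1.1) f (spell b0 dec (d y.2) y.1.1 q0) &
      forall t, t <= K -> f (size b0 + size y.1.1) t = lam (mask y.1.2 X) t].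
have nthK t : t < L -> nth 0 (b0 ++ nseq L K) (size b0 + t) = K.
  by move=> tL; rewrite nth_cat ltnNge leq_addr /= addKn nth_nseq tL.
(* both words reach i.+1 exactly at the end of their common prefix *)
have Puniq y f f' : P y f -> P y f' -> c (reindex f g1) = c (reindex f' g1).
  move=> [e1 s1 sL a1 l1] [e2 s2 _ a2 l2].
  have agb : agree b0 (size b0) f (d y.2).
    apply/(agree_cat (nseq L K) _ _ (leqnn _)).
    apply: (@agree_trans _ _ (spell b0 dec (d y.2) y.1.1 q0)).
      by apply: agree_le a1; lia.
    by move=> j h jb _; rewrite /spell jb.
  have sti : reached f (b0 ++ nseq L K) (size b0 + size y.1.1) = i.
    suff H t : t <= size y.1.1 -> reached f (b0 ++ nseq L K) (size b0 + t) = i by apply: H.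
    elim: t => [_|t IH tw]; first by rewrite addn0 reached_cat.
    rewrite addnS reachedS IH ?(ltnW tw) // nthK; last by lia.
    apply/maxn_idPl; rewrite a1; [|lia|by rewrite nthK //; lia].
    rewrite /spell ltnNge leq_addr /= addKn.
    have [q1 q2 q3] := decP (nth q0 y.1.1 t).
    rewrite -agb // -s1; apply: (@leq_trans (reached f b0 (dec (nth q0 y.1.1 t)).1.+1)).
      rewrite reachedS leq_max; apply/orP; right; case: e1 => /(_ (dec (nth q0 y.1.1 t)).1).
      rewrite size_cat nth_cat q1 => /(_ (leq_trans q1 (leq_addr _ _)))[tp _] _.
      exact: treepath_leq par_lt tp q3 (leqnn _).
    exact: reached_mono.
  apply: (c1 f f' (size b0 + size y.1.1).+1) => //.
  - by rewrite size_cat size_nseq; lia.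
  - move=> j h; rewrite ltnS leq_eqVlt => /predU1P[->|jlt] hj.
      by rewrite nthK // in hj; rewrite l1 // l2.
    by rewrite a1 // a2.
  - by rewrite reachedS sti nthK // l1 // lamK; rewrite /v; lia.
(* the colour of a prefix, through an arbitrary completion *)
have [compl complP] : exists compl, forall y, (exists f, P y f) -> P y (compl y).
  suff /choice[compl complP] : forall y, exists f, (exists f, P y f) -> P y f by exists compl.
  move=> y; have [[f Pf]|no] := pselect (exists f, P y f); first by exists f.
  by exists (fun _ _ => 0).
have [s [ss rs vs [r rP]]] := LP (fun w => [ffun be => c (reindex (compl (w, be.1, be.2)) g1)]).
have [code codeP] : exists code : seq nat -> M.-tuple bool,
    forall S, subseq S X -> mask (code S) X = S.
  suff /choice[code codeP] : forall S, exists b : M.-tuple bool, subseq S X -> mask b X = S.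
    by exists code.
  move=> S; have [/(subseq_mask_code (iota_uniq _ _))|no] := boolP (subseq S X).
    by rewrite -/X sX => -[b be]; exists b.
  by exists [tuple false | _ < M].
have [|H [HX sH HP]] := MP (fun S => [ffun e => r (code S, e)]) X; first by rewrite sX.
pose sp x := sparse k0 (take (nth 0 hs x) H).
have spP x (xh : x < size hs) := @sparse_block hs H M k0 x (ltn0Sn _) HX xh sH.
have sp1 x : x < size hs -> treepath predn (sp x) K /\ sp x K = nth 0 hs x.
  by move=> /spP[].
have [vg fg] := valid_substitution_map decP sp1 rs vs; rewrite ss in vg.
exists (block_map_comp (substitution_map b0 dec sp s) g1); split.
- exact: valid_block_map_comp vg v1.
- exact: fixes_comp fg f1.
(* the colour depends only on the word on b0 and on the step times S *)
have key a e : epi_word par N (b0 ++ hs) a -> reached a b0 (size b0) = i ->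
    agree b0 (size b0) a (d e) -> exists S, [/\ subseq S H, size S = a0 &
    c (reindex a (block_map_comp (substitution_map b0 dec sp s) g1)) = r (code S, e)].
  move=> ea sta ade.
  have [|||x [xs stx stx1 ax]] := @first_reach (b0 ++ hs) a (size b0) i ea.
  - by rewrite size_cat leq_addr.
  - by rewrite reached_cat.
  - by [].
  have xh : x < size hs by rewrite size_cat in xs; lia.
  have nthh y : nth 0 (b0 ++ hs) (size b0 + y) = nth 0 hs y.
    by rewrite nth_cat ltnNge leq_addr /= addKn.
  rewrite nthh in ax.
  have tx : treepath par (a (size b0 + x)) (nth 0 hs x).
    by have [ea1 _] := ea; have [] := ea1 _ xs; rewrite nthh.
  have lift y : exists q, y < x -> forall t, t <= K ->
      a (dec q).1 ((dec q).2 t) = a (size b0 + y) (sp y t).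
    have [yx|] := ltnP y x; last by exists q0.
    have yh : y < size hs by exact: ltn_trans xh.
    have [s1 s2 s3] := spP y yh.
    have [||l [lb lP]] := epi_word_lift par_lt ea b00 yh _ _ s1 s2 s3 => //.
      rewrite sta -stx; apply: (@leq_trans (reached a (b0 ++ hs) (size b0 + y).+1)).
        by rewrite reachedS nthh leq_max leqnn orbT.
      by apply: reached_mono; lia.
    have [q [q1 q2]] := decS l lb; exists q => _ t tK.
    by rewrite q1 q2 // lP.
  have [f fP] := choice lift.
  pose S := map (nth 0 H) (jumps (a (size b0 + x)) (nth 0 hs x)).
  have kH : nth 0 hs x <= size H by rewrite sH leq_nth_sumn.
  have SH : subseq S H by exact: subseq_jumps.
  have sS : size S = a0 by rewrite size_map (size_jumps par_lt tx) ax.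
  exists S; split=> //.
  have [|s1 [s2 [es vs1]]] := first_occurrence (x := x) rs; first by rewrite vs.
  have szs1 : size s1 < L by rewrite -ss es size_cat /=; lia.
  have <- : c (reindex (compl (subst_word f s1, code S, e)) g1) = r (code S, e).
    by have /ffunP/(_ (code S, e)) := rP s1 x s2 f es vs1; rewrite ffunE.
  suff Pa : P (subst_word f s1, code S, e) (reindex a (substitution_map b0 dec sp s)).
    exact: (Puniq _ _ _ Pa (complP _ (ex_intro _ _ Pa))).
  rewrite /P /= size_map; split=> //.
  - exact: epi_word_reindex vg.
  - by rewrite (reached_agree (fixes_agree a fg)).
  - move=> j h js; rewrite nth_cat nth_nseq /reindex /spell /substitution_map.
    case: ltnP => jb hj /=; first exact: ade.
    have js1 : j - size b0 < size s1 by lia.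
    rewrite (_ : j - size b0 < L) in hj; last lia.
    rewrite (nth_map (inr 0)) // {1 2}es nth_cat js1.
    have vl : letter_bound (nth (inr 0) s1 (j - size b0)) <= x.
      rewrite -vs1 -[s1 in num_vars s1](cat_take_drop (j - size b0)) (drop_nth (inr 0)) //.
      by rewrite num_vars_cat num_vars_cons; lia.
    apply: (spell_substitution decP ade) => // y t yl tK; apply: fP => //; lia.
  - move=> t tK; rewrite /reindex /substitution_map ltnNge leq_addr /= addKn es nth_cat ltnn subnn /=.
    rewrite codeP; last exact: subseq_trans HX.
    by rewrite /sp (sparse_path _ tx (ltn0Sn _) HX kH) ax.
move=> a a' ea ea' sta aa'.
have [e ade] := dP _ _ ea.
have ade' : agree b0 (size b0) a' (d e) by apply: agree_trans ade; exact: agree_sym.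
have sta' : reached a' b0 (size b0) = i by rewrite -(reached_agree aa').
have [S [SH sS ->]] := key a e ea sta ade.
have [S' [SH' sS' ->]] := key a' e ea' sta' ade'.
by have /ffunP/(_ e) := HP S S' SH SH' sS sS'; rewrite !ffunE.
Qed.

Lemma ramsey_from_all i : i <= N -> ramsey_from par N i.
Proof.
move=> iN; rewrite -(subKn iN); elim: (N - i) => [|j IH].
  by rewrite subn0; exact: ramsey_from_last.
have [lt|ge] := ltnP j N; last by rewrite (_ : N - j.+1 = N - j) //; lia.
apply: ramsey_from_prefix; first by lia.
apply: prefix_ramsey_from_next => //; rewrite (_ : (N - j.+1).+1 = N - j) //; lia.
Qed.

End Core.

(** A block of height 0 plays the part of the root: it is the prescribed part
at the start of the induction, and it supplies the constant path as a
letter. *)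
Lemma ramsey_words (par : nat -> nat) (N : nat) (hs : seq nat) (R : finType) :
  (forall v, 0 < v -> par v < v) ->
  exists cs, forall c : (nat -> nat -> nat) -> R, local_colouring (0 :: cs) c ->
  exists g, valid_block_map (0 :: cs) (0 :: hs) g /\
    forall a a', epi_word par N (0 :: hs) a -> epi_word par N (0 :: hs) a' ->
      c (reindex a g) = c (reindex a' g).
Proof.
move=> par_lt; have [|cs csP] := @ramsey_from_all par N par_lt 0 (leq0n N) [:: 0] hs R.
  by [].
exists cs => c /csP[g [vg _ gP]]; exists g; split=> // a a' ea ea'.
have a0 b : epi_word par N (0 :: hs) b -> b 0 0 = 0 by move=> [/(_ 0 (ltn0Sn _))[[]]].
apply: gP => //; first by rewrite reachedS reached0 /= max0n a0.
by move=> [|j] [|h] //= _ _; rewrite !a0.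
Qed.

(** * Root paths in fans *)

Section FanPaths.
Variable T : finite_fan.
Notation e := (@fan_edge T).
Notation r := (fan_root T).

(** Where two simple paths with the same ends first part, their remainders
join the two next vertices avoiding x, and closing up through x gives a cycle. *)
Lemma simple_path_unique x p q :
  path e x p -> uniq (x :: p) -> path e x q -> uniq (x :: q) ->
  last x p = last x q -> p = q.
Proof.
elim: p x q => [|a p IH] x [|b q] //=.
- by move=> _ _ _ /andP[+ _] xq; rewrite xq mem_last.
- by move=> _ /andP[+ _] _ _ xp; rewrite -xp mem_last.
move=> /andP[xa pp] /andP[xp up] /andP[xb pq] /andP[xq uq] pq_last.
have [ab|ab] := eqVneq a b.
  by subst b; congr (_ :: _); exact: IH pq_last.
pose e' := [rel u v | e u v && ((u != x) && (v != x))].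
have path' u s : path e u s -> x \notin u :: s -> path e' u s.
  elim: s u => //= v s IHs u /andP[uv vs].
  rewrite !inE !negb_or => /and3P[xu xv xs].
  rewrite uv /= eq_sym xu eq_sym xv IHs //= inE negb_or xv //.
have e'sym : symmetric e' by move=> u v; rewrite /= fan_edge_sym [(u != x) && _]andbC.
have cab : connect e' a b.
  apply: (@connect_trans _ _ (last a p)); first by apply/connectP; exists p => //; exact: path'.
  rewrite pq_last (sym_connect_sym e'sym); apply/connectP; exists q => //; exact: path'.
case/connectP: cab => s0 ps0; case/shortenP: ps0 => s ps us _ lb.
have eps : path e a s by apply: sub_path ps => u v /andP[].
have xs : x \notin a :: s.
  have xa' : x != a by move: xp; rewrite inE negb_or => /andP[].
  rewrite inE negb_or xa' /=; elim: (s) a ps {us lb eps xa xp up pp ab path' pq_last IH xa'} => //= v s' IHs u.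
  by move=> /andP[/and3P[_ _ vx] /IHs]; rewrite inE negb_or eq_sym vx.
have := @fan_acyclic T (x :: a :: s).
case: s ps us lb eps xs => [|v s] ps us lb eps xs; first by rewrite lb eqxx in ab.
move=> /(_ _) H; suff : size [:: x, a, v & s] <= 2 by [].
apply: H; apply/andP; split; last by rewrite cons_uniq xs.
rewrite /cycle rcons_path -cat1s /= xa /=.
move: eps => /= ->; rewrite /= fan_edge_sym.
by move: lb => /= <-.
Qed.

Definition root_path_spec t p :=
  [/\ path e r p, uniq (r :: p) & last r p = t].

Lemma root_path_exists t : exists p, root_path_spec t p.
Proof.
have /connectP[p0 pp lt] := fan_connected r t.
by case: (shortenP pp) lt => p pp' up _ ->; exists p.
Qed.

(** The simple path from the root to t, without its first vertex. *)
Definition root_path t := sval (cid (root_path_exists t)).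

Lemma root_pathP t : root_path_spec t (root_path t).
Proof. exact: svalP (cid (root_path_exists t)). Qed.

Lemma root_path_eq t p : root_path_spec t p -> root_path t = p.
Proof.
move=> [p1 p2 p3]; have [q1 q2 q3] := root_pathP t.
by apply: (simple_path_unique q1 q2 p1 p2); rewrite p3.
Qed.

Lemma fan_leE s t : fan_le s t <-> s \in r :: root_path t.
Proof.
split=> [[p [p1 p2 p3 sp]]|sp].
  by rewrite (@root_path_eq t p).
by have [p1 p2 p3] := root_pathP t; exists (root_path t).
Qed.

Lemma root_path_root : root_path r = [::].
Proof. exact: root_path_eq. Qed.

Lemma root_path_last t : last r (root_path t) = t.
Proof. by have [] := root_pathP t. Qed.

Lemma root_path_uniq t : uniq (r :: root_path t).
Proof. by have [] := root_pathP t. Qed.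

Lemma root_path_inj : injective root_path.
Proof. by move=> s t st; rewrite -(root_path_last s) st root_path_last. Qed.

Lemma root_path_prefix t p1 p2 : root_path t = p1 ++ p2 -> root_path (last r p1) = p1.
Proof.
move=> et; have [q1 q2 q3] := root_pathP t; apply: root_path_eq; split=> //.
  by move: q1; rewrite et cat_path => /andP[].
by move: q2; rewrite et -cat_cons cat_uniq => /and3P[].
Qed.

Lemma fan_le_prefix s t : fan_le s t <-> exists p, root_path t = root_path s ++ p.
Proof.
rewrite fan_leE; split=> [|[p ->]]; last first.
  by rewrite -cat_cons mem_cat -{1}(root_path_last s) mem_last.
move=> /splitPl sp; move: (erefl (root_path t)); case: {2}_ / sp => p1 p2 lp et.
by exists p2; rewrite -lp (root_path_prefix et).
Qed.

(** The order of the fan is the prefix order of root paths, so immediate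
successors extend the root path by one vertex. *)
Lemma immediate_successorE s t :
  immediate_successor s t <-> root_path t = rcons (root_path s) t.
Proof.
split=> [[/fan_le_prefix[[|a p] et] st nb]|et].
- by case: st; apply: root_path_inj; rewrite et cats0.
- have ut := root_path_uniq t; have lt := root_path_last t.
  have ea : root_path a = rcons (root_path s) a.
    by rewrite -(@root_path_prefix t (rcons (root_path s) a) p) ?last_rcons // et cat_rcons.
  case: p et => [|b p] et.
    by move: lt; rewrite et last_cat /= => <-; rewrite cats1.
  case: nb; exists a; split.
  + move=> as_; move: (root_path_uniq a); rewrite ea as_ => /= /andP[_].
    have : s \in r :: root_path s by rewrite -{1}(root_path_last s) mem_last.
    rewrite inE rcons_uniq => /predU1P[sr|->//] _.
    by move: ea (root_path_uniq a); rewrite as_ => ->; rewrite sr /= mem_rcons inE eqxx.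
  + move=> at_; move: ut lt; rewrite et -cat_cons cat_uniq last_cat /= at_ => /and3P[_ _].
    by case/andP => + _ => /[swap] <-; rewrite mem_last.
  + by apply/fan_le_prefix; exists [:: a]; rewrite ea cats1.
  + by apply/fan_le_prefix; exists (b :: p); rewrite ea cat_rcons.
split.
- by apply/fan_le_prefix; exists [:: t]; rewrite cats1.
- by move=> st; move: et; rewrite st => /(congr1 size); rewrite size_rcons; lia.
- move=> [p [ps pt /fan_le_prefix[q1 ep] /fan_leE]]; rewrite et -rcons_cons mem_rcons inE.
  case/predU1P => [//|/fan_leE/fan_le_prefix[q2 es]].
  apply: ps; apply: root_path_inj; move: es; rewrite ep -catA => /(congr1 size).
  by rewrite !size_cat => es; rewrite (_ : q1 = [::]) ?cats0 //; apply: size0nil; lia.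
Qed.

Lemma fan_relE s t : fan_rel s t <-> s = t \/ root_path t = rcons (root_path s) t.
Proof. by rewrite /fan_rel; split=> -[->|/immediate_successorE h]; [left|right|left|right]. Qed.

End FanPaths.

(** * Maximal chains as enumerations *)

Lemma discrete_continuous (X : discreteTopologicalType) (Y : topologicalType) (f : X -> Y) :
  continuous f.
Proof. by move=> x U /nbhs_singleton Ufx; rewrite nbhs_principalE => y ->. Qed.

Definition comparable_sets (X : Type) (C D : set X) := C `<=` D \/ D `<=` C.

Section Enumeration.
Variable A : Fc.
Notation S := (fan_structure A).
Notation r := (fan_root A).

Definition initial (e : seq A) (i : nat) : set S := [set x | (x : A) \in take i.+1 e].

Lemma down_closed_root (D : set S) : D !=set0 -> @downwards_closed A D -> D r.
Proof.
move=> [x Dx] dD; apply: dD Dx; apply/fan_leE; exact: mem_head.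
Qed.

Lemma chain_comparable (C D : set S) : Fc_chain C -> Fc_chain D -> comparable_sets C D.
Proof. by have [_] := @Fc_is_chain A; apply. Qed.

Lemma chain_nonempty (C : set S) : Fc_chain C -> C !=set0.
Proof. by have [/(_ C) h _] := @Fc_is_chain A; move=> /h[]. Qed.

Lemma fan_closed (C : set S) : closed C.
Proof. exact: (@discrete_closed (discrete_topology A)). Qed.

(** Maximality of the chain, in the form in which it is used. *)
Lemma chain_maximal (D : set S) : D !=set0 -> @downwards_closed A D ->
  (forall C, Fc_chain C -> comparable_sets C D) -> Fc_chain D.
Proof.
move=> D0 dD cmp; apply: Fc_maximal => //; split=> [C [/chain_nonempty ? | -> ]|].
- by split=> //; exact: fan_closed.
- by split=> //; exact: fan_closed.
move=> C E [CC|->] [EC|->].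
- exact: chain_comparable.
- exact: cmp.
- by have [] := cmp _ EC; [right|left].
- by left.
Qed.

(** A member of the chain that is not the whole fan has a successor with one
more vertex.  Take the smallest member E of the chain not contained in the
given one, and a new vertex t of E with the shortest root path: adding t keeps
the set downwards closed and comparable with all members. *)
Lemma chain_step (e : seq A) (i : nat) : Fc_chain (initial e i) ->
  take i.+1 e = e -> uniq e -> size e < #|A| ->
  exists t, [/\ t \notin e & Fc_chain [set x : S | (x : A) \in rcons e t]].
Proof.
move=> ce te ue se.
have full : Fc_chain [set: S].
  apply: chain_maximal => //; first by exists r.
  by move=> C _; left.
have out : exists y : A, y \notin e.
  apply: contrapT => /forallNP no.
  have : #|A| <= #|e|.
    by apply: subset_leq_card; apply/fintype.subsetP => y _; apply: contrapT => /negP /(no y).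
  by rewrite (card_uniqP ue); lia.
pose card (E : set S) := #|[set y : A | `[< E y >]]%SET|.
pose big n := `[< exists E : set S, [/\ Fc_chain E, (exists2 y : A, E y & y \notin e) & card E = n] >].
have [n0 n0P] : exists n, big n.
  by exists (card setT); apply/asboolP; exists setT; split=> //; have [y] := out; exists y.
case: (@ex_minnP big (ex_intro _ n0 n0P)) => n /asboolP[E [EC [y0 Ey0 y0e] En]] nmin.
(* E has least cardinality, hence lies in every member that contains a new vertex *)
have Emin C y : Fc_chain C -> C y -> (y : A) \notin e -> E `<=` C.
  move=> CC Cy ye; have [//|CE] := chain_comparable EC CC.
  have : n <= card C by apply: nmin; apply/asboolP; exists C; split=> //; exists y.
  rewrite -En => le x Ex; apply: contrapT => nCx.
  have : card C < card E.
    apply: proper_card; apply/properP; split.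
      by apply/fintype.subsetP => z; rewrite !inE; exact: CE.
    by exists x; rewrite ?inE //; apply/negP; rewrite inE.
  lia.
pose P m := `[< exists y : A, [/\ E y, y \notin e & size (root_path y) = m] >].
have [m0 m0P] : exists m, P m.
  by exists (size (root_path (y0 : A))); apply/asboolP; exists y0.
case: (@ex_minnP P (ex_intro _ m0 m0P)) => m /asboolP[t [Et te' tm]] mmin.
exists t; split=> //.
have eE : initial e i `<=` E.
  have [//|Ee] := chain_comparable ce EC.
  by exfalso; move: te'; have := Ee t Et; rewrite /initial te /= => ->.
have eC (C : set S) : Fc_chain C -> C `<=` [set x : S | (x : A) \in rcons e t] \/
    [set x : S | (x : A) \in rcons e t] `<=` C.
  move=> CC; have [[y Cy ye]|no] := pselect (exists2 y : A, C y & y \notin e).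
    right=> z /=; rewrite mem_rcons inE => /predU1P[->|ze].
      exact: Emin CC Cy ye _ Et.
    by apply: (Emin _ _ CC Cy ye); apply: eE; rewrite /initial te.
  left=> z Cz /=; rewrite mem_rcons inE; apply/orP; right.
  by apply: contrapT => /negP nz; apply: no; exists z.
apply: chain_maximal => //; first by exists t; rewrite /= mem_rcons mem_head.
move=> s u su /=; rewrite mem_rcons inE => /predU1P[ut|ue'].
  rewrite ut in su; have [->|st] := eqVneq s t; first by rewrite mem_rcons mem_head.
  rewrite mem_rcons inE; apply/orP; right; apply: contrapT => /negP se'.
  have Es : E s by apply: (Fc_downwards_closed EC su).
  have : m <= size (root_path s) by apply: mmin; apply/asboolP; exists s.
  move: su => /fan_le_prefix[[|a p] et]; move: (tm); rewrite et size_cat /=; last by lia.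
  by move=> _ _; move/negP: st; apply; apply/eqP/root_path_inj; rewrite et cats0.
rewrite mem_rcons inE; apply/orP; right.
have : initial e i s by apply: (Fc_downwards_closed ce su); rewrite /initial te.
by rewrite /initial te.
Qed.

(** A maximal chain amounts to an enumeration of the vertices: its members are
the initial segments. *)
Definition enumeration (e : seq A) := [/\ uniq e, size e = #|A|,
  nth r e 0 = r & forall i, i < size e -> Fc_chain (initial e i)].

Lemma enumeration_exists : exists e, enumeration e.
Proof.
have A0 : 0 < #|A| by apply/card_gt0P; exists r.
suff H m : m < #|A| -> exists e : seq A, [/\ uniq e, size e = m.+1,
    nth r e 0 = r & forall i, i < size e -> Fc_chain (initial e i)].
  by have [|e] := H #|A|.-1; rewrite prednK //; exists e.
elim: m => [_|m IH mA].
  exists [:: r]; split=> // -[|//] _; rewrite /initial /=.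
  apply: chain_maximal.
  - by exists r; rewrite /= inE.
  - by move=> s t /fan_leE hs /=; rewrite !inE => /eqP te; move: hs; rewrite te root_path_root inE.
  - move=> C CC; right=> x /=; rewrite inE => /eqP ->.
    exact: down_closed_root (chain_nonempty CC) (Fc_downwards_closed CC).
have [e [ue se e0 ce]] := IH (ltnW mA).
have te : take m.+1 e = e by rewrite take_oversize ?se.
have [||t [te' tC]] := @chain_step e m _ te ue; first by apply: ce; rewrite se.
  by rewrite se.
exists (rcons e t); split.
- by rewrite rcons_uniq te' ue.
- by rewrite size_rcons se.
- by rewrite nth_rcons se.
move=> i; rewrite size_rcons ltnS leq_eqVlt => /predU1P[->|ie].
  by rewrite /initial take_oversize ?size_rcons.
have -> : initial (rcons e t) i = initial e i.
  by rewrite /initial -cats1 takel_cat.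
exact: ce.
Qed.

Lemma enumeration_mem e (x : A) : enumeration e -> x \in e.
Proof.
move=> [ue se _ _]; have : e =i A.
  by apply/subset_cardP; [rewrite (card_uniqP ue)|apply/fintype.subsetP].
by move=> ->.
Qed.

(** The initial segments grow by one vertex at a time, so nothing else fits
between them. *)
Lemma comparable_initial e (D : set S) : enumeration e -> D !=set0 ->
  (forall C, Fc_chain C -> comparable_sets C D) ->
  exists2 i, i < size e & D = initial e i.
Proof.
move=> ee D0 cmp; have [ue se e0 ce] := ee.
have A0 : 0 < size e by rewrite se; apply/card_gt0P; exists r.
have ex : exists i, `[< D `<=` initial e i >].
  exists (size e).-1; apply/asboolP => x _; rewrite /initial /= prednK // take_size.
  exact: enumeration_mem.
case: (ex_minnP ex) => i /asboolP Di imin.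
have ie : i < size e.
  rewrite -(prednK A0) ltnS; apply: imin; apply/asboolP => x _.
  by rewrite /initial /= prednK // take_size; exact: enumeration_mem.
exists i => //; apply/seteqP; split=> // x.
rewrite /initial /= (take_nth r) // mem_rcons inE.
case: i Di imin ie => [|i] Di imin ie.
  rewrite take0 inE orbF e0 => /eqP ->; case: D0 => y Dy; have := Di y Dy.
  by rewrite /initial /= (take_nth r) // take0 /= inE e0 => /eqP <-.
have ie' : i < size e by exact: ltnW.
have nD : ~ D `<=` initial e i by move=> /asboolP /imin; rewrite ltnn.
have iD : initial e i `<=` D by have [//|/nD] := cmp _ (ce i ie').
case/predU1P => [->|xi]; last exact: iD.
apply: contrapT => nDx; apply: nD => y Dy; have := Di y Dy.
rewrite /initial /= (take_nth r) // mem_rcons inE => /predU1P[yx|//].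
by rewrite -yx in nDx.
Qed.

(** Downwards closure is automatic: the members of the chain have all possible
sizes. *)
Lemma chain_of_comparable (D : set S) : D !=set0 ->
  (forall C, Fc_chain C -> comparable_sets C D) -> Fc_chain D.
Proof.
move=> D0 cmp; have [e ee] := enumeration_exists.
have [i ie ->] := comparable_initial ee D0 cmp.
by case: ee => _ _ _; apply.
Qed.

End Enumeration.

Lemma chain_epi_comp (C B A : chain_structure) (g : B -> A) (f : C -> B) :
  chain_epimorphism g -> chain_epimorphism f -> chain_epimorphism (g \o f).
Proof.
move=> [[cg sg rg] hg] [[cf sf rf] hf]; split; [split|].
- by move=> x; apply: continuous_comp; [exact: cf|exact: cg].
- by move=> x; have [y <-] := sg x; have [z <-] := sf y; exists z.
- move=> x1 x2; split=> [/rg[y1 [y2 [<- <- /rf[z1 [z2 [<- <- rz]]]]]]|].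
    by exists z1, z2.
  move=> [z1 [z2 [/= e1 e2 rz]]]; apply/rg; exists (f z1), (f z2); split=> //.
  by apply/rf; exists z1, z2.
- by move=> D DC; rewrite -image_comp; apply: hg; exact: hf.
Qed.

(** The images of the initial segments of B grow by at most one vertex at a
time, so no member of the chain of A is skipped. *)
Lemma chain_epi_cover (B A : Fc) (f : Fc_structure B -> Fc_structure A) (D : set (Fc_structure A)) :
  chain_epimorphism f -> chain_family D -> exists2 C, chain_family C & f @` C = D.
Proof.
move=> [[cf sf rf] hf] DC; have [e ee] := enumeration_exists B.
have [ue se e0 ce] := ee.
have B0 : 0 < size e by rewrite se; apply/card_gt0P; exists (fan_root B).
have full : D `<=` f @` initial e (size e).-1.
  move=> x _; have [y <-] := sf x; exists y => //.
  by rewrite /initial /= prednK // take_size; exact: enumeration_mem.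
have ex : exists i, `[< D `<=` f @` initial e i >] by exists (size e).-1; apply/asboolP.
case: (ex_minnP ex) => i /asboolP Di imin.
have ie : i < size e by rewrite -(prednK B0) ltnS; apply: imin; apply/asboolP.
exists (initial e i); first exact: ce.
apply/seteqP; split=> // _ [x + <-].
have D0 : D !=set0 by exact: chain_nonempty DC.
case: i Di imin ie => [|i] Di imin ie.
  rewrite /initial /= (take_nth (fan_root B)) // take0 /= inE => /eqP ->.
  case: D0 => y Dy; have [z + zy] := Di y Dy.
  by rewrite /initial /= (take_nth (fan_root B)) // take0 /= inE => /eqP <-; rewrite zy.
have ie' : i < size e by exact: ltnW.
have nD : ~ D `<=` f @` initial e i by move=> /asboolP /imin; rewrite ltnn.
have iD : f @` initial e i `<=` D.
  by have [//|/nD] := chain_comparable (hf _ (ce i ie')) DC.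
rewrite /initial /= (take_nth (fan_root B)) // mem_rcons inE.
case/predU1P => [->|xi]; last by apply: iD; exists x.
apply: contrapT => nDx; apply: nD => y Dy; have [z + zy] := Di y Dy.
rewrite /initial /= (take_nth (fan_root B)) // mem_rcons inE => /predU1P[ez|zi].
  by rewrite -ez zy in nDx.
by exists z.
Qed.

(** * Fans given by a parent function *)

Section TreeFan.
Variables (par : nat -> nat) (N : nat).
Hypothesis par_lt : forall v, 0 < v -> par v < v.
Hypothesis par_inj : forall u u', 0 < par u -> par u = par u' -> u = u'.

Definition tree_edge : rel 'I_N.+1 := fun s t =>
  [|| s == t, (0 < s) && (par s == t) | (0 < t) && (par t == s)].

Lemma tree_edge_refl : reflexive tree_edge.
Proof. by move=> s; rewrite /tree_edge eqxx. Qed.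

Lemma tree_edge_sym : symmetric tree_edge.
Proof. by move=> s t; rewrite /tree_edge eq_sym; congr (_ || _); rewrite orbC. Qed.

Lemma tree_edge_lt s t : tree_edge s t -> t < s -> par s = t.
Proof.
case/or3P => [/eqP ->|/andP[_ /eqP//]|/andP[t0 /eqP e]]; first by rewrite ltnn.
by have := par_lt t0; rewrite e; lia.
Qed.

Lemma tree_path v : v < N.+1 -> exists p : seq 'I_N.+1,
  [/\ path tree_edge ord0 p, uniq (ord0 :: p), last ord0 p = v :> nat &
    forall u, u \in ord0 :: p -> u <= v].
Proof.
elim/ltn_ind: v => v IH vN; case: (posnP v) => [->|v0].
  by exists [::]; split=> // u; rewrite inE => /eqP ->.
have [|p [p1 p2 p3 p4]] := IH _ (par_lt v0); first by have := par_lt v0; lia.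
have vp : Ordinal vN \notin ord0 :: p.
  by apply/negP => /p4 /=; have := par_lt v0; lia.
exists (rcons p (Ordinal vN)); split.
- by rewrite rcons_path p1 /tree_edge /= p3 v0 /= eqxx !orbT.
- by rewrite -rcons_cons rcons_uniq vp.
- by rewrite last_rcons.
- move=> u; rewrite -rcons_cons mem_rcons inE => /predU1P[->//|/p4].
  by have := par_lt v0; lia.
Qed.

Lemma tree_connected s t : connect tree_edge s t.
Proof.
have c0 u : connect tree_edge ord0 u.
  have [p [p1 _ p3 _]] := tree_path (ltn_ord u).
  by apply/connectP; exists p => //; apply: val_inj.
by apply: (connect_trans _ (c0 t)); rewrite (sym_connect_sym tree_edge_sym).
Qed.

(** Both neighbours on the cycle of its largest vertex m are the parent of
m. *)
Lemma tree_acyclic (c : seq 'I_N.+1) : ucycle tree_edge c -> size c <= 2.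
Proof.
case: c => [//|x0 c0] uc.
have [m mc mmax] : exists2 m, m \in x0 :: c0 & forall u, u \in x0 :: c0 -> u <= m.
  have := @arg_maxnP _ x0 (mem (x0 :: c0)) val (mem_head _ _).
  by case=> m mc mmax; exists m.
have [i p ep] := rot_to mc.
have : ucycle tree_edge (m :: p).
  by move: uc; rewrite /ucycle -ep rot_cycle rot_uniq.
have sz : size (x0 :: c0) = size (m :: p) by rewrite -ep size_rot.
have pm u : u \in p -> u <= m.
  by move=> up; apply: mmax; rewrite -(mem_rot i) ep inE up orbT.
rewrite sz; case: p pm {ep sz} => [//|x p] pm; rewrite /ucycle /= rcons_path.
case/andP => /and3P[mx _ lm] /andP[mp xp].
have lt u : u \in x :: p -> u < m.
  move=> up; rewrite ltn_neqAle pm // andbT; apply/eqP => /val_inj um.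
  by move: mp; rewrite -um up.
have px := tree_edge_lt mx (lt x (mem_head _ _)).
have pl := tree_edge_lt (etrans (tree_edge_sym _ _) lm) (lt _ (mem_last _ _)).
have xl : x = last x p by apply: val_inj; rewrite /= -px -pl.
by case: p xp xl {pm mx lm mp lt pl} => // y p /andP[+ _] /= xl; rewrite xl mem_last.
Qed.

(** By injectivity of par on the children of nonroot vertices, the neighbours
are the parent and at most one child. *)
Lemma tree_degree (s : 'I_N.+1) : s != ord0 -> #|[set t | tree_edge s t & t != s]%SET| <= 2.
Proof.
move=> s0; have s0' : 0 < s by rewrite lt0n.
have ps : par s < N.+1 by have := par_lt s0'; have := ltn_ord s; lia.
have [[c [c0 pc]]|no] := pselect (exists c : 'I_N.+1, 0 < c /\ par c = s).
  apply: (@leq_trans #|[set Ordinal ps; c]%SET|); last by rewrite cards2; case: (_ == _).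
  apply: subset_leq_card; apply/fintype.subsetP => t.
  rewrite !finset.inE => /andP[/or3P[/eqP st|/andP[_ /eqP e]|/andP[t0 /eqP e]] ts].
  - by rewrite st eqxx in ts.
  - by apply/orP; left; apply/eqP/val_inj.
  - by apply/orP; right; apply/eqP/val_inj/par_inj; rewrite ?e.
apply: (@leq_trans #|[set Ordinal ps]%SET|); last by rewrite cards1.
apply: subset_leq_card; apply/fintype.subsetP => t.
rewrite !finset.inE => /andP[/or3P[/eqP st|/andP[_ /eqP e]|/andP[t0 /eqP e]] ts].
- by rewrite st eqxx in ts.
- by apply/eqP/val_inj.
- by case: no; exists t.
Qed.

Definition tree_fan : finite_fan :=
  @MkFiniteFan 'I_N.+1 tree_edge ord0 tree_edge_refl tree_edge_sym tree_connected
    tree_acyclic tree_degree.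

Lemma tree_root_path_le (v : tree_fan) (u : tree_fan) :
  u \in fan_root tree_fan :: root_path v -> (u : 'I_N.+1) <= (v : 'I_N.+1).
Proof.
have [p [p1 p2 p3 p4]] := tree_path (ltn_ord (v : 'I_N.+1)).
rewrite (@root_path_eq tree_fan v p); first exact: p4.
by split=> //; apply: val_inj.
Qed.

Lemma tree_root_path (v u : tree_fan) : 0 < (v : 'I_N.+1) -> par (v : 'I_N.+1) = (u : 'I_N.+1) ->
  root_path v = rcons (root_path u) v.
Proof.
move=> v0 e; apply: root_path_eq; have [p1 p2 p3] := root_pathP u.
have vp : v \notin fan_root tree_fan :: root_path u.
  by apply/negP => /tree_root_path_le; have := par_lt v0; rewrite e; lia.
split.
- rewrite rcons_path p1 p3 /= /tree_edge v0 e eqxx !orbT //.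
- by rewrite -rcons_cons rcons_uniq vp.
- by rewrite last_rcons.
Qed.

Lemma tree_rel (s t : tree_fan) :
  fan_rel s t <-> s = t \/ 0 < (t : 'I_N.+1) /\ par (t : 'I_N.+1) = (s : 'I_N.+1).
Proof.
rewrite fan_relE; split=> -[->|]; [by left| |by left|]; last first.
  by move=> [t0 e]; right; exact: tree_root_path.
move=> e; right; case: (posnP (t : 'I_N.+1)) => [t0|t0].
  have te : t = fan_root tree_fan by apply: val_inj.
  by move: e; rewrite te root_path_root => /(congr1 size); rewrite size_rcons.
split=> //.
have pt : par (t : 'I_N.+1) < N.+1.
  by have := par_lt t0; have := ltn_ord (t : 'I_N.+1); lia.
move: e; rewrite (@tree_root_path t (Ordinal pt : tree_fan)) // => /rcons_inj[/root_path_inj <-].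
by [].
Qed.

Definition tree_chain : set (set (fan_structure tree_fan)) :=
  [set D | exists2 v : nat, v <= N & D = [set u | (u : 'I_N.+1) <= v]].

Lemma tree_is_chain : is_chain tree_chain.
Proof.
split=> [_ [v _ ->]|_ _ [v _ ->] [w _ ->]].
  by split; [exists (ord0 : 'I_N.+1)|exact: (@discrete_closed (discrete_topology tree_fan))].
by have [vw|wv] := leqP v w; [left|right] => u /= uv; lia.
Qed.

Lemma tree_downwards_closed D : tree_chain D -> @downwards_closed tree_fan D.
Proof.
move=> [v _ ->] s t /fan_leE/tree_root_path_le st /= tv; exact: leq_trans tv.
Qed.

Lemma tree_maximal (D : set (fan_structure tree_fan)) : D !=set0 ->
  @downwards_closed tree_fan D -> is_chain (tree_chain `|` [set D]) -> tree_chain D.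
Proof.
move=> D0 _ [_ cmp].
have ex : exists v, `[< D `<=` [set u | (u : 'I_N.+1) <= v] >].
  by exists N; apply/asboolP => u _ /=; rewrite -ltnS ltn_ord.
case: (ex_minnP ex) => v /asboolP Dv vmin.
have vN : v <= N by apply: vmin; apply/asboolP => u _ /=; rewrite -ltnS ltn_ord.
exists v => //; apply/seteqP; split=> // u /= uv.
case: v Dv vmin vN uv => [|v] Dv vmin vN uv.
  by case: D0 => x Dx; have := Dv x Dx => /= x0; rewrite (_ : u = x) //; apply: val_inj => /=; lia.
have nD : ~ D `<=` [set u | (u : 'I_N.+1) <= v] by move=> /asboolP /vmin; rewrite ltnn.
have vD : [set u : fan_structure tree_fan | (u : 'I_N.+1) <= v] `<=` D.
  have [||//|/nD//] := cmp [set u | (u : 'I_N.+1) <= v] D; last by right.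
  by left; exists v => //; exact: ltnW.
move: uv; rewrite leq_eqVlt => /predU1P[uv|uv]; last exact: vD.
apply: contrapT => nDu; apply: nD => x Dx /=; have := Dv x Dx; rewrite /= leq_eqVlt.
by case/predU1P => // xv; case: nDu; rewrite (_ : u = x) //; apply: val_inj; rewrite /= uv xv.
Qed.

(** The fan on 0, ..., N in which par gives the parents, with the initial
segments as its chain. *)
Definition tree_Fc : Fc :=
  @MkFc tree_fan tree_chain tree_is_chain tree_downwards_closed tree_maximal.

Lemma tree_epimorphism (A : Fc) (f : nat -> A) :
  f 0 = fan_root A ->
  (forall v, 0 < v <= N -> f v = f (par v) \/ root_path (f v) = rcons (root_path (f (par v))) (f v)) ->
  (forall a, exists2 v, v <= N & f v = a) ->
  (forall v, v <= N -> @chain_family (Fc_structure A) [set f u | u in [set u | u <= v]]) ->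
  @chain_epimorphism (Fc_structure tree_Fc) (Fc_structure A) (fun v : 'I_N.+1 => f v).
Proof.
move=> f0 fS fsurj fC.
have ordP v : v <= N -> exists x : 'I_N.+1, x = v :> nat.
  by move=> vN; exists (Ordinal (vN : v < N.+1)).
split; [split|].
- exact: (@discrete_continuous (discrete_topology 'I_N.+1)).
- by move=> a; have [v /ordP[x <-] <-] := fsurj a; exists x.
- move=> x1 x2; split=> [/fan_relE[<-|e]|[y1 [y2 [<- <- /tree_rel[->|[y20 e]]]]]].
  + have [v /ordP[x <-] <-] := fsurj x1; exists x, x; split=> //; exact/fan_relE/or_introl.
  + have ex : exists v, (v <= N) && (f v == x2).
      by have [v vN <-] := fsurj x2; exists v; rewrite vN eqxx.
    case: (ex_minnP ex) => v /andP[vN /eqP fv] vmin.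
    have v0 : 0 < v.
      rewrite lt0n; apply/eqP => v0; move: e; rewrite -fv v0 f0 root_path_root.
      by move=> /(congr1 size); rewrite size_rcons.
    have pv : par v <= N by have := par_lt v0; lia.
    have [|E|E] := fS v; first by rewrite v0.
      have : v <= par v by apply: vmin; rewrite pv -E fv eqxx.
      by have := par_lt v0; lia.
    move: e; rewrite -fv E => /rcons_inj[/root_path_inj <-].
    have [y1 y1E] := ordP _ pv; have [y2 y2E] := ordP _ vN.
    exists y1, y2; rewrite y1E y2E; split=> //.
    by apply/tree_rel; right; rewrite y1E y2E.
  + exact/fan_relE/or_introl.
  + apply/fan_relE; rewrite -e; have [|E|E] := fS y2; [|by left|by right].
    by rewrite y20 -ltnS ltn_ord.
- move=> _ [v vN ->]; have := fC v vN; congr chain_family.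
  apply/seteqP; split=> [_ [u /= uv <-]|_ [u /= uv <-]]; last by exists u.
  by have [x xE] := ordP _ (leq_trans uv vN); exists x; rewrite /= xE.
Qed.

End TreeFan.

(** * Two cofinal families of fans *)

(** Branches of height k one after the other: branch j consists of the
vertices j * k + 1, ..., j * k + k above the root 0. *)
Definition lexpar k v := if k %| v.-1 then 0 else v.-1.
(** The vertex at height h of branch j; height 0 is the root. *)
Definition lex_code k j h := if h == 0 then 0 else j * k + h.

Lemma lexpar_lt k v : 0 < v -> lexpar k v < v.
Proof. by rewrite /lexpar; case: ifP; lia. Qed.

Lemma lexpar_inj k u u' : 0 < lexpar k u -> lexpar k u = lexpar k u' -> u = u'.
Proof. by rewrite /lexpar; do 2 case: ifP => _ //; lia. Qed.

Lemma lexpar_lex_code k j h : h < k -> lexpar k (lex_code k j h.+1) = lex_code k j h.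
Proof.
move=> hk; rewrite /lexpar /lex_code addnS /= dvdn_addr ?dvdn_mull //.
case: (posnP h) => [->|h0]; first by rewrite dvdn0.
by rewrite gtnNdvd // -lt0n h0.
Qed.

Lemma lex_code_div k v : 0 < v -> lex_code k (v.-1 %/ k) (v.-1 %% k).+1 = v.
Proof. by move=> v0; rewrite /lex_code addnS -divn_eq prednK. Qed.

Lemma lex_code_divK k j h : h < k -> ((lex_code k j h.+1).-1 %/ k = j) * ((lex_code k j h.+1).-1 %% k = h).
Proof.
move=> hk; rewrite /lex_code addnS /= divnMDl ?modnMDl; last lia.
by rewrite divn_small // modn_small // addn0.
Qed.

Lemma lex_code_le k n j h : j < n -> h <= k -> lex_code k j h <= n * k.
Proof. by rewrite /lex_code; case: ifP => // _; nia. Qed.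

Lemma div_lt k n v : 0 < v <= n * k -> v.-1 %/ k < n /\ v.-1 %% k < k.
Proof.
move=> vn; have k0 : 0 < k by case: k vn => //; lia.
by rewrite ltn_mod ltn_divLR //; split=> //; lia.
Qed.

Definition lex_Fc n k := tree_Fc (n * k) (@lexpar_lt k) (@lexpar_inj k).

(** The root path of t as a function of time that stays at t once it gets
there. *)
Definition walk (T : finite_fan) (t : T) h :=
  nth (fan_root T) (fan_root T :: root_path t) (minn h (size (root_path t))).

Lemma root_path_walk (T : finite_fan) (t : T) h : root_path (walk t h) = take h (root_path t).
Proof.
rewrite -[RHS](@root_path_prefix _ t _ (drop h (root_path t))) ?cat_take_drop //.
congr root_path; rewrite /walk.
have [hs|hs] := leqP h (size (root_path t)).
  rewrite (last_nth (fan_root T)) size_takel //.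
  by case: h hs => //= h hs; rewrite nth_take.
rewrite take_oversize ?(ltnW hs) //.
by rewrite (last_nth (fan_root T)).
Qed.

Lemma walkS (T : finite_fan) (t : T) h : walk t h.+1 = walk t h \/
  root_path (walk t h.+1) = rcons (root_path (walk t h)) (walk t h.+1).
Proof.
rewrite !root_path_walk; have [hs|hs] := ltnP h (size (root_path t)).
  by right; rewrite (take_nth (fan_root T)) // /walk (minn_idPl hs).
by left; rewrite /walk (minn_idPr hs) (minn_idPr (leqW hs)).
Qed.

Lemma walk_le (T : finite_fan) (t : T) h : fan_le (walk t h) t.
Proof.
apply/fan_le_prefix; exists (drop h (root_path t)).
by rewrite root_path_walk cat_take_drop.
Qed.

Lemma walk_end (T : finite_fan) (t : T) h : size (root_path t) <= h -> walk t h = t.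
Proof. by move=> th; apply: root_path_inj; rewrite root_path_walk take_oversize. Qed.

(** Send branch j along the root path of the vertex with number j.+1 in the
enumeration of A.  All vertices below that one have been met before, so each
branch adds a single vertex to the image. *)
Lemma lex_cover (A : Fc) : exists n k (f : Fc_structure (lex_Fc n k) -> Fc_structure A),
  0 < k /\ chain_epimorphism f.
Proof.
have [e ee] := enumeration_exists A; have [ue se e0 ce] := ee.
have A0 : 0 < #|A| by apply/card_gt0P; exists (fan_root A).
pose r := fan_root A; pose k := #|A|; pose n := #|A|.-1.
pose f v := if v is 0 then r else walk (nth r e (v.-1 %/ k).+1) (v.-1 %% k).+1.
have fcode j h : h <= k -> f (lex_code k j h) = walk (nth r e j.+1) h.
  case: h => [_|h hk]; first by rewrite /f /lex_code /walk min0n.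
  have [c1 c2] := lex_code_divK j hk.
  case ec : (lex_code k j h.+1) => [|v]; first by move: ec; rewrite /lex_code /=; lia.
  by rewrite /f -ec c1 c2.
have pk (t : A) : size (root_path t) <= k.
  have := max_card (mem (r :: root_path t)).
  by rewrite (card_uniqP (root_path_uniq t)) /=; exact: ltnW.
have fend j : f (lex_code k j k) = nth r e j.+1 by rewrite fcode // walk_end.
exists n, k, (fun v : 'I_(n * k).+1 => f v); split=> //.
apply: tree_epimorphism => //.
- move=> v vn; have [jn hk] := div_lt vn.
  have /andP[v0 _] := vn; rewrite -(lex_code_div k v0) lexpar_lex_code // !fcode //; last exact: ltnW.
  exact: walkS.
- move=> a; have := enumeration_mem a ee; move=> ae.
  have : index a e < size e by rewrite index_mem.
  case ei : (index a e) => [|i] ie.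
    by exists 0 => //; rewrite -(nth_index r ae) ei e0.
  exists (lex_code k i k); first by apply: lex_code_le => //; rewrite /n -se; lia.
  by rewrite fend -ei nth_index.
- move=> v vn; apply: chain_of_comparable; first by exists (f 0), 0.
  move=> C CC.
  have [i ie ->] := comparable_initial ee (chain_nonempty CC)
    (fun D DC => chain_comparable DC CC).
  case: (posnP v) => [->|v0].
    right=> _ [u /= + <-]; rewrite leqn0 => /eqP ->.
    have <- : nth r e 0 = f 0 by exact: e0.
    by rewrite /initial /= -(nth_take r (ltn0Sn i)) mem_nth // size_takel.
  have vn' : 0 < v <= n * k by rewrite v0.
  have [jn hk] := div_lt vn'; pose j := v.-1 %/ k.
  have initP i' x : i' < size e -> initial e i' x <-> exists2 l, l <= i' & x = nth r e l.
    move=> i's; rewrite /initial /=; split=> [/(nthP r)[l]|[l li ->]].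
      by rewrite size_takel // => li <-; exists l => //; rewrite nth_take.
    by rewrite -(nth_take r (_ : l < i'.+1)) // mem_nth // size_takel.
  have [ij|ji] := leqP i j.
    left=> _ /(initP _ _ ie)[[|l] li ->] /=; first by exists 0; rewrite //= e0.
    exists (lex_code k l k); last by rewrite fend.
    have := divn_eq v.-1 k; rewrite /lex_code -/j /= (_ : (k == 0) = false); last by rewrite /k; lia.
    by nia.
  right=> _ [u /= uv <-]; case: (posnP u) => [->|u0].
    by apply/(initP _ _ ie); exists 0; rewrite //= e0.
  have un : 0 < u <= n * k by rewrite u0 (leq_trans uv).
  have [jn' hk'] := div_lt un; have ju : u.-1 %/ k <= j by apply: leq_div2r; lia.
  rewrite -(lex_code_div k u0) fcode //.
  apply: (Fc_downwards_closed (ce i ie) (walk_le _ _)).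
  by apply/(initP _ _ ie); exists (u.-1 %/ k).+1 => //; lia.
Qed.

(** The vertex v of the lexicographic fan becomes 2 v, and the odd numbers are
leaves attached to the root. *)
Definition spread_par k v := if odd v then 0 else (lexpar k v./2).*2.

Lemma spread_par_lt k v : 0 < v -> spread_par k v < v.
Proof.
move=> v0; rewrite /spread_par; case: ifP => // ov.
have : 0 < v./2 by lia.
by move/(lexpar_lt k); lia.
Qed.

Lemma spread_par_inj k u u' : 0 < spread_par k u -> spread_par k u = spread_par k u' -> u = u'.
Proof.
rewrite /spread_par; case: ifP => // ou; case: ifP => ou'; first by lia.
move=> l0 l1; have : u./2 = u'./2 by apply: (@lexpar_inj k); lia.
lia.
Qed.

(** No vertex other than a neighbour of the root directly follows its
parent. *)
Lemma spread_par_gap k v : spread_par k v = 0 \/ (spread_par k v).+1 < v.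
Proof.
rewrite /spread_par; case: ifP => ov; first by left.
case: (posnP v) => [->|v0]; first by left; rewrite /lexpar /= dvdn0.
have : 0 < v./2 by lia.
by move/(lexpar_lt k); right; lia.
Qed.

Definition spread_Fc n k := tree_Fc (n * k).*2 (@spread_par_lt k) (@spread_par_inj k).

(** The additional leaves collapse to the root, which is always there. *)
Lemma spread_cover n k : exists f : Fc_structure (spread_Fc n k) -> Fc_structure (lex_Fc n k),
  chain_epimorphism f.
Proof.
pose f v : lex_Fc n k := if odd v then ord0 else inord v./2.
have fE v : v <= (n * k).*2 -> (f v : 'I_(n * k).+1) = (if odd v then 0 else v./2) :> nat.
  by move=> vn; rewrite /f; case: ifP => //= ov; rewrite inordK //; lia.
exists (fun v : 'I_((n * k).*2).+1 => f v); apply: tree_epimorphism.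
- by apply: val_inj; rewrite /= inordK.
- move=> v /andP[v0 vn]; rewrite /spread_par; case: ifP => ov.
    by left; apply: val_inj; rewrite /= !fE // ov.
  have v20 : 0 < v./2 by lia.
  right; apply: tree_root_path; first by rewrite fE // ov.
  have := lexpar_lt k v20 => lt.
  by rewrite !fE ?ov ?odd_double ?doubleK //; lia.
- move=> a; exists ((a : 'I_(n * k).+1) : nat).*2.
    by rewrite leq_double -ltnS ltn_ord.
  apply: val_inj; rewrite /= fE ?odd_double ?doubleK //.
  by rewrite leq_double -ltnS ltn_ord.
- move=> v vn; exists v./2; first by lia.
  apply/seteqP; split=> [_ [u /= uv <-]|a /= av].
    by rewrite fE; [case: ifP; lia|lia].
  exists ((a : 'I_(n * k).+1) : nat).*2; first by rewrite /=; lia.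
  by apply: val_inj; rewrite /= fE ?odd_double ?doubleK //; lia.
Qed.

(** * The Ramsey theorem for fans with chains *)

Section Words.
Variables (par : nat -> nat) (N : nat).
Hypothesis par_lt : forall v, 0 < v -> par v < v.
Hypothesis par_inj : forall u u', 0 < par u -> par u = par u' -> u = u'.
Hypothesis par_gap : forall v, par v = 0 \/ (par v).+1 < v.
Variables (n k : nat).
Notation A := (tree_Fc N par_lt par_inj).
Notation B := (lex_Fc n k).

Definition value (f : Fc_structure B -> Fc_structure A) (v : nat) : nat :=
  (f (inord v : 'I_(n * k).+1) : 'I_N.+1).

(** Letter j.+1 is the image of branch j; letter 0 is the block of height
0. *)
Definition word_of_epi (f : Fc_structure B -> Fc_structure A) (j h : nat) : nat :=
  if j is j'.+1 then value f (lex_code k j' h) else 0.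

Section Epi.
Variable f : Fc_structure B -> Fc_structure A.
Hypothesis ef : chain_epimorphism f.
Notation F := (value f).

Lemma value_le v : F v <= N. Proof. by rewrite -ltnS ltn_ord. Qed.

(** Preservation of the chains: the image of an initial segment is an initial
segment. *)
Lemma value_segment v x : v <= n * k -> x <= F v -> exists2 u, u <= v & F u = x.
Proof.
move=> vn xF; have [_ hf] := ef.
have [|w wN E] := hf [set u | (u : 'I_(n * k).+1) <= v].
  by exists v.
have : [set y : Fc_structure A | (y : 'I_N.+1) <= w] (f (inord v : 'I_(n * k).+1)).
  by rewrite -E; exists (inord v : 'I_(n * k).+1) => //=; rewrite inordK.
rewrite /= => Fw.
have xN : x < N.+1 by have := value_le v; lia.
have : [set y : Fc_structure A | (y : 'I_N.+1) <= w] (Ordinal xN : 'I_N.+1).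
  by rewrite /=; apply: leq_trans xF Fw.
rewrite -E => -[u /= uv fu]; exists u => //.
by rewrite /value inord_val fu.
Qed.

Lemma value0 : F 0 = 0.
Proof. by have [u] := value_segment (leq0n _) (leq0n (F 0)); rewrite leqn0 => /eqP ->. Qed.

Lemma valueS v : 0 < v <= n * k ->
  F v = F (lexpar k v) \/ 0 < F v /\ par (F v) = F (lexpar k v).
Proof.
move=> /andP[v0 vn]; have [[_ _ rf] _] := ef.
have pv := lexpar_lt k v0.
have : @Rrel (Fc_structure A) (f (inord (lexpar k v) : 'I_(n * k).+1)) (f (inord v : 'I_(n * k).+1)).
  apply/rf; do 2 eexists; split; [reflexivity|reflexivity|].
  apply/tree_rel; right; rewrite !inordK //; lia.
by case/tree_rel => [E|[? E]]; [left; rewrite /value E|right].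
Qed.

Lemma value_surj x : x <= N -> exists2 u, u <= n * k & F u = x.
Proof.
move=> xN; have [[_ sf _] _] := ef.
have [u fu] := sf (Ordinal (xN : x < N.+1) : 'I_N.+1).
exists (u : 'I_(n * k).+1); first by rewrite -ltnS ltn_ord.
by rewrite /value inord_val fu.
Qed.

(** Only the bound on the ends of the letters needs the gap condition on
par.  A letter ending two above what had been reached would pass through
S.+1 and S.+2, but the parent of S.+2 is not S.+1. *)
Lemma epi_word_of_epi : epi_word par N (0 :: nseq n k) (word_of_epi f).
Proof.
have hk j : j < n -> nth 0 (0 :: nseq n k) j.+1 = k by move=> jn; rewrite /= nth_nseq jn.
have tp j : j < n -> treepath par (word_of_epi f j.+1) k.
  move=> jn; split=> [|h hk']; first by rewrite /= /lex_code /= value0.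
  have vn : 0 < lex_code k j h.+1 <= n * k by rewrite lex_code_le // /lex_code /=; lia.
  by have := valueS vn; rewrite lexpar_lex_code.
have bound j u : j <= n -> u <= j * k -> F u <= reached (word_of_epi f) (0 :: nseq n k) j.+1.
  move=> jn uj; case: (posnP u) => [->|u0]; first by rewrite value0.
  have [|d1 d2] := @div_lt k j u; first by rewrite u0.
  rewrite -{1}(lex_code_div k u0) -/(word_of_epi f (u.-1 %/ k).+1 _).
  have dn : u.-1 %/ k < n by lia.
  apply: leq_trans (treepath_leq par_lt (tp _ dn) d2 (leqnn k)) _.
  apply: (@leq_trans (reached (word_of_epi f) (0 :: nseq n k) (u.-1 %/ k).+2)).
    by rewrite reachedS hk // leq_max leqnn orbT.
  by apply: reached_mono; lia.
split=> [[|j]|].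
- by move=> _; rewrite /=; split=> //; split.
- rewrite [size _]/= size_nseq ltnS => jn; rewrite hk //; split; first exact: tp.
  set S := reached _ _ _.
  suff H h : h <= k -> word_of_epi f j.+1 h <= S.+1 by apply: (H k).
  elim: h => [_|h IH hk']; first by rewrite /= /lex_code /= value0.
  have IHh := IH (ltnW hk').
  have vn : 0 < lex_code k j h.+1 <= n * k by rewrite lex_code_le // /lex_code /=; lia.
  have prev u : u < lex_code k j h.+1 -> F u <= S.+1.
    rewrite /lex_code /= addnS ltnS => uv; have [le|lt] := leqP u (j * k).
      by apply: leqW; apply: bound => //; exact: ltnW.
    have -> : u = lex_code k j (u - j * k) by rewrite /lex_code ifF; lia.
    apply: leq_trans IHh; apply: (treepath_leq par_lt (tp j jn)); lia.
  have [E|[F0 E]] := valueS vn; first by rewrite /= E lexpar_lex_code.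
  rewrite lexpar_lex_code // in E.
  have seg x : x < F (lex_code k j h.+1) -> exists2 u, u < lex_code k j h.+1 & F u = x.
    move=> xF; have [|u uv fu] := @value_segment _ x _ (ltnW xF); first by case/andP: vn.
    by exists u => //; rewrite ltn_neqAle uv andbT; apply/eqP => uE; move: xF; rewrite -fu uE ltnn.
  rewrite leqNgt; apply/negP => big; rewrite /= in big.
  have FE : F (lex_code k j h.+1) = S.+2.
    apply/eqP; rewrite eqn_leq big andbT leqNgt; apply/negP => lt.
    by have [u /prev + fu] := seg _ lt; rewrite fu ltnn.
  have [|u ult fu] := seg S.+1; first by rewrite FE.
  have jku : j * k < u.
    by rewrite ltnNge; apply/negP => /(bound j u (ltnW jn)); rewrite fu ltnn.
  have ule : F u <= F (lex_code k j h).
    have -> : u = lex_code k j (u - j * k) by rewrite /lex_code ifF; lia.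
    apply: (treepath_leq par_lt (tp j jn)); last exact: ltnW.
    by move: ult; rewrite /lex_code /=; lia.
  rewrite fu -E FE in ule.
  by have := par_gap S.+2; lia.
- apply/eqP; rewrite eqn_leq /= size_nseq; apply/andP; split.
    apply/bigmax_leqP => -[[|j] jn] _ //=; exact: value_le.
  have [u un <-] := value_surj (leqnn N); exact: bound.
Qed.

End Epi.

Definition target_code j x := if j is j'.+1 then lex_code k j' x else 0.

Lemma word_of_epi_target f j x : chain_epimorphism f -> word_of_epi f j x = value f (target_code j x).
Proof. by case: j => //= ef; rewrite value0. Qed.

End Words.

(** If values rise by at most one above the previous maximum, then the image of
an initial segment is an initial segment. *)
Lemma rigid_image (F : nat -> nat) M : F 0 = 0 ->
  (forall v, v < M -> F v.+1 <= (\max_(u < v.+1) F u).+1) ->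
  forall v x, v <= M -> x <= \max_(u < v.+1) F u -> exists2 u, u <= v & F u = x.
Proof.
move=> F0 FS; elim=> [|v IH] x vM.
  by rewrite big_ord_recr big_ord0 /= F0 maxnn leqn0 => /eqP ->; exists 0.
rewrite big_ord_recr /= => xm; have [le|lt] := leqP x (\max_(u < v.+1) F u).
  by have [u uv <-] := IH x (ltnW vM) le; exists u => //; exact: leqW.
exists v.+1 => //; move: (FS v vM) lt xm; move: (\max_(u < v.+1) F u) => S; lia.
Qed.

Section Substructure.
Variables (cs : seq nat) (n k : nat) (g : block_map).
Hypothesis k0 : 0 < k.
Hypothesis vg : valid_block_map (0 :: cs) (0 :: nseq n k) g.
Let K := (sumn cs).+1.
Let m := size cs.

(** The map of blocks g on numbered vertices.  All source blocks are padded to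
the common height K, along which block j waits after its own height
nth 0 cs j. *)
Definition image_code v := if v is 0 then 0 else
  target_code k (g (v.-1 %/ K).+1).1
    ((g (v.-1 %/ K).+1).2 (minn (v.-1 %% K).+1 (nth 0 cs (v.-1 %/ K)))).

Lemma nth_hs j : 0 < j < n.+1 -> nth 0 (0 :: nseq n k) j = k.
Proof. by case: j => // j; rewrite /= nth_nseq ltnS => ->. Qed.

Lemma image_code_code j h : j < m -> h <= K ->
  image_code (lex_code K j h) = target_code k (g j.+1).1 ((g j.+1).2 (minn h (nth 0 cs j))).
Proof.
move=> jm; case: h => [_|h hk].
  have [/(_ j.+1 jm)[[g0 _] _] _] := vg.
  by rewrite min0n g0 /target_code; case: (g _).1.
have [c1 c2] := lex_code_divK j hk.
case ec : (lex_code K j h.+1) => [|v]; first by move: ec; rewrite /lex_code /=; lia.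
by rewrite /image_code -ec c1 c2.
Qed.

Lemma target_code_le j x : j < n.+1 -> x <= nth 0 (0 :: nseq n k) j -> target_code k j x <= j * k.
Proof.
by case: j => // j jn; rewrite nth_hs // => xk; rewrite /target_code lex_code_le.
Qed.

Lemma letter_le j h : j < m -> [/\ (g j.+1).1 < n.+1 &
  (g j.+1).2 (minn h (nth 0 cs j)) <= nth 0 (0 :: nseq n k) (g j.+1).1].
Proof.
move=> jm; have := valid_block_map_target vg (j := j.+1); rewrite /= size_nseq => tg; split; first exact: tg.
by apply: (valid_block_map_range vg) => //=; rewrite geq_minr.
Qed.

Lemma image_code_le v : v <= m * K -> image_code v <= n * k.
Proof.
case: (posnP v) => [->//|v0 vm]; have [|d1 d2] := @div_lt K m v; first by rewrite v0.
rewrite -(lex_code_div K v0) image_code_code //.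
have [l1 l2] := letter_le (v.-1 %% K).+1 d1.
by apply: leq_trans (target_code_le l1 l2) _; rewrite leq_mul2r; lia.
Qed.

Lemma image_code_step j h : j < m -> h < K ->
  image_code (lex_code K j h.+1) = image_code (lex_code K j h) \/
  exists j' x, [/\ (g j.+1).1 = j'.+1, x < k, image_code (lex_code K j h) = lex_code k j' x &
    image_code (lex_code K j h.+1) = lex_code k j' x.+1].
Proof.
move=> jm hK; rewrite !image_code_code //; last exact: ltnW.
have [/(_ j.+1 jm)[[_ gS] _] _] := vg; rewrite /= in gS.
have [l1 l2] := letter_le h.+1 jm.
have [hc|ch] := ltnP h (nth 0 cs j); last first.
  by left; rewrite (minn_idPr (leqW ch)).
rewrite (minn_idPl hc) in l2 *.
have [->|[p e]] := gS h hc; first by left.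
case ej : (g j.+1).1 l1 l2 => [|j'] l1 l2; first by left.
have eS : (g j.+1).2 h.+1 = ((g j.+1).2 h).+1 by lia.
right; exists j', ((g j.+1).2 h); split=> //; last by rewrite /= eS.
by move: l2; rewrite nth_hs // eS.
Qed.

Definition image_max v := \max_(u < v.+1) image_code u.

Lemma image_max_ub u w : u <= w -> image_code u <= image_max w.
Proof.
by move=> uw; exact: (@leq_bigmax _ (fun i : 'I_w.+1 => image_code i) (Ordinal (uw : u < w.+1))).
Qed.

Lemma image_max_mono u w : u <= w -> image_max u <= image_max w.
Proof.
move=> uw; apply/bigmax_leqP => -[i iu] _ /=; apply: image_max_ub; lia.
Qed.

(** Before branch j all target blocks counted by mc have been covered; the
block of height 0 accounts for the predecessor. *)
Lemma image_max_blocks mc j : discovery_counter (0 :: cs) (0 :: nseq n k) g mc -> j <= m ->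
  0 < mc j.+1 /\ (mc j.+1).-1 * k <= image_max (j * K).
Proof.
move=> [c0 cN cS]; elim: j => [_|j IH jm].
  have [[]|[_ -> _]] := cS 0 (ltn0Sn _); first by rewrite c0.
  by rewrite c0.
have [i1 i2] := IH (ltnW jm).
have le : image_max (j * K) <= image_max (j.+1 * K) by apply: image_max_mono; rewrite leq_mul2r leqnSn orbT.
have [[lt ->]|[e -> e2]] := cS j.+1 jm; first by split=> //; exact: leq_trans le.
split=> //=.
have [l1 l2] := letter_le K jm; rewrite e in l1.
have cK : nth 0 cs j <= K by rewrite leqW // leq_nth_sumn.
have := image_code_code jm (leqnn K); rewrite (minn_idPr cK) e.
rewrite (_ : (g j.+1).2 (nth 0 cs j) = k); last first.
  by rewrite /= in e2; rewrite e2 -/(nth 0 (0 :: nseq n k) _) nth_hs // i1.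
move=> E; apply: (@leq_trans (image_code (lex_code K j K))).
  rewrite E; case: (mc j.+1) i1 => // M _ /=; rewrite /lex_code (_ : (k == 0) = false); lia.
by apply: image_max_ub; rewrite /lex_code /=; lia.
Qed.

Lemma image_code_rigid v : v < m * K -> image_code v.+1 <= (image_max v).+1.
Proof.
move=> vm; have [gp [mc cm]] := vg; have [c0 cN cS] := cm.
have [|d1 d2] := @div_lt K m v.+1; first by [].
have ev : lex_code K (v %/ K) (v %% K).+1 = v.+1 := lex_code_div K (ltn0Sn v).
move: d1 d2 ev; rewrite [v.+1.-1]/=; move: (v %/ K) (v %% K) => j h d1 d2 ev.
have [i1 i2] := image_max_blocks cm (ltnW d1).
have jv : lex_code K j h <= v.
  by move: ev; rewrite /lex_code /=; case: ifP => // _; lia.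
have jKv : j * K <= v by move: ev; rewrite /lex_code /=; lia.
have prev := image_max_ub jv.
have start := image_max_mono jKv.
rewrite -ev; have [->|[j' [x [ej xk E1 ->]]]] := image_code_step d1 d2; first exact: leqW.
have [[lt _]|[e _ _]] := cS j.+1 d1.
  rewrite ej in lt; apply: leqW; apply: leq_trans start; apply: leq_trans i2.
  by rewrite /lex_code /=; nia.
rewrite E1 in prev; case: (posnP x) prev => [-> _|x0]; rewrite /lex_code /=; last first.
  by rewrite ifF; lia.
rewrite addn1 ltnS; apply: leq_trans start; apply: leq_trans i2.
by rewrite -e ej.
Qed.

Lemma image_max_end : n * k <= image_max (m * K).
Proof.
have [_ [mc cm]] := vg; have [_ i2] := image_max_blocks cm (leqnn m).
by have [_ cN _] := cm; move: i2; rewrite [mc _]cN /= size_nseq.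
Qed.

Definition substructure_map (v : 'I_(m * K).+1) : 'I_(n * k).+1 := inord (image_code v).

Lemma substructure_epi :
  @chain_epimorphism (Fc_structure (lex_Fc m K)) (Fc_structure (lex_Fc n k)) substructure_map.
Proof.
pose f v : lex_Fc n k := inord (image_code v).
have fE v : v <= m * K -> (f v : 'I_(n * k).+1) = image_code v :> nat.
  by move=> vm; rewrite /f inordK // ltnS image_code_le.
have seg := rigid_image (erefl (image_code 0)) image_code_rigid.
have -> : substructure_map = (fun v : 'I_(m * K).+1 => f v) by [].
apply: tree_epimorphism.
- by apply: val_inj; rewrite /= inordK.
- move=> v /andP[v0 vm].
  have [|d1 d2] := @div_lt K m v; first by rewrite v0.
  have pv := lexpar_lt K v0.
  have := image_code_step d1 d2; rewrite -(lexpar_lex_code _ d2) lex_code_div //.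
  case=> [e|[j' [x [_ xk e1 e2]]]]; first by left; rewrite /f e.
  right; apply: tree_root_path; rewrite !fE //; try by lia.
    by rewrite e2 /lex_code addnS.
  by rewrite e2 lexpar_lex_code.
- move=> a; have [||u um ua] := seg (m * K) (a : 'I_(n * k).+1) => //.
    by apply: leq_trans image_max_end; rewrite -ltnS ltn_ord.
  by exists u => //; rewrite /f ua inord_val.
- move=> v vm; exists (minn (image_max v) (n * k)); first exact: geq_minr.
  apply/seteqP; split=> [_ [u /= uv <-]|a /= av].
    rewrite fE; last exact: leq_trans vm.
    by rewrite leq_min image_max_ub //= image_code_le // (leq_trans uv).
  have [|u uv ua] := seg v (a : 'I_(n * k).+1) vm.
    by apply: leq_trans av _; exact: geq_minl.
  by exists u => //; rewrite /f ua inord_val.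
Qed.

End Substructure.

(** The Ramsey theorem for words, carried over to epimorphisms: those onto the
tree are words, and the block map given by [ramsey_words] is an epimorphism of
fans. *)
Theorem fan_ramsey par N (par_lt : forall v, 0 < v -> par v < v)
    (par_inj : forall u u', 0 < par u -> par u = par u' -> u = u')
    (par_gap : forall v, par v = 0 \/ (par v).+1 < v) n k (R : finType) : 0 < k ->
  let A := Fc_structure (tree_Fc N par_lt par_inj) in
  exists C : Fc, forall c : (Fc_structure C -> A) -> R,
  exists g : Fc_structure C -> Fc_structure (lex_Fc n k), chain_epimorphism g /\
    forall a a' : Fc_structure (lex_Fc n k) -> A,
      chain_epimorphism a -> chain_epimorphism a' -> c (a \o g) = c (a' \o g).
Proof.
move=> k0 A; have [cs csP] := @ramsey_words par N (nseq n k) R par_lt.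
pose K := (sumn cs).+1; pose m := size cs.
exists (lex_Fc m K) => c.
(* the map of fans described by a word; branches wait after their own height *)
pose reading (w : nat -> nat -> nat) (v : 'I_(m * K).+1) : 'I_N.+1 :=
  inord (if (v : nat) is 0 then 0 else
    w (v.-1 %/ K).+1 (minn (v.-1 %% K).+1 (nth 0 cs (v.-1 %/ K)))).
have lc : local_colouring (0 :: cs) (fun w => c (reading w : Fc_structure (lex_Fc m K) -> A)).
  move=> w w' ww'; congr c; apply: funext => -[v vm]; rewrite /reading /=; congr inord.
  case: v vm => // v vm; have [|d1 d2] := @div_lt K m v.+1; first by [].
  by apply: ww' => //=; exact: geq_minr.
have [g [vg gP]] := csP _ lc.
exists (@substructure_map cs n k g); split; first exact: substructure_epi.
have key (a : Fc_structure (lex_Fc n k) -> A) : chain_epimorphism a ->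
    a \o @substructure_map cs n k g = reading (reindex (word_of_epi a) g) :> (Fc_structure (lex_Fc m K) -> A).
  move=> ea; apply: funext => v; apply: val_inj => /=; rewrite /reading.
  case: v => -[|v] vm; rewrite /substructure_map /image_code /=.
    by rewrite inordK //; exact: (value0 ea).
  by rewrite /reindex (word_of_epi_target _ _ ea) /value inord_val.
move=> a a' ea ea'; rewrite !key //; apply: gP; exact: epi_word_of_epi.
Qed.

(** * Projections of inverse limits *)

Section InverseLimitLift.
Variable S : inverse_sequence.
Notation A n := (Fc_structure (S n)).

Lemma bond_irrel m n (h h' : m <= n) (x : A n) : bond h x = bond h' x.
Proof. by rewrite (bool_irrelevance h h'). Qed.

(** Pairs of points are lifted step by step along the sequence, as long as a
property P can be carried along.  Level m of the limit point is read off
from level m + n, which makes sense for all m. *)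
Lemma invlim_lift n (P : forall m, A m -> A m -> Prop) (x y : A n) : P n x y ->
  (forall m (u v : A m), n <= m -> P m u v -> exists u' v' : A m.+1,
     [/\ bond (leqnSn m) u' = u, bond (leqnSn m) v' = v & P m.+1 u' v']) ->
  exists X Y : invlim S, [/\ invlim_proj n X = x, invlim_proj n Y = y &
    forall m, n <= m -> P m (invlim_proj m X) (invlim_proj m Y)].
Proof.
move=> Pxy step.
pose T i := {p : A (i + n) * A (i + n) | P _ p.1 p.2}.
have next i (t : T i) : {t' : T i.+1 | bond (leqnSn (i + n)) (sval t').1 = (sval t).1 /\
    bond (leqnSn (i + n)) (sval t').2 = (sval t).2}.
  apply: cid; have [u' [v' [e1 e2 Puv]]] := step _ _ _ (leq_addl i n) (svalP t).
  by exists (exist _ (u', v') Puv).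
pose s := nat_rect T (exist (fun p : A n * A n => P n p.1 p.2) (x, y) Pxy)
  (fun i t => sval (next i t)).
have sS i : bond (leqnSn (i + n)) (sval (s i.+1)).1 = (sval (s i)).1 /\
    bond (leqnSn (i + n)) (sval (s i.+1)).2 = (sval (s i)).2.
  exact: (svalP (next i (s i))).
have sle i j (h : i + n <= j + n) : bond h (sval (s j)).1 = (sval (s i)).1 /\
    bond h (sval (s j)).2 = (sval (s i)).2.
  have ij : i <= j by lia.
  elim: j ij h => [|j IH] ij h.
    have i0 : i = 0 by lia.
    by subst i; rewrite !bond_id.
  have [e|lt] := eqVneq i j.+1; first by subst i; rewrite !bond_id.
  have ij' : i <= j by lia.
  have h' : i + n <= j + n by lia.
  have [e1 e2] := sS j; have [f1 f2] := IH ij' h'.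
  by rewrite -(bond_comp h' (leqnSn (j + n)) h) -(bond_comp h' (leqnSn (j + n)) h) e1 e2.
have mk (pr : forall i, T i -> A (i + n))
    (prP : forall i j (h : i + n <= j + n), bond h (pr j (s j)) = pr i (s i)) :
    exists X : invlim S, forall i, invlim_proj (i + n) X = pr i (s i).
  pose X m : A m := bond (leq_addr n m) (pr m (s m)).
  have cX : coherent X.
    move=> m m' h; rewrite /X.
    have h2 : m <= m' + n by lia.
    rewrite (bond_comp h (leq_addr n m') h2).
    have h3 : m + n <= m' + n by lia.
    by rewrite -(prP _ _ h3) (bond_comp (leq_addr n m) h3 h2).
  exists (exist _ X (mem_set cX)) => i.
  exact: (prP i (i + n) (leq_addr n (i + n))).
have [X XP] := mk (fun i t => (sval t).1) (fun i j h => (sle i j h).1).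
have [Y YP] := mk (fun i t => (sval t).2) (fun i j h => (sle i j h).2).
exists X, Y; split; [exact: (XP 0)|exact: (YP 0)|].
move=> m nm; have : P _ (invlim_proj (m - n + n) X) (invlim_proj (m - n + n) Y).
  by rewrite XP YP; exact: svalP (s (m - n)).
by rewrite subnK.
Qed.

Lemma bond_rel m n (h : m <= n) (x y : A n) : Rrel x y -> Rrel (bond h x) (bond h y).
Proof.
by move=> xy; have [[_ _ rb] _] := bond_epi S h; apply/rb; exists x, y.
Qed.

Lemma invlim_proj_epi n : @chain_epimorphism (invlim_structure S) (A n) (@invlim_proj S n).
Proof.
split; [split|].
- exact: invlim_proj_continuous.
- move=> x; have [|X [Y [<- _ _]]] := @invlim_lift n (fun m u v => u = v) x x (erefl x).
    move=> m u _ nm <-; have [[_ sb _] _] := bond_epi S (leqnSn m).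
    by have [u' uu'] := sb u; exists u', u'.
  by exists X.
- move=> x1 x2; split=> [x12|[y1 [y2 [<- <- ]]]]; last exact.
  have [|X [Y [<- <- XY]]] := @invlim_lift n (fun m u v => Rrel u v) x1 x2 x12.
    move=> m u v nm uv; have [[_ _ rb] _] := bond_epi S (leqnSn m).
    by have /rb[u' [v' [? ? ?]]] := uv; exists u', v'.
  exists X, Y; split=> // m; have [/XY//|mn] := leqP n m.
  rewrite -(invlim_proj_bond (ltnW mn) X) -(invlim_proj_bond (ltnW mn) Y).
  by apply: bond_rel; exact: XY.
- by move=> C [_ _]; apply.
Qed.

(** At level m let E m be the largest member of the chain whose image in A n is
contained in D.  The bonding maps send these sets onto one another, so they
are the projections of a closed set of the limit. *)
Lemma invlim_proj_cover n (D : set (A n)) : chain_family D ->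
  exists2 C : set (invlim_structure S), chain_family C & @invlim_proj S n @` C = D.
Proof.
move=> DC.
pose E m : set (A m) := [set z | exists (h : n <= m) F,
  [/\ chain_family F, bond h @` F `<=` D & F z]].
have EC m (h : n <= m) : chain_family (E m).
  apply: chain_of_comparable.
    have [F FC FD] := chain_epi_cover (bond_epi S h) DC.
    have [z Fz] := chain_nonempty FC; exists z, h, F; split=> //.
    by rewrite FD.
  move=> C CC; have [CD|CD] := pselect (bond h @` C `<=` D).
    by left=> z Cz; exists h, C.
  right=> z [h' [F [FC FD Fz]]]; have [CF|] := chain_comparable CC FC; last exact.
  exfalso; apply: CD => _ [w Cw <-]; apply: FD; exists w; [exact: CF|exact: bond_irrel].
have Ebond m m' (nm : n <= m) (h : m <= m') : bond h @` E m' = E m.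
  apply/seteqP; split=> [_ [z [h' [F [FC FD Fz]]] <-]|z [h' [F [FC FD Fz]]]].
    exists nm, (bond h @` F); split; last by exists z.
      by have [_] := bond_epi S h; apply.
    move=> _ [_ [w Fw <-] <-]; rewrite (bond_comp nm h h'); apply: FD; by exists w.
  have [F' FC' eF] := chain_epi_cover (bond_epi S h) FC.
  have nm' : n <= m' by lia.
  move: (Fz); rewrite -eF => -[z' Fz' zz']; exists z' => //; exists nm', F'; split=> //.
  move=> _ [w Fw <-]; rewrite -(bond_comp h' h nm'); apply: FD.
  by exists (bond h w) => //; rewrite -eF; exists w.
have En : E n = D.
  apply/seteqP; split=> [z [h [F [FC FD Fz]]]|z Dz].
    by apply: FD; exists z => //; rewrite bond_id.
  exists (leqnn n), D; split=> // _ [w Dw <-]; by rewrite bond_id.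
pose C : set (invlim_structure S) := [set X | forall m, n <= m -> E m (invlim_proj m X)].
have Cproj m : n <= m -> @invlim_proj S m @` C = E m.
  move=> nm; apply/seteqP; split=> [_ [X CX <-]|x Ex]; first exact: CX.
  have [|X [_ [Xx _ XE]]] := @invlim_lift m (fun m' u v => E m' u) x x Ex.
    move=> m' u v mm' Eu; move: (Eu); rewrite -(Ebond _ _ _ (leqnSn m')); last by lia.
    have [[_ sb _] _] := bond_epi S (leqnSn m'); have [v' vv'] := sb v.
    by move=> [u' Eu' uu']; exists u', v'.
  exists X => // m' nm'; have [mm'|m'm] := leqP m m'; first exact: XE.
  rewrite -(invlim_proj_bond (ltnW m'm) X) -(Ebond _ _ nm' (ltnW m'm)).
  by exists (invlim_proj m X) => //; rewrite Xx.
exists C; last by rewrite Cproj ?En.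
split.
- have [x] := chain_nonempty DC; rewrite -En -(Cproj n (leqnn n)) => -[X CX _].
  by exists X.
- move=> X clX m nm; have [Y [CY /= YX]] := clX _ (invlim_cylinder_nbhs m X).
  by rewrite -YX; exact: CY.
- move=> m; have [nm|mn] := leqP n m; first by rewrite Cproj //; exact: EC.
  have -> : @invlim_proj S m @` C = bond (ltnW mn) @` (@invlim_proj S n @` C).
    rewrite image_comp; congr image; apply: funext => X /=.
    by rewrite invlim_proj_bond.
  by rewrite Cproj // En; have [_] := bond_epi S (ltnW mn); apply.
Qed.

End InverseLimitLift.

(** * Automorphisms of the limit *)

Lemma compact_increasing (T : topologicalType) (K : set T) (P : nat -> set T) :
  compact K -> (forall n, open (P n)) -> (forall m n, m <= n -> P m `<=` P n) ->
  (forall x, K x -> exists n, P n x) -> exists n, K `<=` P n.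
Proof.
move=> /compact_near_coveringP cK oP mP cov.
pose F : set_system nat := filter_from setT (fun n => [set i | n <= i]).
have FF : Filter F.
  apply: filter_from_filter; first by exists 0.
  by move=> m n _ _; exists (maxn m n) => // i /=; rewrite geq_max => /andP[].
have [|n _ nP] := cK nat F P FF.
  move=> x /cov[n Pnx]; exists (P n, [set i | n <= i]) => /=; last first.
    by move=> [y i] [/= Py ni]; exact: mP Py.
  by split; [exact: open_nbhs_nbhs|exists n].
by exists n; apply: nP => /=.
Qed.

Lemma compact_finite_cover (T : topologicalType) (U : T -> set T) :
  compact [set: T] -> (forall x, nbhs x (U x)) ->
  exists s : seq T, forall y, exists2 x, x \in s & U x y.
Proof.
move=> /compact_near_coveringP cT nU.
pose F : set_system (seq T) := filter_from setT (fun s : seq T => [set s' : seq T | {subset s <= s'}]).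
have FF : Filter F.
  apply: filter_from_filter; first by exists [::].
  move=> s1 s2 _ _; exists (s1 ++ s2) => // s ss.
  by split=> x xs; apply: ss; rewrite mem_cat xs ?orbT.
have [|s _ sP] := cT _ F (fun s y => exists2 x, x \in s & U x y) FF.
  move=> x _; exists (U x, [set s' : seq T | {subset [:: x] <= s'}]) => /=; last first.
    by move=> [y s] [/= Uy xs]; exists x => //; apply: xs; rewrite mem_head.
  by split; [exact: nU|exists [:: x]].
exists s => y; exact: (sP s (fun x xs => xs) y I).
Qed.

(** The image of a closed set is compact, hence closed. *)
Lemma continuous_bijection_inverse (X Y : topologicalType) (f : X -> Y) (g : Y -> X) :
  compact [set: X] -> hausdorff_space Y -> continuous f -> cancel f g -> cancel g f ->
  continuous g.
Proof.
move=> cX hY cf fg gf; apply/continuousP => O oO.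
have -> : g @^-1` O = ~` (f @` (~` O)).
  apply/seteqP; split=> [y /= Oy [x nOx xy]|y /= nO].
    by apply: nOx; rewrite -(fg x) xy.
  by apply: contrapT => nOy; apply: nO; exists (g y).
apply: closed_openC; apply: compact_closed => //.
apply: continuous_compact; first exact: continuous_subspaceT.
by apply: (subclosed_compact _ cX) => //; exact: open_closedC.
Qed.

Section Limit.
Variables (L : chain_structure) (S : inverse_sequence).
Variables (to_lim : L -> invlim_structure S) (of_lim : invlim_structure S -> L).
Hypothesis to_epi : chain_epimorphism to_lim.
Hypothesis of_epi : chain_epimorphism of_lim.
Hypothesis toK : cancel to_lim of_lim.
Hypothesis ofK : cancel of_lim to_lim.
Notation A n := (Fc_structure (S n)).

Definition lim_proj n (x : L) : A n := invlim_proj n (to_lim x).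

Lemma lim_proj_epi n : chain_epimorphism (@lim_proj n).
Proof. exact: (chain_epi_comp (invlim_proj_epi S n) to_epi). Qed.

Lemma lim_proj_bond m n (h : m <= n) x : bond h (lim_proj n x) = lim_proj m x.
Proof. exact: invlim_proj_bond. Qed.

Lemma lim_proj_nbhs n x : nbhs x [set y | lim_proj n y = lim_proj n x].
Proof.
have [[cp _ _] _] := lim_proj_epi n.
exact: (cp x _ (@discrete_set1 (discrete_topology (S n)) (lim_proj n x))).
Qed.

Lemma nbhs_lim_proj x (U : set L) : nbhs x U -> exists n, forall y, lim_proj n y = lim_proj n x -> U y.
Proof.
move=> nU; have [[co _ _] _] := of_epi.
have nU' : nbhs (of_lim (to_lim x)) U by rewrite toK.
have /invlim_nbhs[n nP] := co (to_lim x) U nU'.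
by exists n => y yx; rewrite -(toK y); apply: nP.
Qed.

Lemma lim_proj_open n (P : set L) : (forall x y, lim_proj n x = lim_proj n y -> P x -> P y) -> open P.
Proof.
move=> inv; rewrite openE => x Px; apply: filterS (lim_proj_nbhs n x) => y yx.
exact: inv (esym yx) Px.
Qed.

Lemma lim_proj_cover n (D : set (A n)) : chain_family D ->
  exists2 C : set L, chain_family C & @lim_proj n @` C = D.
Proof.
move=> DC; have [E EC ED] := invlim_proj_cover DC.
exists (of_lim @` E); first by have [_] := of_epi; apply.
rewrite image_comp -ED; congr image; apply: funext => x /=.
by rewrite /lim_proj ofK.
Qed.

(** The chain of the limit, described by projections without reference to the
inverse limit. *)
Lemma chain_familyP (C : set L) : chain_family C <->
  [/\ C !=set0, closed C & forall n, chain_family (@lim_proj n @` C)].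
Proof.
have [[cto _ _] cfto] := to_epi; have [[cof _ _] cfof] := of_epi.
have projE n D : @lim_proj n @` D = @invlim_proj S n @` (to_lim @` D) by rewrite image_comp.
split=> [CC|[C0 clC Cn]].
  have [[x [y Cy _]] clE En] := cfto C CC.
  split; [by exists y| |by move=> n; rewrite projE; exact: En].
  have -> : C = to_lim @^-1` (to_lim @` C).
    apply/seteqP; split=> [z Cz|z [w Cw /(congr1 of_lim)]]; first by exists z.
    by rewrite !toK => <-.
  exact: (closed_comp (fun x _ => cto x) clE).
have -> : C = of_lim @` (to_lim @` C).
  rewrite image_comp -[LHS]image_id; congr image; apply: funext => x /=.
  by rewrite toK.
apply: cfof; split.
- by case: C0 => x Cx; exists (to_lim x), x.
- apply: compact_closed; first exact: invlim_hausdorff.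
  apply: continuous_compact; first exact: continuous_subspaceT.
  by apply: (subclosed_compact clC (@Rspace_compact L)).
- by move=> n; rewrite -projE.
Qed.

(** If x in C is not in D, some projection separates x from D, and from that
level on the projection of D is contained in that of C; as C is closed, D is
contained in C. *)
Lemma chain_family_comparable (C D : set L) :
  chain_family C -> chain_family D -> C `<=` D \/ D `<=` C.
Proof.
move=> /chain_familyP[_ clC Cn] /chain_familyP[_ clD Dn].
have [|/existsNP[x /not_implyP[Cx nDx]]] := pselect (C `<=` D); first by left.
right=> y Dy; apply: clC => U /nbhs_lim_proj[m mU].
have [n nD] : exists n, forall z, lim_proj n z = lim_proj n x -> ~ D z.
  have : nbhs x (~` D) by apply: open_nbhs_nbhs; split=> //; exact: closed_openC.
  by move=> /nbhs_lim_proj.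
pose N := maxn m n.
have [CD|DC] := chain_comparable (Cn N) (Dn N).
  have [|z Dz zx] := CD (lim_proj N x); first by exists x.
  exfalso; apply: (nD z) Dz.
  by rewrite -!(lim_proj_bond (leq_maxr m n)) zx.
have [|z Cz zy] := DC (lim_proj N y); first by exists y.
exists z; split=> //; apply: mU.
by rewrite -!(lim_proj_bond (leq_maxl m n)) zy.
Qed.

(** An isomorphism is only assumed to send members of the chain to members.
The preimage of a member is closed and comparable with all members, so its
projections are members by [chain_of_comparable], and it is one itself. *)
Lemma isomorphism_automorphism (psi : L -> L) : chain_isomorphism psi -> is_automorphism psi.
Proof.
move=> [[[cpsi _ rpsi] fpsi] [h psiK hK]].
have ch : continuous h.
  exact: continuous_bijection_inverse (@Rspace_compact L) (@Rspace_hausdorff L) cpsi psiK hK.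
split=> //.
- by exists h.
- move=> x y; split=> [/rpsi[x' [y' [/(can_inj psiK) -> /(can_inj psiK) ->]]]//|xy].
  by apply/rpsi; exists x, y.
apply/seteqP; split=> [_ [C CC <-]|D DC]; first exact: fpsi.
have imK (E : set L) : psi @` (h @` E) = E.
  rewrite image_comp -[RHS]image_id; congr image; apply: funext => x /=.
  by rewrite hK.
have hD : h @` D = psi @^-1` D.
  apply/seteqP; split=> [_ [x Dx <-]|x Dx]; first by rewrite /= hK.
  by exists (psi x) => //; rewrite psiK.
exists (h @` D) => //; have [D0 clD _] := (chain_familyP D).1 DC.
apply/chain_familyP; split.
- by case: D0 => x Dx; exists (h x), x.
- by rewrite hD; exact: (closed_comp (fun x _ => cpsi x) clD).
move=> n; apply: chain_of_comparable.
  by case: D0 => x Dx; exists (lim_proj n (h x)), (h x) => //; exists x.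
move=> E EC; have [E' E'C <-] := lim_proj_cover EC.
have [sub|sub] := chain_family_comparable (fpsi _ E'C) DC.
  left; apply: image_subset => x Ex; rewrite hD /=; apply: sub; by exists x.
right; apply: image_subset => x; rewrite hD /= => /sub[z Ez /(can_inj psiK) <-].
exact: Ez.
Qed.

(** If K is compact and contained in the open set O, some projection tells every
point of K from the complement of O. *)
Lemma stabilizer_nbhs (V : set (Aut L)) : nbhs (1%g : Aut L) V ->
  exists n, forall g : Aut L, (forall x, lim_proj n (aut_fun g x) = lim_proj n x) -> V g.
Proof.
pose G n : set (Aut L) := [set g | forall x, lim_proj n (aut_fun g x) = lim_proj n x].
have Gmono m n : m <= n -> G n `<=` G m.
  by move=> mn g Gg x; rewrite -!(lim_proj_bond mn) Gg.
pose F : set_system (Aut L) := filter_from [set: nat] G.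
have FF : Filter F.
  apply: filter_from_filter; first by exists 0.
  move=> m n _ _; exists (maxn m n) => // g Gg.
  by split; apply: Gmono Gg; rewrite (leq_maxl, leq_maxr).
have F1 : F --> (1%g : Aut L).
  apply/aut_cvgP => K O cK oO KO.
  pose P n : set L := [set x | forall y, lim_proj n y = lim_proj n x -> O y].
  have [|||n nP] := @compact_increasing _ K P cK.
  - move=> n; apply: (@lim_proj_open n) => x y xy Px z zy; apply: Px.
    by rewrite zy.
  - move=> m n mn x Px y yx; apply: Px.
    by rewrite -!(lim_proj_bond mn) yx.
  - move=> x Kx; apply: nbhs_lim_proj; apply: open_nbhs_nbhs; split=> //.
    exact: (KO x Kx).
  exists n => // g Gg x Kx; apply: (nP x Kx); exact: Gg.
by move=> /F1[n _ nV]; exists n => g gP; apply: nV.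
Qed.

Lemma continuous_factor (X : choiceType) (u : L -> discrete_topology X) : continuous u ->
  exists n, forall x y, lim_proj n x = lim_proj n y -> u x = u y.
Proof.
move=> cu; pose P n : set L := [set x | forall y, lim_proj n y = lim_proj n x -> u y = u x].
have [|||n nP] := @compact_increasing _ setT P (@Rspace_compact L).
- move=> n; apply: (@lim_proj_open n) => x y xy Px z zy.
  by rewrite (Px z) ?(Px y) // zy.
- move=> m n mn x Px y yx; apply: Px.
  by rewrite -!(lim_proj_bond mn) yx.
- move=> x _; apply: nbhs_lim_proj.
  exact: (cu x _ (@discrete_set1 (discrete_topology X) (u x))).
by exists n => x y xy; apply: (nP y I).
Qed.

Lemma epi_factor (B : Fc) (u : L -> Fc_structure B) n : chain_epimorphism u ->
  (forall x y, lim_proj n x = lim_proj n y -> u x = u y) ->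
  exists2 a : A n -> Fc_structure B, chain_epimorphism a & u = a \o @lim_proj n.
Proof.
move=> [[cu su ru] fu] inv; have [[cp sp rp] fp] := lim_proj_epi n.
have [s sP] := choice sp.
pose a z := u (s z).
have au : u = a \o @lim_proj n by apply: funext => x /=; apply: inv; rewrite sP.
exists a => //; split; [split|].
- exact: (@discrete_continuous (discrete_topology (S n))).
- by move=> x; have [y <-] := su x; exists (lim_proj n y); rewrite [in RHS]au.
- move=> x1 x2; split=> [/ru[y1 [y2 [<- <- y12]]]|[z1 [z2 [<- <- /rp[y1 [y2 [<- <- y12]]]]]]].
    exists (lim_proj n y1), (lim_proj n y2); split; [by rewrite [in RHS]au|by rewrite [in RHS]au|].
    by apply/rp; exists y1, y2.
  by apply/ru; exists y1, y2; split=> //; rewrite [in LHS]au.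
- move=> C CC; have [C' C'C <-] := lim_proj_cover CC.
  rewrite image_comp; have := fu C' C'C; rewrite [in X in X -> _]au; exact.
Qed.

End Limit.

(** * Extreme amenability *)

(** Continuity of the action at (1, x) allows both y and g y to be perturbed by
group elements near 1 while they stay in disjoint neighbourhoods of x and of
its image. *)
Lemma moved_point_neighbourhoods (G : topologicalGroupType) (X : topologicalType)
    (act : G -> X -> X) (g : G) (x : X) :
  hausdorff_space X -> continuous_action act -> act g x <> x ->
  exists U V, [/\ nbhs x U, nbhs (1%g : G) V &
    forall v w y z, V v -> V w -> U y -> U z -> act (g * v)%g y <> act w z].
Proof.
move=> hX [act1 actM cact] gx.
have cg : {for x, continuous (act g)}.
  have c1 : continuous (fun y : X => (g, y)).
    by move=> y; apply: cvg_pair; [exact: cvg_cst|exact: cvg_id].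
  exact: (continuous_comp (c1 x) (cact (g, x))).
have [[O1 O2] [O1x O2x] O12] : exists2 P : set X * set X,
    nbhs (act g x) P.1 /\ nbhs x P.2 & P.1 `&` P.2 = set0.
  apply: contrapT => no; apply: gx; apply: hX => B1 B2 B1x B2x.
  by apply/set0P/negP => /eqP e; apply: no; exists (B1, B2).
have n1 : nbhs ((1%g : G), x) (fun p => O2 (act p.1 p.2)).
  by apply: (cact (1%g, x)); rewrite /= act1.
have n2 : nbhs ((1%g : G), x) (fun p => O1 (act g (act p.1 p.2))).
  apply: (cact (1%g, x) (fun y => O1 (act g y))); rewrite /= act1; exact: cg.
have [[V1 U1] [V11 U11] VU1] := n1; have [[V2 U2] [V21 U21] VU2] := n2.
exists (U1 `&` U2), (V1 `&` V2); split; [exact: filterI|exact: filterI|].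
move=> v w y z [_ Vv] [Vw _] [_ Uy] [Uz _] e.
have h1 : O1 (act (g * v)%g y) by rewrite actM; exact: (VU2 (v, y)).
have h2 : O2 (act w z) by exact: (VU1 (w, z)).
have : (O1 `&` O2) (act w z) by split; [rewrite -e|].
by rewrite [O1 `&` O2]O12.
Qed.

(** Every finite colouring of G is constant, up to left multiplication by
elements of V, on a right translate of any given finite set. *)
Definition oscillation_stable (G : topologicalGroupType) :=
  forall (V : set G) (gs : seq G) (R : finType) (c : G -> R), nbhs (1%g : G) V ->
  exists b r, forall a, a \in gs ->
    exists v b', [/\ V v, c b' = r & (a * b)%g = (v * b')%g].

(** A group element b is coloured by a member of the finite cover that
contains b x0. *)
Lemma oscillation_stable_extremely_amenable (G : topologicalGroupType) :
  oscillation_stable G -> extremely_amenable G.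
Proof.
move=> stable X act [x0 _] cX hX cact; have [act1 actM _] := cact.
apply: contrapT => /forallNP nofix.
have [g gP] : exists g : X -> G, forall x, act (g x) x <> x.
  suff /choice[g gP] : forall x, exists g, act g x <> x by exists g.
  by move=> x; apply/existsNP; exact: nofix.
pose good x (UV : set X * set G) := [/\ nbhs x UV.1, nbhs (1%g : G) UV.2 &
    forall v w y z, UV.2 v -> UV.2 w -> UV.1 y -> UV.1 z -> act (g x * v)%g y <> act w z].
have [UV UVP] : exists UV : X -> set X * set G, forall x, good x (UV x).
  suff /choice[UV UVP] : forall x, exists UV, good x UV by exists UV.
  move=> x; have [U [V [? ? ?]]] := moved_point_neighbourhoods hX cact (gP x).
  by exists (U, V).
have [|s sP] := compact_finite_cover (U := fun x => (UV x).1) cX.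
  by move=> x; have [] := UVP x.
have nV : nbhs (1%g : G) [set v | forall y, y \in s -> (UV y).2 v].
  elim: (s) => [|y t IH]; first by apply: filterS filterT.
  have [_ Vy _] := UVP y; apply: filterS (filterI Vy IH) => v [yv tv] z.
  by rewrite inE => /predU1P[->|/tv].
have [ind indP] : exists ind : X -> X, forall y, ind y \in s /\ (UV (ind y)).1 y.
  suff /choice[ind indP] : forall y, exists x, x \in s /\ (UV x).1 y by exists ind.
  by move=> y; have [x ? ?] := sP y; exists x.
have [b [r rP]] := stable _ (1%g :: map g s) (seq_sub s)
  (fun b => SeqSub (indP (act b x0)).1) nV.
have colour b' : SeqSub (indP (act b' x0)).1 = r -> (UV (ssval r)).1 (act b' x0).
  by move=> <-; exact: (indP _).2.
have rs : ssval r \in s by exact: ssvalP.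
have [v [b1 [/(_ _ rs) Vv /colour U1 e1]]] := rP 1%g (mem_head _ _).
have [|w [b2 [/(_ _ rs) Vw /colour U2 e2]]] := rP (g (ssval r)).
  by rewrite inE map_f ?orbT.
have [_ _ disj] := UVP (ssval r); apply: (disj v w _ _ Vv Vw U1 U2).
by rewrite -!actM -mulgA -e1 mul1g e2.
Qed.

Lemma aut_chain_epi (L : chain_structure) (a : Aut L) : @chain_epimorphism L L (aut_fun a).
Proof.
have [ca [b [cb aK bK]] Ra La] := autP a; split; [split=> //|].
- by move=> x; exists (b x).
- move=> x1 x2; split=> [x12|[y1 [y2 [<- <- y12]]]]; last exact/Ra.
  by exists (b x1), (b x2); split=> //; apply/Ra; rewrite !bK.
- by move=> C CC; rewrite -La; exists C.
Qed.

(** A neighbourhood of 1 contains the stabilizer of an epimorphism phi onto a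
spread fan A.  For a in gs, the map phi a factors through a finite quotient of
the limit, hence [fan_ramsey] applies to the epimorphisms onto A; its
substructure is realized by an automorphism b through homogeneity.  Two group
elements with the same composite with phi differ on the left by an element
of the stabilizer. *)
Lemma Lc_oscillation_stable (L : chain_structure) : is_Lc L -> oscillation_stable (Aut L).
Proof.
move=> [[S [f [h [ef eh fK hK]]]] univ _ hom] V gs R c nV.
have [n nP] := stabilizer_nbhs ef eh fK nV.
have aut_of (psi : L -> L) : chain_isomorphism psi -> exists a : Aut L, aut_fun a = psi.
  by move=> ip; exists (mkAut (isomorphism_automorphism ef eh fK hK ip)).
have [N [k [rho [k0 erho]]]] := lex_cover (S n).
have [sig esig] := spread_cover N k.
pose A := Fc_structure (spread_Fc N k).
(* phi maps onto a spread fan and refines the projection to level n *)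
have [phi [ephi phiP]] : exists phi : L -> A, chain_epimorphism phi /\
    forall x y, phi x = phi y -> lim_proj f n x = lim_proj f n y.
  have [th eth] := univ (spread_Fc N k).
  have [psi [ipsi e]] := hom _ _ _ (chain_epi_comp (chain_epi_comp erho esig) eth)
    (lim_proj_epi ef n).
  exists (th \o psi); split; first by apply: chain_epi_comp eth _; case: ipsi.
  by move=> x y xy; rewrite e /=; congr (rho (sig _)).
have epi_aut (a : Aut L) : chain_epimorphism (phi \o aut_fun a).
  exact: chain_epi_comp ephi (aut_chain_epi a).
(* by homogeneity every epimorphism onto A is phi composed with an automorphism *)
have [rep repP] : exists rep : (L -> A) -> Aut L,
    forall e, chain_epimorphism e -> e = phi \o aut_fun (rep e).
  suff /choice[rep repP] : forall e, exists a : Aut L,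
      chain_epimorphism e -> e = phi \o aut_fun a by exists rep.
  move=> e; have [ee|ne] := pselect (chain_epimorphism e); last by exists 1%g.
  have [psi [ipsi ->]] := hom _ _ _ ephi ee.
  by have [a <-] := aut_of psi ipsi; exists a.
(* a level through which all the maps phi a factor *)
have [m mP] : exists m, forall a, a \in gs -> forall x y,
    lim_proj f m x = lim_proj f m y -> phi (aut_fun a x) = phi (aut_fun a y).
  elim: (gs) => [|a t [m mP]]; first by exists 0.
  have [[ce _ _] _] := epi_aut a.
  have [m' m'P] := continuous_factor ef eh fK ce.
  exists (maxn m m') => b; rewrite inE => /predU1P[->|bt] x y xy.
    by apply: m'P; rewrite -!(lim_proj_bond _ (leq_maxr m m')) xy.
  by apply: (mP _ bt); rewrite -!(lim_proj_bond _ (leq_maxl m m')) xy.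
have [N' [k' [rho' [k'0 erho']]]] := lex_cover (S m).
have [C CP] := @fan_ramsey (spread_par k) (N * k).*2 (@spread_par_lt k) (@spread_par_inj k)
  (@spread_par_gap k) N' k' R k'0.
have [th eth] := univ C.
have [gam [egam gamP]] := CP (fun d => c (rep (d \o th))).
have [psi [ipsi e]] := hom _ _ _ (lim_proj_epi ef m)
  (chain_epi_comp (chain_epi_comp erho' egam) eth).
have [b bpsi] := aut_of psi ipsi.
have factor a : a \in gs -> exists2 al, chain_epimorphism al &
    phi \o aut_fun (a * b)%g = (al \o gam) \o th.
  move=> ags; have [al eal E] := epi_factor ef eh hK (epi_aut a) (mP a ags).
  exists (al \o rho'); first exact: chain_epi_comp.
  have -> : phi \o aut_fun (a * b)%g = (phi \o aut_fun a) \o psi by rewrite -bpsi.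
  rewrite E; apply: funext => x.
  by have /(congr1 (fun F => F x)) /= <- := e.
have [r rP] : exists r, forall a, a \in gs -> c (rep (phi \o aut_fun (a * b)%g)) = r.
  case: gs {mP} factor => [|a gs] factor; first by exists (c 1%g).
  have [al eal eqa] := factor a (mem_head _ _).
  exists (c (rep (phi \o aut_fun (a * b)%g))) => a' /factor[al' eal' ->].
  by rewrite eqa; exact: gamP.
exists b, r => a ags; pose b' := rep (phi \o aut_fun (a * b)%g).
exists (a * b * b'^-1)%g, b'; split; [|exact: rP|by rewrite -!mulgA mulVg !mulg1].
apply: nP => x; apply: phiP; pose y := aut_fun (aut_inv b') x.
have /(congr1 (fun F => F y)) /= := repP _ (epi_aut (a * b)%g).
by rewrite /y -/b' aut_invVK.
Qed.

Theorem corollary4p10 (L : chain_structure) :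
  is_Lc L -> extremely_amenable (Aut L).
Proof.
by move=> /Lc_oscillation_stable; exact: oscillation_stable_extremely_amenable.
Qed.
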